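(* Let $D_h\subset\mathbb C^2$ be a balanced pseudoconvex domain with $h\not\equiv0$. Then $L_h^2(D_h)$ contains all (holomorphic) polynomials in $z_1,z_2$ if and only if $\nu(\log h,[v])=0$ for all $[v]\in\mathbb P^1$.
   Context: A balanced domain is $D_h:=\{z\in\mathbb C^2:h(z)<1\}$ where $h:\mathbb C^2\to[0,\infty)$ is upper semicontinuous and homogeneous, i.e. $h(\lambda z)=|\lambda|h(z)$ for $\lambda\in\mathbb C$, $z\in\mathbb C^2$; $D_h$ is pseudoconvex iff $\log h$ is plurisubharmonic. $L_h^2(D):=L^2(D)\cap\mathcal O(D)$ (Lebesgue measure). For a subharmonic function $u\not\equiv-\infty$ on a domain in $\mathbb C$ and a point $z_0$ of the domain, the Lelong number is $\nu(u,z_0):=\lim_{r\to0^+}\frac{\max_{|\lambda|=r}u(z_0+\lambda)}{\log r}$. For $[v]\in\mathbb P^1$ (complex projective line, $v=(v_1,v_2)\in\mathbb C^2\setminus\{0\}$) put $\nu(\log h,[v]):=\nu(\log h(\cdot,v_2),v_1)$ if $v_2\ne0$, and $\nu(\log h,[v]):=\nu(\log h(v_1,\cdot),v_2)$ if $v_1\neq 0$; this is well defined (independent of the representative and of which non-zero coordinate is used). *)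

(* Defs.v *)
From HB Require Import structures.
From mathcomp Require Export all_boot all_order all_algebra.
From mathcomp Require Export complex.
From mathcomp Require Export all_classical all_reals all_analysis.
From mathcomp Require Export measurable_realfun.

Set Implicit Arguments.
Unset Strict Implicit.
Unset Printing Implicit Defensive.

Export Order.TTheory GRing.Theory Num.Theory.
Export numFieldNormedType.Exports.

Global Open Scope classical_set_scope.
Global Open Scope ring_scope.
Global Open Scope complex_scope.

(* R[i]^o carries the topology and the complex normed module structure. *)
Notation C1 R := (R[i]^o).
Notation C2 R := (R[i]^o * R[i]^o)%type.

Definition upper_semicontinuous {R : realType} {X : topologicalType}
    (u : X -> \bar R) : Prop :=
  lower_semicontinuous (fun x => (- u x)%E).

Definition circle_mean {R : realType} (u : C1 R -> \bar R) (a : R[i]) (r : R) :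
    \bar R :=
  (((2 * pi)^-1)%:E *
   \int[lebesgue_measure]_(t in `[0%R, (2 * pi)%R])
     u (a + r%:C * (cos t +i* sin t))%R)%E.

(* Subharmonicity on the whole plane, for functions with values in            *)
(* [-oo, +oo); the function identically -oo is allowed. The integral is       *)
(* meaningful since u is bounded above on circles.                            *)
Definition subharmonic {R : realType} (u : C1 R -> \bar R) : Prop :=
  [/\ forall z, (u z < +oo)%E,
      upper_semicontinuous u &
      forall (a : R[i]) (r : R), 0 < r -> (u a <= circle_mean u a r)%E].

Definition plurisubharmonic {R : realType} (u : C2 R -> \bar R) : Prop :=
  [/\ forall z, (u z < +oo)%E,
      upper_semicontinuous u &
      forall a b : C2 R, subharmonic (fun l : C1 R => u (a + l *: b))].

(* log h, with log 0 = -oo. *)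
Definition log_fun {R : realType} (h : C2 R -> R) (z : C2 R) : \bar R :=
  lne (h z)%:E.

Definition homogeneous_gauge {R : realType} (h : C2 R -> R) : Prop :=
  [/\ forall z, 0 <= h z,
      upper_semicontinuous (fun z : C2 R => (h z)%:E) &
      forall (l : R[i]) (z : C2 R), h (l *: z) = Normc.normc l * h z].

Definition balanced_domain {R : realType} (h : C2 R -> R) : set (C2 R) :=
  [set z | h z < 1].

(* Pseudoconvexity of balanced_domain h, for a homogeneous gauge h: by the    *)
(* standard criterion for balanced domains it means that log h is             *)
(* plurisubharmonic.                                                          *)
Definition pseudoconvex_gauge {R : realType} (h : C2 R -> R) : Prop :=
  plurisubharmonic (log_fun h).

(* Complex Frechet differentiability at every point of D (meant for D open). *)
Definition holomorphic_on {R : realType} (D : set (C2 R)) (f : C2 R -> C1 R) :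
    Prop :=
  forall z, D z -> differentiable f z.

(* R^2 and R^4 with their Borel sigma-algebras. *)
Notation R2 R := (measurableTypeR R * measurableTypeR R)%type.
Notation R4 R := (R2 R * R2 R)%type.

Definition of_reals {R : realType} (x : R4 R) : C2 R :=
  ((x.1.1 : R) +i* (x.1.2 : R), (x.2.1 : R) +i* (x.2.2 : R)).

Section lebesgue_R4.
Context {R : realType}.

Definition lebesgue2 : set (R2 R) -> \bar R :=
  (@lebesgue_measure R \x @lebesgue_measure R)%E.

HB.instance Definition _ := Measure.on lebesgue2.

Let lebesgue2_sigma_finite : sigma_finite setT lebesgue2.
Proof.
have /sigma_finiteP[F [TF ndF Foo]] := sigma_finiteT (@lebesgue_measure R).
exists (fun n => F n `*` F n).
  rewrite -setXTT TF predeqE => -[x y]; split.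
    move=> [/= [n _ Fnx] [k _ Fky]]; exists (maxn n k) => //; split.
    - by move: x Fnx; exact/subsetPset/ndF/leq_maxl.
    - by move: y Fky; exact/subsetPset/ndF/leq_maxr.
  by move=> [n _ []/= ? ?]; split; exists n.
move=> k; have [? ?] := Foo k.
split; first exact: measurableX.
by rewrite /lebesgue2 product_measure1E// lte_mul_pinfty// ge0_fin_numE.
Qed.

HB.instance Definition _ :=
  Measure_isSigmaFinite.Build _ _ _ lebesgue2 lebesgue2_sigma_finite.

Definition lebesgue4 : set (R4 R) -> \bar R := (lebesgue2 \x lebesgue2)%E.

HB.instance Definition _ := Measure.on lebesgue4.

End lebesgue_R4.

Definition square_integrable_on {R : realType} (D : set (C2 R))
    (f : C2 R -> C1 R) : Prop :=
  let D' : set (R4 R) := of_reals @^-1` D in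
  [/\ measurable_fun D' (fun x : R4 R => complex.Re (f (of_reals x))),
      measurable_fun D' (fun x : R4 R => complex.Im (f (of_reals x))) &
      (\int[lebesgue4]_(x in D') ((Normc.normc (f (of_reals x))) ^+ 2)%:E
         < +oo)%E].

(* Elements are represented by total functions, of which only the values on D *)
(* matter.                                                                    *)
Definition L2h {R : realType} (D : set (C2 R)) : set (C2 R -> C1 R) :=
  [set f | holomorphic_on D f /\ square_integrable_on D f].

(* The inner variable of P is z_1 and the outer one is z_2. *)
Definition poly_fun {R : realType} (P : {poly {poly R[i]}}) (z : C2 R) : C1 R :=
  (P.[(z.2 : R[i])%:P]).[z.1].

Definition circle_max {R : realType} (u : C1 R -> \bar R) (z0 : R[i]) (r : R) :
    \bar R :=
  ereal_sup [set u (z0 + l) | l in [set l : R[i] | Normc.normc l = r]].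

Definition lelong {R : realType} (u : C1 R -> \bar R) (z0 : R[i]) : \bar R :=
  lim ((circle_max u z0 r * ((ln r)^-1)%:E)%E @[r --> (0 : R)^'+]).

(* Lelong number at the point [v] of the projective line, for v != 0. When    *)
(* both coordinates of v are nonzero the two branches agree for log h.        *)
Definition lelong_proj {R : realType} (u : C2 R -> \bar R) (v : C2 R) : \bar R :=
  if v.2 != 0 then lelong (fun l => u (l, v.2)) v.1
  else lelong (fun l => u (v.1, l)) v.2.

(* Main.v *)
(* Put u = log h(., 1). If the Lelong number of u at z0 is nonzero, the maximum
   principle on annuli shows that it exists as a limit and that h(l, 1) is at most
   |l - z0|^kappa near z0 for some kappa > 0; then {|z1 / z2 - z0| < r,
   |z2| < r^-kappa} is essentially contained in D_h, and z2^b is not square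
   integrable as soon as kappa (b + 2) > 1.

   Conversely, vanishing Lelong numbers make exp (- c u) locally integrable for
   every c (Skoda). This is proved with the heat semigroup P_t applied to
   g = A + |z|^2 - u >= 0: P_d g is a sum of Gaussian averages of a smoothed Riesz
   measure of u at scales d, ..., k d, plus a bounded term. When the mass near z0 is
   small, Jensen's inequality and a logarithmic bound for the sum of the Gaussians
   bound the integral of exp (c P_d g) independently of d, and d -> 0. When it is not
   small at any scale, P_t g (z0) grows like log (1 / t), so that u has a logarithmic
   pole at z0. In the coordinates z1 = l z2 the integral of a power of 1 + |z|^2
   over the part of D_h where l is bounded is controlled by the integral of a
   negative power of h(l, 1); this chart and a small neighbourhood of l = oo cover
   D_h. *)
From HB Require Import structures.
Require Import Defs.
From mathcomp Require Import ring lra.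
Set Implicit Arguments.
Unset Strict Implicit.
Unset Printing Implicit Defensive.

(** * Integration in the plane *)

(** The Riesz measure of [u] is never built. With P_t the Gaussian average at time t, the
    nonnegative function P_d g + 4 d - P_2d g takes its place, and every quantity is an integral of
    a nonnegative function against Lebesgue measure, so that Tonelli's theorem and Fatou's lemma
    suffice. This is why [u] is replaced by g: the slices of a gauge grow at most logarithmically,
    so A + |z|^2 dominates them, and the circle means of |z|^2 are explicit, which turns the submean
    inequality into P_t g <= g + 4 t. The threshold for the mass is pi / (2 c): it reduces the
    exponential of the kernel to a multiple of |x|^(-1/2), with x the real part of the difference,
    and this is integrable in one real variable. For a polynomial P with |P|^2 <= C (1 + |z|^2)^m
    the exponent to be reached is c = 2 m + 4. Of [u] itself only upper semicontinuity and the
    submean inequality are available; the maximum principle is derived from them by averaging over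
    quarter turns, which replaces the integration of ln |z| over circles. *)

Section affine.
Context {R : realType}.
Local Notation mu := (@lebesgue_measure R).

Lemma measurable_affine (a b : R) :
  measurable_fun setT ((fun x => a * x + b) : measurableTypeR R -> measurableTypeR R).
Proof.
apply: measurable_funD => //; exact: measurable_funM.
Qed.

(** The scaled pushforward is a measure that agrees with Lebesgue measure on half-open intervals,
    and these characterise it. For [a < 0] the preimage is half-open on the other side, which does
    not change its length. *)
Lemma lebesgue_measure_affine (a b : R) (A : set (measurableTypeR R)) : a != 0 -> measurable A ->
  (`|a|%:E * mu ((fun x => a * x + b)%R @^-1` A))%E = mu A.
Proof.
move=> a0 mA.
have na : 0 <= `|a| by [].
pose nu_ : {measure set (measurableTypeR R) -> \bar R} := mscale (NngNum na)
  (@pushforward _ _ (measurableTypeR R) (measurableTypeR R) R mu (fun x => a * x + b)%R).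
pose nu := nu_ (measurable_affine a b).
suff: mu A = nu A by move=> ->; rewrite /nu/= /mscale/= /pushforward.
apply: lebesgue_measure_unique mA => _ [[c d]] _ <-.
rewrite /nu/= /mscale/= /pushforward /=.
have [a_gt0|] := ltP 0 a.
  rewrite (_ : _ @^-1` _ = `](c - b) / a, (d - b) / a]%classic); last first.
    apply/seteqP; split => x /=; rewrite !in_itv/= ltr_pdivrMr// ler_pdivlMr// ltrBlDr lerBrDr mulrC//.
  rewrite !lebesgue_measure_itv/= !lte_fin ltr_pM2r ?invr_gt0// ltrD2r.
  case: ifPn => // _; last by rewrite mule0.
  by rewrite -!EFinB -EFinM gtr0_norm//; congr EFin; field.
rewrite le_eqVlt (negbTE a0)/= => a_lt0.
rewrite (_ : _ @^-1` _ = `[(d - b) / a, (c - b) / a[%classic); last first.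
  apply/seteqP; split => x /=; rewrite !in_itv/= ltr_ndivlMr// ler_ndivrMr// ltrBlDr lerBrDr mulrC andbC//.
rewrite !lebesgue_measure_itv/= !lte_fin ltr_nM2r ?invr_lt0// ltrD2r.
case: ifPn => // _; last by rewrite mule0.
by rewrite -!EFinB -EFinM ltr0_norm//; congr EFin; field.
Qed.

Lemma ge0_integral_affine (a b : R) (f : measurableTypeR R -> \bar R) : a != 0 ->
  measurable_fun setT f -> (forall x, 0 <= f x)%E ->
  (`|a|%:E * \int[mu]_x f (a * x + b)%R = \int[mu]_x f x)%E.
Proof.
move=> a0 mf f0.
have na : 0 <= `|a| by [].
have mfa : measurable_fun setT (fun x : measurableTypeR R => f (a * x + b)).
  exact: measurableT_comp (measurable_affine a b).
rewrite -[LHS](@ge0_integral_mscale _ _ _ mu setT measurableT (NngNum na))//.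
pose nu_ : {measure set (measurableTypeR R) -> \bar R} := mscale (NngNum na)
  (@pushforward _ _ (measurableTypeR R) (measurableTypeR R) R mu (fun x => a * x + b)%R).
pose nu := nu_ (measurable_affine a b).
transitivity (\int[nu]_x f x)%E.
  rewrite ge0_integral_mscale// ge0_integral_mscale//.
  by rewrite [in RHS]ge0_integral_pushforward//; exact: measurable_affine.
apply: eq_measure_integral => A mA _.
by rewrite /nu/= /mscale/= /pushforward; exact: lebesgue_measure_affine.
Qed.
End affine.

Section plane.
Context {R : realType}.
Local Notation mu := (@lebesgue_measure R).
Local Notation mu2 := (@lebesgue2 R).
Local Open Scope ereal_scope.

Lemma ge0_integral2E (f : R2 R -> \bar R) : measurable_fun setT f ->
  (forall x, 0 <= f x) ->
  \int[mu2]_z f z = \int[mu]_x \int[mu]_y f (x, y).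
Proof. by move=> mf f0; rewrite -[LHS]/(\int[mu \x mu]_z f z) fubini_tonelli1. Qed.

Lemma ge0_integral2E_swap (f : R2 R -> \bar R) : measurable_fun setT f ->
  (forall x, 0 <= f x) ->
  \int[mu2]_z f z = \int[mu]_y \int[mu]_x f (x, y).
Proof. by move=> mf f0; rewrite (ge0_integral2E mf f0) fubini_tonelli. Qed.

Lemma measurable_pair2 d (T : measurableType d) (f g : T -> R) :
  measurable_fun setT f -> measurable_fun setT g ->
  measurable_fun setT (fun x => (f x, g x) : R2 R).
Proof. by move=> mf mg; exact: measurable_fun_pair. Qed.

(** The lower right entry is written [b * c / a + e] so that the determinant is [a * e] and the map
    factors: for fixed y the substitution x' = a x + b y turns the second coordinate into (c / a) x'
    + e y, which for fixed x' is affine in y. *)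
Lemma ge0_integral2_shear (f : R2 R -> \bar R) (a b c e : R) : (a * e != 0)%R ->
  measurable_fun setT f -> (forall x, 0 <= f x) ->
  `|a * e|%:E * \int[mu2]_z f ((a * z.1 + b * z.2)%R, (c * z.1 + (b * c / a + e) * z.2)%R) = \int[mu2]_z f z.
Proof.
rewrite mulf_eq0 negb_or => /andP[a0 e0] mf f0.
have mL : measurable_fun setT (fun z : R2 R => f ((a * z.1 + b * z.2)%R, (c * z.1 + (b * c / a + e) * z.2)%R)).
  apply: (measurableT_comp mf); apply: measurable_pair2.
  - by apply: measurable_funD; apply: measurable_funM.
  - by apply: measurable_funD; apply: measurable_funM.
rewrite ge0_integral2E_swap//.
under eq_integral => y _.
  rewrite (_ : \int[mu]_x _ = `|a|^-1%:E * \int[mu]_x f (x, (c / a * x + e * y)%R)); last first.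
    rewrite -(@ge0_integral_affine _ a (b * y) (fun x => f (x, (c / a * x + e * y)%R)))//; last first.
      apply: (measurableT_comp mf); apply: measurable_pair2 => //.
      by apply: measurable_funD => //; apply: measurable_funM.
    rewrite muleA -EFinM mulVf ?normr_eq0// mul1e; apply: eq_integral => x _.
    rewrite /=; congr (f (_, _)); by field.
  over.
have mL2 : measurable_fun setT (fun z : R2 R => f (z.1, (c / a * z.1 + e * z.2)%R)).
  apply: (measurableT_comp mf); apply: measurable_pair2 => //.
  by apply: measurable_funD; apply: measurable_funM.
rewrite ge0_integralZl_EFin//; last 2 first.
- by move=> y _; apply: integral_ge0.
- exact: (measurable_fun_fubini_tonelli_G _ mL2).
rewrite -(ge0_integral2E_swap mL2)// (ge0_integral2E mL2)//=.
rewrite normrM EFinM muleAC muleA -EFinM mulfV ?normr_eq0// mul1e muleC.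
rewrite -ge0_integralZl_EFin//; last 2 first.
- by move=> y _; apply: integral_ge0.
- exact: (measurable_fun_fubini_tonelli_F _ mL2).
rewrite [RHS]ge0_integral2E//.
apply: eq_integral => x _.
rewrite -(@ge0_integral_affine _ e (c / a * x) (fun y => f (x, y)))//; last first.
  by apply: (measurableT_comp mf); apply: measurable_pair2.
by congr (_ * _); apply: eq_integral => y _; rewrite addrC.
Qed.

Lemma ge0_integral2_translation (f : R2 R -> \bar R) (a : R2 R) :
  measurable_fun setT f -> (forall x, 0 <= f x) ->
  \int[mu2]_z f ((z.1 + a.1)%R, (z.2 + a.2)%R) = \int[mu2]_z f z.
Proof.
move=> mf f0.
have mL : measurable_fun setT (fun z : R2 R => f ((z.1 + a.1)%R, (z.2 + a.2)%R)).
  by apply: (measurableT_comp mf); apply: measurable_pair2; apply: measurable_funD.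
rewrite (ge0_integral2E mL (fun=> f0 _)) (ge0_integral2E mf f0).
have mL2 : measurable_fun setT (fun z : R2 R => f (z.1, (z.2 + a.2)%R)).
  apply: (measurableT_comp mf); apply: measurable_pair2 => //; exact: measurable_funD.
have mF := measurable_fun_fubini_tonelli_F (m2 := mu) _ mL2 (fun _ => f0 _).
rewrite -[in RHS](@ge0_integral_affine _ 1 a.1 (fun x => \int[mu]_y f (x, y)))//; last 2 first.
- exact: (measurable_fun_fubini_tonelli_F f).
- by move=> x; apply: integral_ge0.
rewrite normr1 mul1e; apply: eq_integral => x _.
rewrite -[in RHS](@ge0_integral_affine _ 1 a.2)//; last first.
  by apply: (measurableT_comp mf); apply: measurable_pair2.
by rewrite normr1 mul1e; apply: eq_integral => y _; rewrite !mul1r.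
Qed.

(* The real matrix of the multiplication by a + ib factors into shears. *)
Lemma ge0_integral2_mulc (f : R2 R -> \bar R) (a b : R) : (a ^+ 2 + b ^+ 2 != 0)%R ->
  measurable_fun setT f -> (forall x, 0 <= f x) ->
  (a ^+ 2 + b ^+ 2)%:E * \int[mu2]_z f ((a * z.1 - b * z.2)%R, (b * z.1 + a * z.2)%R) = \int[mu2]_z f z.
Proof.
(* For [a = 0] the pivot of the shear vanishes; the map is then an exchange of the coordinates
   followed by a diagonal map. *)
move=> ab mf f0; have [a0|a0] := eqVneq a 0%R.
  subst a; rewrite expr0n/= add0r in ab *.
  have b0 : b != 0%R by apply: contra_neq ab => ->; rewrite expr0n.
  have mL : measurable_fun setT (fun z : R2 R => f ((0 * z.1 - b * z.2)%R, (b * z.1 + 0 * z.2)%R)).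
    by apply: (measurableT_comp mf); apply: measurable_pair2;
      [apply: measurable_funB | apply: measurable_funD]; apply: measurable_funM.
  have mL2 : measurable_fun setT (fun z : R2 R => f ((- b * z.1)%R, (b * z.2)%R)).
    by apply: (measurableT_comp mf); apply: measurable_pair2; apply: measurable_funM.
  rewrite ge0_integral2E_swap//.
  have := @ge0_integral2_shear f (- b) 0 0 b; rewrite mulf_neq0 ?oppr_eq0// => /(_ isT mf f0) <-.
  rewrite mulNr normrN -expr2 ger0_norm ?sqr_ge0//; congr (_ * _).
  have mL3 : measurable_fun setT (fun z : R2 R => f ((- b * z.1 + 0 * z.2)%R, (0 * z.1 + (0 * 0 / - b + b) * z.2)%R)).
    apply: (measurableT_comp mf); apply: measurable_pair2;
      by apply: measurable_funD; apply: measurable_funM.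
  rewrite (ge0_integral2E mL3 (fun=> f0 _)).
  by apply: eq_integral => x _; apply: eq_integral => y _ /=; congr (f (_, _)); ring.
have h : (a * ((a ^+ 2 + b ^+ 2) / a) = a ^+ 2 + b ^+ 2)%R by field.
have := @ge0_integral2_shear f a (- b) b ((a ^+ 2 + b ^+ 2) / a).
rewrite h => /(_ ab mf f0) <-.
rewrite ger0_norm ?addr_ge0 ?sqr_ge0//; congr (_ * _); apply: eq_integral => z _.
rewrite /=; congr (f (_, _)); first by ring.
by field.
Qed.

End plane.

(** * The topology of C and C^2 in real coordinates *)

Section complex_topology.
Context {R : realType}.

Lemma normcE (z : R[i]) : Normc.normc z = Num.sqrt (complex.Re z ^+ 2 + complex.Im z ^+ 2).
Proof. by case: z. Qed.

Lemma normc_real_norm (z : R[i]) : `|z| = (Normc.normc z)%:C.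
Proof. by []. Qed.

Lemma normc_ge_Re (z : R[i]) : `|complex.Re z| <= Normc.normc z.
Proof. by rewrite normcE -sqrtr_sqr ler_sqrt ?lerDl ?sqr_ge0 ?addr_ge0 ?sqr_ge0. Qed.

Lemma normc_ge_Im (z : R[i]) : `|complex.Im z| <= Normc.normc z.
Proof. by rewrite normcE -sqrtr_sqr ler_sqrt ?lerDr ?sqr_ge0 ?addr_ge0 ?sqr_ge0. Qed.

Lemma normc_ge0 (z : R[i]) : 0 <= Normc.normc z.
Proof. by rewrite normcE sqrtr_ge0. Qed.

Lemma normc_le_ReIm (z : R[i]) : Normc.normc z <= `|complex.Re z| + `|complex.Im z|.
Proof.
rewrite normcE -(@ger0_norm _ (`|complex.Re z| + `|complex.Im z|)) ?addr_ge0//.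
rewrite -sqrtr_sqr ler_wsqrtr// sqrrD !real_normK ?num_real// lerD2r lerDl.
by rewrite mulrn_wge0// mulr_ge0.
Qed.

Lemma sqr_normc2 (z : R[i]) : Normc.normc z ^+ 2 = complex.Re z ^+ 2 + complex.Im z ^+ 2.
Proof. by rewrite normcE sqr_sqrtr// addr_ge0// sqr_ge0. Qed.

Lemma nbhs_C1P (z : C1 R) (U : set (C1 R)) :
  nbhs z U <-> exists2 e : R, 0 < e & forall w, Normc.normc (w - z) < e -> U w.
Proof.
rewrite -nbhs_ballE; split => [[e /= e0 zeU]|[e e0 zeU]].
  have e_real : e = (complex.Re e)%:C.
    by rewrite RRe_real// gtr0_real.
  have re0 : 0 < complex.Re e by move: e0; rewrite e_real ltcR.
  exists (complex.Re e) => // w wz; apply: zeU.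
  by rewrite -ball_normE/= distrC normc_real_norm e_real ltcR.
exists (e%:C); first by rewrite /= ltcR.
move=> w; rewrite -ball_normE/= distrC normc_real_norm ltcR; exact: zeU.
Qed.

Lemma nbhs_C2P (z : C2 R) (U : set (C2 R)) :
  nbhs z U <-> exists2 e : R, 0 < e &
    forall w, Normc.normc (w.1 - z.1) < e -> Normc.normc (w.2 - z.2) < e -> U w.
Proof.
split => [[[/= U1 U2] [/= /nbhs_C1P[e1 e10 h1] /nbhs_C1P[e2 e20 h2]] hU]|[e e0 hU]].
  exists (Num.min e1 e2); first by rewrite lt_min e10.
  move=> w; rewrite !lt_min => /andP[w1 _] /andP[_ w2]; apply: hU.
  by split; [exact: h1|exact: h2].
exists ([set x | Normc.normc (x - z.1) < e], [set x | Normc.normc (x - z.2) < e]).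
  by split; apply/nbhs_C1P; exists e.
by move=> [w1 w2] [/= h1 h2]; exact: hU.
Qed.

(** Boxes with rational corners form a countable base. This is what relates the topology of C and
    C^2 to the product sigma-algebras: an open set is the union of the countably many boxes, or
    products of boxes, that it contains. *)
Let box := (rat * rat * (rat * rat))%type.

Let box_set (q : box) : set (R2 R) :=
  `]ratr q.1.1, ratr q.1.2[%classic `*` `]ratr q.2.1, ratr q.2.2[%classic.

Let measurable_box q : measurable (box_set q).
Proof. by apply: measurableX. Qed.

Let box_in (x : R2 R) (e : R) : 0 < e -> exists2 q, box_set q x &
  forall y, box_set q y -> `|y.1 - x.1| < e /\ `|y.2 - x.2| < e.
Proof.
have itv (a : R) : 0 < e -> exists q : rat * rat, ratr q.1 < a < ratr q.2 /\
   forall b : R, ratr q.1 < b < ratr q.2 -> `|b - a| < e.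
  move=> e0.
  have [p] := @rat_in_itvoo _ (a - e) a ltac:(by rewrite ltrBlDr ltrDl).
  have [q] := @rat_in_itvoo _ a (a + e) ltac:(by rewrite ltrDl).
  rewrite !in_itv/= => /andP[q1 q2] /andP[p1 p2].
  exists (p, q); rewrite /= p2 q1; split=> // b /andP[b1 b2].
  rewrite ltr_norml; apply/andP; split; lra.
move=> e0; have [p [p1 p2]] := itv x.1 e0; have [q [q1 q2]] := itv x.2 e0.
exists (p, q); first by split; rewrite /= in_itv/=.
by move=> y []/=; rewrite !in_itv/= => y1 y2; split; [exact: p2|exact: q2].
Qed.

Lemma measurable_nbhs_cover (I : countType) d (T : measurableType d) (F : I -> set T) (B : set T) :
  (forall i, measurable (F i)) ->
  (forall x, B x -> exists2 i, F i x & F i `<=` B) -> measurable B.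
Proof.
move=> mF BF.
pose F' i := if `[< F i `<=` B >] then F i else set0.
have -> : B = \bigcup_i F' i.
  apply/seteqP; split=> [x /BF[i Fix FiB]|x [i _]]; last first.
    by rewrite /F'; case: asboolP => // FiB /FiB.
  by exists i => //; rewrite /F'; case: asboolP.
apply: countable_bigcupT_measurable => [|i]; first exact: countableP.
by rewrite /F'; case: ifP.
Qed.

Lemma measurable_open_R2 (B : set (R2 R)) :
  (forall x, B x -> exists2 e : R, 0 < e &
    forall y, `|y.1 - x.1| < e -> `|y.2 - x.2| < e -> B y) -> measurable B.
Proof.
move=> oB; apply: (measurable_nbhs_cover measurable_box) => x /oB[e e0 eB].
by have [q qx qe] := box_in x e0; exists q => // y /qe[]; exact: eB.
Qed.

Lemma measurable_open_R4 (B : set (R4 R)) :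
  (forall x, B x -> exists2 e : R, 0 < e & forall y,
    `|y.1.1 - x.1.1| < e -> `|y.1.2 - x.1.2| < e ->
    `|y.2.1 - x.2.1| < e -> `|y.2.2 - x.2.2| < e -> B y) -> measurable B.
Proof.
move=> oB.
apply: (@measurable_nbhs_cover (box * box)%type _ _
   (fun q => box_set q.1 `*` box_set q.2)).
  by move=> q; apply: measurableX; exact: measurable_box.
move=> x /oB[e e0 eB].
have [p px pe] := box_in x.1 e0; have [q qx qe] := box_in x.2 e0.
exists (p, q); first by split.
by move=> y [/= /pe[? ?] /qe[? ?]]; exact: eB.
Qed.

Definition of_R2 (x : R2 R) : C1 R := (x.1 : R) +i* (x.2 : R).

Lemma normc_of_R2B_lt (x y : R2 R) (e : R) :
  `|y.1 - x.1| < e / 2 -> `|y.2 - x.2| < e / 2 ->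
  Normc.normc (of_R2 y - of_R2 x : R[i]) < e.
Proof.
move=> h1 h2; apply: le_lt_trans (normc_le_ReIm _) _; rewrite /=.
by rewrite [ltRHS]splitr ltrD.
Qed.

Lemma measurable_C1_open (U : set (C1 R)) : open U -> measurable (of_R2 @^-1` U).
Proof.
rewrite openE => oU; apply: measurable_open_R2 => x /oU /nbhs_C1P[e e0 eU].
exists (e / 2); first by rewrite divr_gt0.
by move=> y h1 h2; apply: eU; exact: normc_of_R2B_lt.
Qed.

Lemma measurable_C2_open (U : set (C2 R)) : open U -> measurable (of_reals @^-1` U).
Proof.
rewrite openE => oU; apply: measurable_open_R4 => x /oU /nbhs_C2P[e e0 eU].
exists (e / 2); first by rewrite divr_gt0.
move=> y h1 h2 h3 h4; apply: eU.
  exact: (@normc_of_R2B_lt x.1 y.1).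
exact: (@normc_of_R2B_lt x.2 y.2).
Qed.

Lemma lower_semicontinuous_measurable_C1 (u : C1 R -> \bar R) :
  lower_semicontinuous u -> measurable_fun setT (u \o of_R2).
Proof.
move=> lu; apply: (measurability _ (ErealGenOInfty.measurableE R)).
move=> /= _ [_ [a ->]] <-; apply: measurableI => //.
rewrite preimage_itvoy; apply: (@measurable_C1_open [set x | (a%:E < u x)%E]).
by move/lower_semicontinuousP : lu; exact.
Qed.

End complex_topology.

(** * The heat semigroup *)

Section gaussian.
Context {R : realType}.
Local Notation mu := (@lebesgue_measure R).
Local Notation mu2 := (@lebesgue2 R).

Definition sqdist (z w : R2 R) : R := (w.1 - z.1) ^+ 2 + (w.2 - z.2) ^+ 2.

Lemma sqdist_ge0 z w : 0 <= sqdist z w.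
Proof. by rewrite addr_ge0 ?sqr_ge0. Qed.

Lemma sqdistC z w : sqdist z w = sqdist w z.
Proof. by rewrite /sqdist; ring. Qed.

Lemma sqdist_le2 a z w : sqdist a w <= 2 * sqdist z w + 2 * sqdist z a.
Proof.
rewrite -subr_ge0 (_ : _ - _ = (w.1 - 2 * z.1 + a.1) ^+ 2 + (w.2 - 2 * z.2 + a.2) ^+ 2).
  by rewrite addr_ge0 ?sqr_ge0.
by rewrite /sqdist; ring.
Qed.

(** The kernel at time [t] of the semigroup generated by half the Laplacian: each real coordinate
    has variance [t]. *)
Definition gauss (t : R) (z w : R2 R) : R :=
  (2 * pi * t)^-1 * expR (- (sqdist z w / (2 * t))).

Lemma gauss_ge0 (t : R) z w : 0 < t -> 0 <= gauss t z w.
Proof. by move=> t0; rewrite mulr_ge0 ?expR_ge0// invr_ge0 !mulr_ge0 ?pi_ge0// ltW. Qed.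

Lemma gauss_nneg (t : R) z w : 0 <= t -> 0 <= gauss t z w.
Proof. by move=> t0; rewrite mulr_ge0 ?expR_ge0// invr_ge0 !mulr_ge0 ?pi_ge0. Qed.

Lemma measurable_sqdist d (T : measurableType d) (f g : T -> R2 R) :
  measurable_fun setT f -> measurable_fun setT g ->
  measurable_fun setT (fun x => sqdist (f x) (g x)).
Proof.
move=> mf mg.
by apply: measurable_funD; apply: measurable_funX; apply: measurable_funB;
  apply: measurableT_comp.
Qed.

Lemma measurable_gauss d (T : measurableType d) t (f g : T -> R2 R) :
  measurable_fun setT f -> measurable_fun setT g ->
  measurable_fun setT (fun x => gauss t (f x) (g x)).
Proof.
move=> mf mg; apply: measurable_funM => //; apply: measurableT_comp => //.
apply: measurableT_comp => //; apply: measurable_funM => //.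
exact: measurable_sqdist.
Qed.

Lemma gaussE (t : R) z w : 0 < t ->
  gauss t z w = normal_pdf z.1 (Num.sqrt t) w.1 * normal_pdf z.2 (Num.sqrt t) w.2.
Proof.
move=> t0; have st0 : Num.sqrt t != 0 by rewrite gt_eqF// sqrtr_gt0.
rewrite !normal_pdfE// /normal_fun /normal_peak !sqr_sqrtr ?ltW//.
rewrite mulrACA -expRD -invfM -expr2 sqr_sqrtr; last by rewrite mulrn_wge0// mulr_ge0 ?pi_ge0 ?ltW.
rewrite /gauss; congr (_^-1 * expR _); first by rewrite -mulr_natr; ring.
by rewrite /sqdist -mulr_natr; field; rewrite gt_eqF.
Qed.

Local Open Scope ereal_scope.

Lemma integral_gauss (t : R) z : (0 < t)%R -> \int[mu2]_w (gauss t z w)%:E = 1.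
Proof.
move=> t0; rewrite ge0_integral2E//; first last.
- by move=> w; rewrite lee_fin gauss_ge0.
- by apply/measurable_EFinP; apply: measurable_gauss.
under eq_integral => x _.
  under eq_integral => y _ do rewrite gaussE//= EFinM.
  have -> : \int[mu]_y ((normal_pdf z.1 (Num.sqrt t) x)%:E * (normal_pdf z.2 (Num.sqrt t) y)%:E)
      = (normal_pdf z.1 (Num.sqrt t) x)%:E.
    rewrite ge0_integralZl_EFin ?integral_normal_pdf ?mule1//.
    - by move=> y _; rewrite lee_fin normal_pdf_ge0.
    - by apply/measurable_EFinP; exact: measurable_normal_pdf.
    - exact: normal_pdf_ge0.
  over.
exact: integral_normal_pdf.
Qed.

(** Completing the square in [w]. The second factor on the right has total mass 1 in [w], so the
    semigroup law follows by integration. *)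
Lemma gaussM (s t : R) z w v : (0 < s)%R -> (0 < t)%R ->
  (gauss s z w * gauss t w v = gauss (s + t) z v *
   gauss (s * t / (s + t)) (((t * z.1 + s * v.1) / (s + t))%R, ((t * z.2 + s * v.2) / (s + t))%R) w)%R.
Proof.
move=> s0 t0; rewrite /gauss mulrACA -expRD [RHS]mulrACA -expRD.
have st0 : (0 < s + t)%R by rewrite addr_gt0.
congr (_ * expR _)%R.
  rewrite -!invfM; congr (_^-1)%R; field.
  by rewrite !gt_eqF.
rewrite /sqdist/=; field; rewrite !gt_eqF//.
Qed.

Lemma integral_gaussM (s t : R) z v : (0 < s)%R -> (0 < t)%R ->
  \int[mu2]_w (gauss s z w * gauss t w v)%:E = (gauss (s + t) z v)%:E.
Proof.
move=> s0 t0; have st0 : (0 < s + t)%R by rewrite addr_gt0.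
have st1 : (0 < s * t / (s + t))%R by rewrite divr_gt0 ?mulr_gt0.
under eq_integral => w _ do rewrite gaussM// EFinM.
rewrite ge0_integralZl_EFin//.
- by rewrite integral_gauss ?mule1.
- by move=> w _; rewrite lee_fin gauss_ge0.
- by apply/measurable_EFinP; apply: measurable_gauss.
- by rewrite gauss_ge0.
Qed.

Definition heat (t : R) (g : R2 R -> \bar R) (z : R2 R) : \bar R :=
  \int[mu2]_w ((gauss t z w)%:E * g w).

Variables (g : R2 R -> \bar R) (mg : measurable_fun setT g) (g0 : forall z, 0 <= g z).

Lemma measurable_gaussM t z : measurable_fun setT (fun w => (gauss t z w)%:E * g w).
Proof. by apply: emeasurable_funM => //; apply/measurable_EFinP; exact: measurable_gauss. Qed.

Lemma gauss_mul_ge0 (t : R) z w : (0 < t)%R -> 0 <= (gauss t z w)%:E * g w.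
Proof. by move=> t0; rewrite mule_ge0// lee_fin gauss_ge0. Qed.

Lemma heat_ge0 (t : R) z : (0 < t)%R -> 0 <= heat t g z.
Proof. by move=> t0; apply: integral_ge0 => w _; exact: gauss_mul_ge0. Qed.

Lemma measurable_heat (t : R) : (0 < t)%R -> measurable_fun setT (heat t g).
Proof.
move=> t0; apply: (measurable_fun_fubini_tonelli_F (fun x : R2 R * R2 R => (gauss t x.1 x.2)%:E * g x.2)).
  apply: emeasurable_funM; last exact: measurableT_comp.
  by apply/measurable_EFinP; apply: measurable_gauss.
by move=> x; exact: gauss_mul_ge0.
Qed.

Lemma heat_kernel_le (t t' c : R) z z' : (0 < t)%R -> (0 < t')%R -> (0 <= c)%R ->
  (forall w, gauss t z w <= c * gauss t' z' w)%R -> heat t g z <= c%:E * heat t' g z'.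
Proof.
move=> t0 t0' c0 h; rewrite /heat -ge0_integralZl_EFin//; last 2 first.
- by move=> w _; exact: gauss_mul_ge0.
- exact: measurable_gaussM.
apply: ge0_le_integral => //.
- by move=> w _; exact: gauss_mul_ge0.
- exact: measurable_gaussM.
- by apply: measurable_funeM; exact: measurable_gaussM.
- by move=> w _; rewrite muleA -EFinM lee_wpmul2r// lee_fin.
Qed.

(** Moving the centre is paid for by doubling the time: [sqdist_le2] compares the exponents, and the
    factor 2 is the ratio of the normalising constants. *)
Lemma heat_shift (t : R) z a : (0 < t)%R ->
  heat t g z <= (2 * expR (sqdist z a / (2 * t)))%:E * heat (2 * t) g a.
Proof.
move=> t0; have t20 : (0 < 2 * t)%R by rewrite mulr_gt0.
apply: heat_kernel_le => //.
move=> w; rewrite /gauss [leRHS](_ : _ = (2 * pi * t)^-1 *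
    expR (sqdist z a / (2 * t) - sqdist a w / (2 * (2 * t))))%R; last first.
  rewrite expRD; have := @pi_gt0 R; move: (@pi R) => p p0.
  by field; rewrite !gt_eqF.
rewrite ler_wpM2l ?ler_expR//.
  by rewrite invr_ge0 !mulr_ge0 ?pi_ge0// ltW.
have := sqdist_le2 a z w => h.
rewrite -subr_ge0 (_ : (_ - _)%R = (2 * sqdist z w + 2 * sqdist z a - sqdist a w) / (2 * (2 * t)))%R.
  by rewrite divr_ge0 ?subr_ge0// !mulr_ge0// ltW.
by field; rewrite gt_eqF.
Qed.

(** The kernel multiplied by its time is nondecreasing in time. *)
Lemma heat_scale (s t : R) z : (0 < s)%R -> (s <= t)%R -> heat s g z <= (t / s)%:E * heat t g z.
Proof.
move=> s0 st; have t0 := lt_le_trans s0 st.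
apply: heat_kernel_le => //; first by rewrite divr_ge0// ltW.
move=> w; rewrite /gauss mulrA [(t / s * _)%R](_ : _ = (2 * pi * s)^-1)%R; last first.
  have := @pi_gt0 R; move: (@pi R) => p p0.
  by field; rewrite !gt_eqF.
rewrite ler_wpM2l ?ler_expR//.
  by rewrite invr_ge0 !mulr_ge0 ?pi_ge0// ltW.
rewrite lerN2 ler_wpM2l ?sqdist_ge0// lef_pV2 ?posrE ?mulr_gt0//.
by rewrite ler_pM2l.
Qed.

Lemma heat_semigroup (s t : R) z : (0 < s)%R -> (0 < t)%R ->
  heat s (heat t g) z = heat (s + t) g z.
Proof.
move=> s0 t0; rewrite /heat.
pose F := fun x : R2 R * R2 R => (gauss s z x.1 * gauss t x.1 x.2)%:E * g x.2.
have mF : measurable_fun setT F.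
  apply: emeasurable_funM; last exact: measurableT_comp.
  by apply/measurable_EFinP; apply: measurable_funM; apply: measurable_gauss.
have F0 x : 0 <= F x by rewrite mule_ge0// lee_fin mulr_ge0// gauss_ge0.
transitivity (\int[mu2]_w \int[mu2]_v F (w, v)).
  apply: eq_integral => w _; rewrite -ge0_integralZl_EFin//; last 3 first.
  - by move=> v _; exact: gauss_mul_ge0.
  - exact: measurable_gaussM.
  - exact: gauss_ge0.
  by apply: eq_integral => v _; rewrite muleA -EFinM.
rewrite fubini_tonelli//; apply: eq_integral => v _.
rewrite /F/= -integral_gaussM//.
rewrite ge0_integralZr//.
- apply/measurable_EFinP; apply: measurable_funM; apply: measurable_gauss => //.
- by move=> w _; rewrite lee_fin mulr_ge0 ?gauss_ge0.
Qed.

End gaussian.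

(** * Shifts of periodic functions and the polar angle *)

Section periodic.
Context {R : realType}.
Local Notation mu := (@lebesgue_measure R).
Local Open Scope ereal_scope.

Lemma ge0_integral_itv_translation (F : R -> \bar R) (a b c : R) :
  measurable_fun setT F -> (forall x, 0 <= F x) ->
  \int[mu]_(x in `[a, b[) F (x + c)%R = \int[mu]_(x in `[(a + c)%R, (b + c)%R[) F x.
Proof.
move=> mF F0; rewrite integral_mkcond [RHS]integral_mkcond.
rewrite -(@ge0_integral_affine _ 1 c (F \_ `[(a + c)%R, (b + c)%R[))//; last 2 first.
- by apply/(measurable_restrictT _ _).1 => //; exact: measurable_funTS.
- by move=> x; apply: erestrict_ge0.
rewrite normr1 mul1e; apply: eq_integral => x _.
by rewrite !patchE mul1r !mem_setE !in_itv/= lerD2r ltrD2r.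
Qed.

Lemma ge0_integral_periodic_shift (F : R -> \bar R) (c p : R) :
  (0 <= c <= p)%R -> measurable_fun setT F -> (forall x, 0 <= F x) ->
  (forall x, F (x + p)%R = F x) ->
  \int[mu]_(x in `[0%R, p]) F (x + c)%R = \int[mu]_(x in `[0%R, p]) F x.
Proof.
move=> /andP[c0 cp] mF F0 Fp.
have split (x y z : R) : (x <= y <= z)%R -> \int[mu]_(t in `[x, z[) F t =
    \int[mu]_(t in `[x, y[) F t + \int[mu]_(t in `[y, z[) F t.
  move=> /andP[xy yz]; rewrite -ge0_integral_setU//=.
  - by rewrite -itv_bndbnd_setU// bnd_simp.
  - exact: measurable_funTS.
  - apply/disj_setPLR => t/=; rewrite !in_itv/= => /andP[_ ty] /andP[].
    by rewrite leNgt ty.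
have mFc : measurable_fun setT (fun x : measurableTypeR R => F (x + c)%R).
  by apply: (measurableT_comp mF); exact: measurable_funD.
rewrite -!integral_itv_bndo_bndc; [|exact: measurable_funTS|exact: measurable_funTS].
rewrite ge0_integral_itv_translation// add0r.
rewrite (split c p (p + c)%R) ?cp ?lerDl//.
have := ge0_integral_itv_translation 0 c p mF F0; rewrite add0r (addrC c p) => <-.
rewrite [RHS](split 0%R c p) ?c0//  addeC.
by congr (_ + _); apply: eq_integral => x _.
Qed.

Lemma polar_form (a b : R) : exists r c, [/\ (0 <= r)%R, (0 <= c <= 2 * pi)%R,
  (a = r * cos c)%R, (b = r * sin c)%R & (r ^+ 2 = a ^+ 2 + b ^+ 2)%R].
Proof.
set r := Num.sqrt (a ^+ 2 + b ^+ 2)%R.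
have ab0 : (0 <= a ^+ 2 + b ^+ 2)%R by rewrite addr_ge0 ?sqr_ge0.
have r2 : (r ^+ 2 = a ^+ 2 + b ^+ 2)%R by rewrite sqr_sqrtr.
have r0 : (0 <= r)%R by rewrite sqrtr_ge0.
have [rz|rn0] := eqVneq r 0%R.
  move: r2; rewrite rz expr0n/= => /esym/eqP; rewrite paddr_eq0 ?sqr_ge0//.
  rewrite !sqrf_eq0 => /andP[/eqP -> /eqP ->].
  exists 0%R, 0%R; rewrite !mul0r lexx expr0n/= addr0; split=> //.
  by rewrite mulr_ge0 ?pi_ge0.
have rp : (0 < r)%R by rewrite lt_neqAle eq_sym rn0.
have ar1 : (-1 <= a / r <= 1)%R.
  rewrite -ler_norml normrM normfV (ger0_norm r0).
  rewrite ler_pdivrMr// mul1r -ler_sqr ?nnegrE//.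
  by rewrite !real_normK ?num_real// r2 lerDl sqr_ge0.
have acosE := acosK ar1.
have sinE : (sin (acos (a / r)) = `|b| / r)%R.
  rewrite sin_acos// (_ : 1 - _ = (b / r) ^+ 2)%R.
    by rewrite sqrtr_sqr normrM normfV (ger0_norm r0).
  rewrite !expr_div_n r2; field; rewrite -r2 sqrf_eq0//.
have [b0|b0] := leP 0%R b.
  exists r, (acos (a / r)); split => //.
  - rewrite acos_ge0//= (le_trans (acos_lepi ar1))// ler_peMl ?pi_ge0// ler1n//.
  - by rewrite acosE; field.
  - by rewrite sinE ger0_norm//; field.
exists r, (2 * pi - acos (a / r))%R; split => //.
- rewrite subr_ge0 lerBlDr lerDl acos_ge0// andbT (le_trans (acos_lepi ar1))// ler_peMl ?pi_ge0// ler1n//.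
- rewrite mulr_natl addrC cosD2pi cosN acosE; by field.
- by rewrite mulr_natl addrC sinD2pi sinN sinE ltr0_norm//; field.
Qed.

Lemma measurable_cos d (T : measurableType d) (f : T -> R) :
  measurable_fun setT f -> measurable_fun setT (fun x => cos (f x)).
Proof. by apply: measurableT_comp; apply: continuous_measurable_fun; exact: continuous_cos. Qed.

Lemma measurable_sin d (T : measurableType d) (f : T -> R) :
  measurable_fun setT f -> measurable_fun setT (fun x => sin (f x)).
Proof. by apply: measurableT_comp; apply: continuous_measurable_fun; exact: continuous_sin. Qed.

End periodic.

Section second_moment.
Context {R : realType}.
Local Notation mu2 := (@lebesgue2 R).
Local Open Scope ereal_scope.

(** With x = |z - w|^2 / (4 t) this is the inequality 2 x <= exp x. The exact second moment is 2 t;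
    giving up a factor 2 allows a pointwise comparison of kernels in place of an integration by
    parts. *)
Lemma gauss_sqdist (t : R) z w : (0 < t)%R ->
  (gauss t z w * sqdist z w <= 4 * t * gauss (2 * t) z w)%R.
Proof.
move=> t0; rewrite /gauss; set x := (sqdist z w / (2 * (2 * t)))%R.
have x0 : (0 <= x)%R by rewrite divr_ge0 ?sqdist_ge0// ltW// !mulr_gt0.
rewrite (_ : sqdist z w / (2 * t) = x + x)%R; last by rewrite /x; field; rewrite gt_eqF.
rewrite (_ : sqdist z w = 4 * t * x)%R; last by rewrite /x; field; rewrite gt_eqF.
have pi0 := @pi_gt0 R.
rewrite (_ : (2 * pi * (2 * t))^-1 = (2 * pi * t)^-1 / 2)%R; last first.
  by move: (@pi R) pi0 => p p0; field; rewrite !gt_eqF.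
rewrite opprD expRD [leLHS](_ : _ = (4 * t * (2 * pi * t)^-1 * expR (- x)) * (expR (- x) * x))%R; last by ring.
rewrite [leRHS](_ : _ = (4 * t * (2 * pi * t)^-1 * expR (- x)) * 2^-1)%R; last by ring.
apply: ler_wpM2l; first by rewrite !mulr_ge0 ?expR_ge0// ?invr_ge0 ?mulr_ge0 ?ltW.
rewrite expRN ler_pdivrMl ?expR_gt0//.
have : (1 + x / 2 <= expR (x / 2))%R by exact: expR_ge1Dx.
have -> : expR x = (expR (x / 2) * expR (x / 2))%R by rewrite -expRD -splitr.
move=> h.
have : ((1 + x / 2) * (1 + x / 2) <= expR (x / 2) * expR (x / 2))%R.
  by apply: ler_pM => //; rewrite addr_ge0// divr_ge0.
have := sqr_ge0 (x / 2 - 1)%R; move: (expR (x / 2) * expR (x / 2))%R => E; clear; lra.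
Qed.

Lemma integral_gauss_sqdist (t : R) z : (0 < t)%R ->
  \int[mu2]_w (gauss t z w * sqdist z w)%:E <= (4 * t)%:E.
Proof.
move=> t0; have t20 : (0 < 2 * t)%R by rewrite mulr_gt0.
rewrite -[leRHS]mule1 -(@integral_gauss _ (2 * t) z)// -ge0_integralZl_EFin//; last 3 first.
- by move=> w _; rewrite lee_fin gauss_ge0.
- by apply/measurable_EFinP; exact: measurable_gauss.
- by rewrite mulr_ge0// ltW.
apply: ge0_le_integral => //.
- by move=> w _; rewrite lee_fin mulr_ge0 ?gauss_ge0 ?sqdist_ge0.
- apply/measurable_EFinP; apply: measurable_funM; first exact: measurable_gauss.
  exact: measurable_sqdist.
- by apply: measurable_funeM; apply/measurable_EFinP; exact: measurable_gauss.
- by move=> w _; rewrite lee_fin gauss_sqdist.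
Qed.

End second_moment.

(* Satisfied by [A + |z|^2 - u] for [u] subharmonic. *)
Definition circle_superharmonic {R : realType} (g : R2 R -> \bar R) :=
  forall (a : R2 R) (r : R), 0 <= r ->
  (\int[lebesgue_measure]_(s in `[0%R, (2 * pi)%R])
     g ((a.1 + r * cos s)%R, (a.2 + r * sin s)%R)
   <= (2 * pi)%:E * (g a + (r ^+ 2)%:E))%E.

Lemma half_sum_le {R : realType} (K S D E a d kd : R) : kd = K * d -> S + E = D + 4 * d * K -> a / 2 * K <= S ->
  K * a <= 2 * (D - E + 4 * kd).
Proof. by move=> ->; lra. Qed.

Section superharmonic.
Context {R : realType}.
Local Notation mu := (@lebesgue_measure R).
Local Notation mu2 := (@lebesgue2 R).
Local Open Scope ereal_scope.
Variables (g : R2 R -> \bar R).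
Hypotheses (mg : measurable_fun setT g) (g0 : forall z, 0 <= g z)
  (sg : circle_superharmonic g).

Let measurable_cos_sin (z w : R2 R) :
  measurable_fun setT (fun s : measurableTypeR R => g ((z.1 + (cos s * w.1 - sin s * w.2))%R,
     (z.2 + (sin s * w.1 + cos s * w.2))%R)).
Proof.
apply: (measurableT_comp mg); apply: measurable_pair2.
- apply: measurable_funD => //; apply: measurable_funB; apply: measurable_funM => //.
  + exact: measurable_cos.
  + exact: measurable_sin.
- apply: measurable_funD => //; apply: measurable_funD; apply: measurable_funM => //.
  + exact: measurable_sin.
  + exact: measurable_cos.
Qed.

(** In polar form, rotating [w] by [s] adds [s] to its angle, so the mean over [s] is a circle mean
    with a shifted origin of angles, which periodicity undoes. *)
Let rotation_mean (z w : R2 R) :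
  \int[mu]_(s in `[0%R, (2 * pi)%R])
     g ((z.1 + (cos s * w.1 - sin s * w.2))%R, (z.2 + (sin s * w.1 + cos s * w.2))%R)
  <= (2 * pi)%:E * (g z + (w.1 ^+ 2 + w.2 ^+ 2)%:E).
Proof.
have [r [c [r0 c2pi w1 w2 <-]]] := polar_form w.1 w.2.
apply: le_trans (sg z r0).
pose F (s : R) := g ((z.1 + r * cos s)%R, (z.2 + r * sin s)%R).
rewrite [leRHS](_ : _ = \int[mu]_(s in `[0%R, (2 * pi)%R]) F (s + c)%R); last first.
  rewrite (@ge0_integral_periodic_shift _ F)//.
  - apply: (eq_measurable_fun _ _ (measurable_cos_sin z (r, 0%R))) => s _/=.
    by rewrite /F; congr (g (_, _)); ring.
  - by move=> x; exact: g0.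
  - by move=> x; rewrite /F mulr_natl cosD2pi sinD2pi.
rewrite le_eqVlt; apply/orP; left; apply/eqP; apply: eq_integral => s _.
by rewrite /F cosD sinD w1 w2; congr (g (_, _)); ring.
Qed.

(* The Gaussian is rotation invariant, so [g] may be replaced by its circle means;
   their excess over [g z] integrates to at most the second moment [4 t]. *)
Lemma heat_le (t : R) z : (0 < t)%R -> heat t g z <= g z + (4 * t)%:E.
Proof.
move=> t0.
pose G := fun x : measurableTypeR R * R2 R => (gauss t (0, 0)%R x.2)%:E *
  g ((z.1 + (cos x.1 * x.2.1 - sin x.1 * x.2.2))%R, (z.2 + (sin x.1 * x.2.1 + cos x.1 * x.2.2))%R).
have mcos : measurable_fun setT (fun x : measurableTypeR R * R2 R => cos x.1).
  exact: measurable_cos.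
have msin : measurable_fun setT (fun x : measurableTypeR R * R2 R => sin x.1).
  exact: measurable_sin.
have m21 : measurable_fun setT (fun x : measurableTypeR R * R2 R => x.2.1).
  by apply: measurableT_comp.
have m22 : measurable_fun setT (fun x : measurableTypeR R * R2 R => x.2.2).
  by apply: measurableT_comp.
have mG : measurable_fun setT G.
  apply: emeasurable_funM.
    by apply/measurable_EFinP; apply: measurable_gauss.
  apply: (measurableT_comp mg); apply: measurable_pair2; apply: measurable_funD => //.
  - by apply: measurable_funB; apply: measurable_funM.
  - by apply: measurable_funD; apply: measurable_funM.
have G0 x : 0 <= G x by rewrite mule_ge0// lee_fin gauss_ge0.
(* Translation to the origin and rotation by [s] preserve both Lebesgue measure and the kernel. The
   integral is thus the same for every [s], and averaging it over [s] brings in the circle means. *)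
have heatE s : heat t g z = \int[mu2]_w G (s, w).
  pose H w := (gauss t (0, 0)%R w)%:E * g ((z.1 + w.1)%R, (z.2 + w.2)%R).
  have mH : measurable_fun setT H.
    apply: emeasurable_funM.
      by apply/measurable_EFinP; apply: measurable_gauss.
    by apply: (measurableT_comp mg); apply: measurable_pair2; apply: measurable_funD.
  have H0 w : 0 <= H w by rewrite mule_ge0// lee_fin gauss_ge0.
  transitivity (\int[mu2]_w H w).
    rewrite /heat -(@ge0_integral2_translation _ _ z); last 2 first.
    - exact: measurable_gaussM.
    - by move=> w; exact: gauss_mul_ge0.
    apply: eq_integral => w _; congr (_%:E * g (_, _)); last 2 first.
    - by rewrite addrC.
    - by rewrite addrC.
    by rewrite /gauss /sqdist/= !addrK !subr0.
  have cs : (cos s ^+ 2 + sin s ^+ 2 = 1)%R by exact: cos2Dsin2.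
  rewrite -(@ge0_integral2_mulc _ H (cos s) (sin s))// cs ?oner_neq0// mul1e.
  apply: eq_integral => w _; rewrite /H /G/=; congr (_%:E * _).
  rewrite /gauss (_ : sqdist _ (_, _) = sqdist (0, 0)%R w)//.
  by rewrite /sqdist/= !subr0 -[RHS]mul1r -cs; ring.
have pi20 : (0 < 2 * pi :> R)%R by rewrite mulr_gt0 ?pi_gt0.
rewrite -(@lee_pmul2l _ (2 * pi)%:E)//.
have -> : (2 * pi)%:E * heat t g z = \int[mu]_(s in `[0%R, (2 * pi)%R]) \int[mu2]_w G (s, w).
  under eq_integral do rewrite -heatE.
  rewrite integral_cst//= lebesgue_measure_itv/= lte_fin pi20 sube0 muleC//.
rewrite integral_mkcond.
under eq_integral => s _.
  rewrite (_ : _ s = \int[mu2]_w ((fun x => G x * (\1_`[0%R, (2 * pi)%R] x.1)%:E) (s, w))); last first.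
    rewrite patchE; case: ifPn => hs; rewrite /= indicE ?hs ?(negbTE hs).
      by apply: eq_integral => w _; rewrite mule1.
    by rewrite integral0_eq// => w _; rewrite mule0.
  over.
pose GI := fun x : measurableTypeR R * R2 R => G x * (\1_`[0%R, (2 * pi)%R] x.1)%:E.
have mGI : measurable_fun setT GI.
  apply: emeasurable_funM => //; apply/measurable_EFinP.
  have mI : measurable_fun setT (\1_`[0%R, (2 * pi)%R] : measurableTypeR R -> R).
    exact: measurable_indic.
  exact: (measurableT_comp mI measurable_fst).
have GI0 x : 0 <= GI x by rewrite mule_ge0// lee_fin.
rewrite [leLHS](fubini_tonelli GI mGI GI0).
apply: (@le_trans _ _ (\int[mu2]_w ((2 * pi)%:E * (g z * (gauss t (0, 0)%R w)%:E + (gauss t (0, 0)%R w * sqdist (0, 0)%R w)%:E)))).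
  apply: ge0_le_integral => //.
  - by move=> w _; apply: integral_ge0.
  - exact: (measurable_fun_fubini_tonelli_G _ mGI).
  - apply: measurable_funeM; apply: emeasurable_funD.
      by apply: measurable_funeM; apply/measurable_EFinP; exact: measurable_gauss.
    apply/measurable_EFinP; apply: measurable_funM; first exact: measurable_gauss.
    exact: measurable_sqdist.
  - move=> w _.
    have := rotation_mean z w; rewrite integral_mkcond => hrot.
    rewrite (_ : \int[_]_x _ = (gauss t (0, 0)%R w)%:E * \int[mu]_s ((fun s : R => g ((z.1 + (cos s * w.1 - sin s * w.2))%R, (z.2 + (sin s * w.1 + cos s * w.2))%R)) \_ `[0%R, (2 * pi)%R]) s); last first.
      rewrite -ge0_integralZl_EFin//; last 3 first.
      - by move=> s _; apply: erestrict_ge0.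
      - apply/(measurable_restrictT _ _).1 => //; apply: measurable_funTS; exact: measurable_cos_sin.
      - exact: gauss_ge0.
      apply: eq_integral => s _; rewrite patchE /GI /G/= indicE.
      by case: ifPn => hs; rewrite ?mule1 ?mule0.
    apply: (le_trans (lee_wpmul2l _ hrot)); first by rewrite lee_fin gauss_ge0.
    rewrite muleCA lee_wpmul2l ?lee_fin ?(ltW pi20)//.
    rewrite ge0_muleDr ?lee_fin ?addr_ge0 ?sqr_ge0//.
    by rewrite muleC -EFinM /sqdist/= !subr0.
rewrite ge0_integralZl_EFin//; last 3 first.
- move=> w _; rewrite adde_ge0 ?mule_ge0 ?lee_fin ?gauss_ge0//.
  by rewrite mulr_ge0 ?gauss_ge0 ?sqdist_ge0.
- apply: emeasurable_funD.
    by apply: measurable_funeM; apply/measurable_EFinP; exact: measurable_gauss.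
  apply/measurable_EFinP; apply: measurable_funM; first exact: measurable_gauss.
  exact: measurable_sqdist.
- exact: ltW.
rewrite lee_pmul2l//.
rewrite ge0_integralD//; first last.
- apply/measurable_EFinP; apply: measurable_funM; first exact: measurable_gauss.
  exact: measurable_sqdist.
- by move=> w _; rewrite lee_fin mulr_ge0 ?gauss_ge0 ?sqdist_ge0.
- by apply: measurable_funeM; apply/measurable_EFinP; exact: measurable_gauss.
- by move=> w _; rewrite mule_ge0 ?lee_fin ?gauss_ge0.
apply: leeD; last exact: integral_gauss_sqdist.
rewrite ge0_integralZl//.
- by rewrite integral_gauss// mule1.
- by apply/measurable_EFinP; exact: measurable_gauss.
- by move=> w _; rewrite lee_fin gauss_ge0.
Qed.

Hypothesis gfin : exists a, g a < +oo.

(** One finite value is enough: [heat_shift] moves the centre to a point where [g] is finite, and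
    [heat_le] bounds the average there. *)
Lemma heat_lty (t : R) z : (0 < t)%R -> heat t g z < +oo.
Proof.
move=> t0; have [a ga] := gfin; apply: (le_lt_trans (heat_shift mg g0 z a t0)).
rewrite lte_mul_pinfty ?lee_fin ?mulr_ge0 ?expR_ge0//.
by apply: (le_lt_trans (heat_le a _)); rewrite ?mulr_gt0// lte_add_pinfty// ltry.
Qed.

Definition heatr (t : R) z : R := fine (heat t g z).

Lemma heatrE (t : R) z : (0 < t)%R -> heat t g z = (heatr t z)%:E.
Proof. by move=> t0; rewrite /heatr fineK// ge0_fin_numE ?heat_lty ?heat_ge0. Qed.

Lemma heatr_ge0 (t : R) z : (0 < t)%R -> (0 <= heatr t z)%R.
Proof. by move=> t0; rewrite -lee_fin -heatrE// heat_ge0. Qed.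

Lemma measurable_heatr (t : R) : (0 < t)%R -> measurable_fun setT (heatr t).
Proof.
move=> t0; apply/measurable_EFinP.
rewrite (_ : EFin \o _ = heat t g); first exact: measurable_heat.
by apply/funext => z; rewrite /= heatrE.
Qed.

Lemma heat_cst (t c : R) z : (0 < t)%R -> (0 <= c)%R -> heat t (cst c%:E) z = c%:E.
Proof.
move=> t0 c0; rewrite /heat ge0_integralZr//.
- by rewrite integral_gauss// mul1e.
- by apply/measurable_EFinP; exact: measurable_gauss.
- by move=> w _; rewrite lee_fin gauss_ge0.
Qed.

Lemma heatD (t : R) (f k : R2 R -> \bar R) z : (0 < t)%R ->
  measurable_fun setT f -> measurable_fun setT k ->
  (forall w, 0 <= f w) -> (forall w, 0 <= k w) ->
  heat t (f \+ k) z = heat t f z + heat t k z.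
Proof.
move=> t0 mf mk f0 k0; rewrite /heat -ge0_integralD//.
- by apply: eq_integral => w _; rewrite ge0_muleDr.
- by move=> w _; rewrite mule_ge0// lee_fin gauss_ge0.
- exact: measurable_gaussM.
- by move=> w _; rewrite mule_ge0// lee_fin gauss_ge0.
- exact: measurable_gaussM.
Qed.

Lemma le_heat (t : R) (f k : R2 R -> \bar R) z : (0 < t)%R ->
  measurable_fun setT f -> measurable_fun setT k ->
  (forall w, 0 <= f w) -> (forall w, f w <= k w) ->
  heat t f z <= heat t k z.
Proof.
move=> t0 mf mk f0 fk; apply: ge0_le_integral => //.
- by move=> w _; rewrite mule_ge0// lee_fin gauss_ge0.
- exact: measurable_gaussM.
- exact: measurable_gaussM.
- by move=> w _; rewrite lee_wpmul2l ?lee_fin ?gauss_ge0.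
Qed.

(** P_(s+t) g = P_s (P_t g) <= P_s (g + 4 t). *)
Lemma heatr_le (s t : R) z : (0 < s)%R -> (0 < t)%R ->
  (heatr (s + t) z <= heatr s z + 4 * t)%R.
Proof.
move=> s0 t0; have st0 : (0 < s + t)%R by rewrite addr_gt0.
rewrite -lee_fin -heatrE// -heat_semigroup//.
apply: (@le_trans _ _ (heat s (g \+ cst (4 * t)%:E) z)).
  apply: le_heat => //.
  - exact: measurable_heat.
  - exact: emeasurable_funD.
  - by move=> w; exact: heat_ge0.
  - by move=> w /=; exact: heat_le.
have t40 : (0 <= 4 * t)%R by rewrite mulr_ge0// ltW.
by rewrite heatD// heat_cst// heatrE.
Qed.

Lemma heatr_le2 (s t : R) z : (0 < s)%R -> (s <= t)%R ->
  (heatr t z <= heatr s z + 4 * (t - s))%R.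
Proof.
move=> s0; rewrite le_eqVlt => /predU1P[<-|st].
  by rewrite subrr mulr0 addr0.
by rewrite -[in leLHS](subrK s t) addrC heatr_le ?subr_gt0.
Qed.

Section increments.
Variable (d : R).
Hypothesis d0 : (0 < d)%R.

(* Up to smoothing at scale [d] this is [d * (8 - laplacian g) / 2]; for
   [g = A + |z|^2 - u] it is [d * (4 + laplacian u) / 2], a smoothed Riesz measure. *)
Definition heat_drop z : R := (heatr d z + 4 * d - heatr (2 * d) z)%R.

Lemma heat_drop_ge0 z : (0 <= heat_drop z)%R.
Proof. by rewrite /heat_drop subr_ge0 mulr_natl mulr2n; exact: heatr_le. Qed.

Lemma measurable_heat_drop : measurable_fun setT heat_drop.
Proof.
apply: measurable_funB; last by apply: measurable_heatr; rewrite mulr_gt0.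
by apply: measurable_funD => //; exact: measurable_heatr.
Qed.

Let mdrop : measurable_fun setT (fun z => (heat_drop z)%:E).
Proof. by apply/measurable_EFinP; exact: measurable_heat_drop. Qed.

Definition heat_dropr (j : nat) z : R := fine (heat (j%:R * d) (fun z => (heat_drop z)%:E) z).

(** The semigroup law applied to the definition of [heat_drop]. Stating it as a sum avoids
    subtraction of averages not yet known to be finite; finiteness of the first term is then read
    off from it. *)
Lemma heat_drop_telescope j z : (0 < j)%N ->
  heat (j%:R * d) (fun z => (heat_drop z)%:E) z + (heatr (j.+2%:R * d) z)%:E =
  (heatr (j.+1%:R * d) z + 4 * d)%:E.
Proof.
move=> j0; have jd0 : (0 < j%:R * d)%R by rewrite mulr_gt0 ?ltr0n.
have d20 : (0 < 2 * d)%R by rewrite mulr_gt0.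
have d40 : (0 <= 4 * d)%R by rewrite mulr_ge0// ltW.
rewrite -heatrE ?mulr_gt0 ?ltr0n//.
rewrite (_ : j.+2%:R * d = j%:R * d + 2 * d)%R; last by rewrite -addn2 natrD mulrDl.
rewrite -heat_semigroup// -heatD//; last 3 first.
- exact: measurable_heat.
- by move=> w; rewrite lee_fin heat_drop_ge0.
- by move=> w; exact: heat_ge0.
rewrite (_ : (fun _ => _) \+ _ = heat d g \+ cst (4 * d)%:E); last first.
  apply/funext => w /=; by rewrite (heatrE w d0) (heatrE w d20) -EFinD /heat_drop subrK.
rewrite heatD//; last 2 first.
- exact: measurable_heat.
- by move=> w; exact: heat_ge0.
rewrite heat_cst// heat_semigroup// (_ : j%:R * d + d = j.+1%:R * d)%R.
  by rewrite heatrE// mulr_gt0 ?ltr0n.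
by rewrite -natr1 mulrDl mul1r.
Qed.

Lemma heat_droprE j z : (0 < j)%N ->
  heat (j%:R * d) (fun z => (heat_drop z)%:E) z = (heat_dropr j z)%:E.
Proof.
move=> j0; have jd0 : (0 < j%:R * d)%R by rewrite mulr_gt0 ?ltr0n.
rewrite /heat_dropr fineK// ge0_fin_numE; last first.
  by apply: heat_ge0 => // w; rewrite lee_fin heat_drop_ge0.
rewrite ltey; apply/eqP => h; have := heat_drop_telescope z j0.
by rewrite h.
Qed.

Lemma heat_dropr_ge0 j z : (0 < j)%N -> (0 <= heat_dropr j z)%R.
Proof.
move=> j0; rewrite -lee_fin -heat_droprE//; apply: heat_ge0 => //.
- by move=> w; rewrite lee_fin heat_drop_ge0.
- by rewrite mulr_gt0 ?ltr0n.
Qed.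

(** For [p = 1] and [n = k] this expresses the average of [g] at time 2 d by the averages of the
    drop at the times d, ..., k d, which is how the smoothed Riesz mass recovers [g]. *)
Lemma sum_heat_dropr p n z : (0 < p)%N ->
  (\sum_(p <= j < p + n) heat_dropr j z + heatr ((p + n).+1%:R * d) z =
   heatr (p.+1%:R * d) z + 4 * d * n%:R)%R.
Proof.
move=> p0; elim: n => [|n IH].
  by rewrite addn0 big_geq// add0r mulr0 addr0.
rewrite addnS big_nat_recr ?leq_addr//=.
have pn0 : (0 < p + n)%N by rewrite addn_gt0 p0.
have := heat_drop_telescope z pn0; rewrite heat_droprE// -EFinD => -[h].
by rewrite -addrA h addrA IH -natr1; ring.
Qed.

Lemma heat_dropr_scale k j z : (0 < k)%N -> (k <= j)%N ->
  (k%:R * heat_dropr k z <= j%:R * heat_dropr j z)%R.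
Proof.
move=> k0 kj; have j0 := leq_trans k0 kj.
have kd0 : (0 < k%:R * d)%R by rewrite mulr_gt0 ?ltr0n.
have := @heat_scale R _ mdrop _ (k%:R * d) (j%:R * d) z kd0.
rewrite (heat_droprE z k0) (heat_droprE z j0) -EFinM lee_fin => h.
rewrite -ler_pdivlMl ?ltr0n//; apply: le_trans (h _ _) _.
- by move=> w; rewrite lee_fin heat_drop_ge0.
- by rewrite ler_pM2r// ler_nat.
rewrite mulrA ler_wpM2r ?heat_dropr_ge0// le_eqVlt; apply/orP; left; apply/eqP.
by field; rewrite ?(gt_eqF d0) ?pnatr_eq0 -?lt0n ?k0.
Qed.

(** By [heat_dropr_scale] each of the [k] averages at the times j d with k <= j < 2 k is at least
    half the one at time k d, and their sum telescopes. The mass seen at time k d is so controlled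
    by a decrement of the averages of [g]. *)
Lemma heat_dropr_le k z : (0 < k)%N ->
  (k%:R * heat_dropr k z <= 2 * (heatr (k.+1%:R * d) z - heatr ((2 * k).+1%:R * d) z + 4 * (k%:R * d)))%R.
Proof.
move=> k0; have := sum_heat_dropr k z k0; rewrite addnn -mul2n => h.
have : (\sum_(k <= j < 2 * k) (heat_dropr k z / 2) <= \sum_(k <= j < 2 * k) heat_dropr j z)%R.
  apply: ler_sum_nat => j /andP[kj jk].
  rewrite ler_pdivrMr// -(@ler_pM2l _ k%:R) ?ltr0n//.
  apply: (le_trans (heat_dropr_scale z k0 kj)).
  rewrite mulrCA mulrC ler_wpM2l ?heat_dropr_ge0 ?(leq_trans k0)//.
  by rewrite -natrM ler_nat mulnC ltnW.
rewrite sumr_const_nat (_ : (2 * k - k = k)%N); last by rewrite mul2n -addnn addnK.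
by rewrite -(mulr_natr (heat_dropr k z / 2) k); exact: half_sum_le erefl h.
Qed.

End increments.

End superharmonic.

(** * Local exponential integrability *)

Section kernel_bounds.
Context {R : realType}.

(** At a fixed distance the kernel increases with time until twice the time reaches the squared
    distance. The integrated form of this is t / s <= exp (t / s - 1). *)
Lemma gauss_le_far (s t : R) z w : 0 < s -> s <= t -> 2 * t <= sqdist z w ->
  gauss s z w <= gauss t z w.
Proof.
move=> s0 st xt; have t0 := lt_le_trans s0 st.
have pi0 := @pi_gt0 R.
rewrite /gauss -ler_pdivlMl ?invr_gt0 ?mulr_gt0//.
rewrite mulrA (_ : (2 * pi * s)^-1^-1 / (2 * pi * t) = (t / s)^-1); last first.
  by rewrite invrK; move: (@pi R) pi0 => p p0; field; rewrite !gt_eqF.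
rewrite ler_pdivlMl ?divr_gt0//.
rewrite -ler_pdivlMr ?expR_gt0// -expRN -expRD opprK.
have h : t / s - 1 <= - (sqdist z w / (2 * t)) + sqdist z w / (2 * s).
  rewrite -subr_ge0 (_ : _ - _ = (sqdist z w - 2 * t) * (t - s) / (2 * s * t)).
    by rewrite divr_ge0 ?mulr_ge0 ?subr_ge0// ltW.
  by field; rewrite !gt_eqF.
apply: (@le_trans _ _ (expR (t / s - 1))); last by rewrite ler_expR.
by have := expR_ge1Dx (t / s - 1); rewrite addrC subrK.
Qed.

(** Comparison with the integral of 1 / (x + a) over [0, k], one term at a time. *)
Lemma sum_inv_le_ln (k : nat) (a : R) : 0 < a ->
  \sum_(1 <= j < k.+1) (j%:R + a)^-1 <= ln (1 + k%:R / a).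
Proof.
move=> a0; elim: k => [|k IH]; first by rewrite big_geq// mul0r addr0 ln1.
rewrite big_nat_recr//=; apply: (le_trans (lerD IH (lexx _))).
have ka0 : 0 < k%:R + a by rewrite ltr_wpDl.
have ka1 : 0 < k.+1%:R + a by rewrite ltr_wpDl.
have e1 : 1 + k%:R / a = (k%:R + a) / a by field; rewrite gt_eqF.
have e2 : 1 + k.+1%:R / a = (k.+1%:R + a) / a by field; rewrite gt_eqF.
rewrite e1 e2 !ln_div ?posrE// -lerBrDl.
have -> : ln (k.+1%:R + a) - ln a - (ln (k%:R + a) - ln a) = - (ln ((k%:R + a) / (k.+1%:R + a))).
  by rewrite ln_div ?posrE//; ring.
rewrite lerNr; have := @le_ln1Dx R ((k%:R + a) / (k.+1%:R + a) - 1).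
rewrite (addrC 1) subrK => h; apply: le_trans (h _) _.
  by rewrite ltrBrDl subrr divr_gt0.
rewrite -subr_ge0 (_ : _ - _ = 0)// -natr1; field.
by rewrite natr1 gt_eqF.
Qed.

(** Since exp y >= 1 + y, the term at time j d is at most (2 pi d)^-1 / (j + a) with a = (w.1 -
    z.1)^2 / (2 d). Only the first coordinate of the distance is kept: the singularity on the line
    w.1 = z.1 is still weak enough once the mass is small. *)
Lemma sum_gauss_le (k : nat) (d : R) z w : 0 < d -> w.1 != z.1 ->
  \sum_(1 <= j < k.+1) gauss (j%:R * d) z w <=
  (2 * pi * d)^-1 * ln (1 + 2 * (k%:R * d) / (w.1 - z.1) ^+ 2).
Proof.
move=> d0 wz; have pi0 := @pi_gt0 R.
have wz2 : 0 < (w.1 - z.1) ^+ 2 by rewrite exprn_even_gt0//= subr_eq0.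
set a := (w.1 - z.1) ^+ 2 / (2 * d).
have a0 : 0 < a by rewrite divr_gt0// mulr_gt0.
have -> : 2 * (k%:R * d) / (w.1 - z.1) ^+ 2 = k%:R / a.
  by rewrite /a; field; rewrite ?subr_eq0 ?wz ?(gt_eqF d0).
apply: (@le_trans _ _ (\sum_(1 <= j < k.+1) (2 * pi * d)^-1 * (j%:R + a)^-1)); last first.
  rewrite -mulr_sumr ler_wpM2l ?sum_inv_le_ln//.
  by rewrite invr_ge0 !mulr_ge0// ltW.
apply: ler_sum_nat => j /andP[j0 _].
have j0' : 0 < j%:R :> R by rewrite ltr0n.
rewrite /gauss (_ : (2 * pi * (j%:R * d))^-1 = (2 * pi * d)^-1 / j%:R); last first.
  by move: (@pi R) pi0 => p p0; field; rewrite !gt_eqF.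
rewrite -mulrA ler_wpM2l ?invr_ge0 ?mulr_ge0 ?(ltW pi0) ?(ltW d0)//.
rewrite -lef_pV2 ?posrE ?mulr_gt0 ?invr_gt0 ?expR_gt0 ?addr_gt0// invrK invfM invrK -expRN opprK.
have h : j%:R + a <= j%:R * (1 + sqdist z w / (2 * (j%:R * d))).
  rewrite mulrDr mulr1 lerD2l.
  rewrite (_ : _ * _ = sqdist z w / (2 * d)); last by field; rewrite !gt_eqF.
  by rewrite /a ler_wpM2r ?invr_ge0 ?mulr_ge0 ?(ltW d0)// lerDl sqr_ge0.
apply: (le_trans h); by rewrite ler_wpM2l ?(ltW j0')// expR_ge1Dx.
Qed.

End kernel_bounds.

(** * Jensen's inequality for a weight of mass at most m *)

Section jensen.
Context d (T : measurableType d) {R : realType}.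
Variables (nu : {measure set T -> \bar R}).

(* Tangent line at the mean; the deficit [m - nu setT] of mass is put at [k = 0]. *)
Lemma expR_integral_le (k w : T -> R) (m A : R) : 0 < m ->
  measurable_fun setT k -> measurable_fun setT w ->
  (forall x, 0 <= k x) -> (forall x, 0 <= w x) ->
  (\int[nu]_x (w x)%:E <= m%:E)%E ->
  (\int[nu]_x (k x * w x)%:E = A%:E)%E ->
  ((expR A)%:E <= 1 + m^-1%:E * \int[nu]_x (expR (m * k x) * w x)%:E)%E.
Proof.
move=> m0 mk mw k0 w0 wm kwA.
have W0 : (0 <= \int[nu]_x (w x)%:E)%E by apply: integral_ge0 => x _; rewrite lee_fin.
have [W WE] : exists W : R, (\int[nu]_x (w x)%:E = W%:E)%E.
  by exists (fine (\int[nu]_x (w x)%:E)%E); rewrite fineK// ge0_fin_numE// (le_lt_trans wm)// ltry.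
have A0 : 0 <= A.
  by rewrite -lee_fin -kwA; apply: integral_ge0 => x _; rewrite lee_fin mulr_ge0.
have mkw : measurable_fun setT (fun x => k x * w x) by exact: measurable_funM.
have mekw : measurable_fun setT (fun x => expR (m * k x) * w x).
  by apply: measurable_funM => //; apply: measurableT_comp => //; exact: measurable_funM.
rewrite WE !lee_fin in W0 wm.
have tangent : ((expR A * (W + m * A))%:E <= \int[nu]_x (expR (m * k x) * w x)%:E + (expR A * A * W)%:E)%E.
  have -> : (expR A * (W + m * A))%:E = (\int[nu]_x ((expR A)%:E * ((w x)%:E + m%:E * (k x * w x)%:E)))%E.
    rewrite ge0_integralZl_EFin ?expR_ge0//; last 2 first.
    - move=> x _; change (0%:E <= (w x + m * (k x * w x))%:E)%E.
      by rewrite lee_fin addr_ge0// !mulr_ge0// ltW.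
    - apply: emeasurable_funD; first exact/measurable_EFinP.
      by apply: measurable_funeM; exact/measurable_EFinP.
    rewrite ge0_integralD//; last 4 first.
    - by move=> x _; rewrite lee_fin.
    - exact/measurable_EFinP.
    - by move=> x _; rewrite -EFinM lee_fin !mulr_ge0// ltW.
    - by apply: measurable_funeM; exact/measurable_EFinP.
    rewrite ge0_integralZl_EFin ?(ltW m0)//; last 2 first.
    - by move=> x _; rewrite lee_fin mulr_ge0.
    - exact/measurable_EFinP.
    by rewrite WE kwA.
  have -> : (expR A * A * W)%:E = (\int[nu]_x ((expR A * A)%:E * (w x)%:E))%E.
    rewrite ge0_integralZl_EFin ?mulr_ge0 ?expR_ge0//; last 2 first.
    - by move=> x _; rewrite lee_fin.
    - exact/measurable_EFinP.
    by rewrite WE.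
  rewrite -ge0_integralD//; last 4 first.
  - by move=> x _; rewrite lee_fin mulr_ge0 ?expR_ge0.
  - exact/measurable_EFinP.
  - by move=> x _; rewrite -EFinM lee_fin !mulr_ge0 ?expR_ge0.
  - by apply: measurable_funeM; exact/measurable_EFinP.
  apply: ge0_le_integral => //.
  - move=> x _; change (0%:E <= (expR A * (w x + m * (k x * w x)))%:E)%E.
    by rewrite lee_fin mulr_ge0 ?expR_ge0// addr_ge0// !mulr_ge0// ltW.
  - apply: measurable_funeM; apply: emeasurable_funD; first exact/measurable_EFinP.
    by apply: measurable_funeM; exact/measurable_EFinP.
  - apply: emeasurable_funD; first exact/measurable_EFinP.
    by apply: measurable_funeM; exact/measurable_EFinP.
  move=> x _.
  change ((expR A * (w x + m * (k x * w x)))%:E <= (expR (m * k x) * w x + expR A * A * w x)%:E)%E.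
  rewrite lee_fin.
  have h : expR A * (1 + (m * k x - A)) <= expR (m * k x).
    by rewrite -ler_pdivlMl ?expR_gt0// -expRN -expRD (addrC (- A)) expR_ge1Dx.
  have := ler_wpM2r (w0 x) h; clear; lra.
rewrite -(@lee_pmul2l _ m%:E)// ge0_muleDr//; last first.
  rewrite mule_ge0 ?lee_fin ?invr_ge0 ?(ltW m0)//.
  by apply: integral_ge0 => x _; rewrite lee_fin mulr_ge0// expR_ge0.
rewrite muleA -!EFinM mulfV ?gt_eqF// mul1e mulr1.
have [->|fin] := eqVneq (\int[nu]_x (expR (m * k x) * w x)%:E)%E +oo%E.
  by rewrite addey// leey.
have [I IE] : exists I : R, (\int[nu]_x (expR (m * k x) * w x)%:E = I%:E)%E.
  exists (fine (\int[nu]_x (expR (m * k x) * w x)%:E)%E); rewrite fineK// ge0_fin_numE ?ltey//.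
  by apply: integral_ge0 => x _; rewrite lee_fin mulr_ge0// expR_ge0.
move: tangent; rewrite IE -!EFinD !lee_fin => tangent.
have eA := expR_ge1Dx A.
have eNA : expR A * (1 - A) <= 1.
  by rewrite -ler_pdivlMl ?expR_gt0// mulr1 -expRN; exact: expR_ge1Dx.
(* By [tangent], I >= exp A (W (1 - A) + m A), which is affine in the mass W between 0 and [m]. For
   A >= 1 the worst case is W = m and gives I >= m exp A; for A < 1 it is W = 0, where exp A (1 - A)
   <= 1 accounts for the summand 1 of the conclusion. *)
have [A1|A1] := leP 1 A.
  have : 0 <= expR A * ((A - 1) * (m - W)) by rewrite !mulr_ge0 ?expR_ge0 ?subr_ge0.
  by move: tangent eA m0; clear; lra.
have : 0 <= expR A * ((1 - A) * W) by rewrite !mulr_ge0 ?expR_ge0 ?subr_ge0// ltW.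
have : m * (expR A * (1 - A)) <= m * 1 by rewrite ler_pM2l.
by move: tangent eA m0; clear; lra.
Qed.

End jensen.

(** * The singularity |x|^(-1/2) on the line *)

Section singular_integral.
Context {R : realType}.
Local Notation mu := (@lebesgue_measure R).
Local Open Scope ereal_scope.

Let measurable_rsqrt : measurable_fun setT (fun x : measurableTypeR R => (x `^ (- 2^-1))%:E).
Proof. by apply/measurable_EFinP; exact: measurable_powR. Qed.

Lemma integral_rsqrt (b : R) : (0 < b)%R ->
  \int[mu]_(x in `[0%R, b]) (x `^ (- 2^-1))%:E <= (2 * b `^ 2^-1)%:E.
Proof.
(* The index [n.+2] keeps every left endpoint strictly below [b], as the fundamental theorem of
   calculus requires. *)
move=> b0; pose a n : R := (b / n.+2%:R)%R.
have a0 n : (0 < a n)%R by rewrite divr_gt0.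
have ab n : (a n < b)%R by rewrite ltr_pdivrMr// ltr_pMr// ltr1n.
rewrite -integral_itv_obnd_cbnd; last exact: measurable_funTS.
have -> : `]0%R, b]%classic = \bigcup_n `[a n, b]%classic.
  apply/seteqP; split=> [x/=|x [n _]]/=; rewrite !in_itv/= => /andP[x1 x2]; last first.
    by rewrite x2 (lt_le_trans (a0 n)).
  have [n nbx] : exists n, (b / x < n%:R)%R.
    by exists (Num.truncn (b / x)).+1; rewrite truncnS_gt// num_real.
  exists n => //=; rewrite in_itv/= x2 andbT /a.
  rewrite ler_pdivrMr// mulrC -ler_pdivrMr// ltW// (lt_trans nbx)// ltr_nat//.
have nd : nondecreasing_seq (fun n => `[a n, b]%classic : set R).
  apply/nondecreasing_seqP => n; apply/subsetPset => x /=; rewrite !in_itv/=.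
  move=> /andP[x1 ->]; rewrite andbT; apply: le_trans x1.
  by rewrite /a ler_pM2l// lef_pV2 ?posrE ?ltr0n// ler_nat.
have cvgI : \int[mu]_(x in `[a n, b]) (x `^ (- 2^-1))%:E @[n --> \oo] -->
    \int[mu]_(x in \bigcup_n `[a n, b]%classic) (x `^ (- 2^-1))%:E.
  apply: ge0_nondecreasing_set_cvg_integral => //.
  - by move=> n; exact: measurable_funTS.
  - by move=> n x _; rewrite lee_fin powR_ge0.
rewrite -(cvg_lim _ cvgI)//; apply: lime_le; first by apply/cvg_ex; eexists; exact: cvgI.
apply: nearW => n.
rewrite (@continuous_FTC2 _ (fun x => x `^ (- 2^-1))%R (fun x => 2 * x `^ 2^-1)%R)//.
- by rewrite -EFinB lee_fin lerBlDr lerDl mulr_ge0 ?powR_ge0.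
- apply: (@derivable_within_continuous _ _ (fun x : R => x `^ (- 2^-1))%R) => x.
  rewrite in_itv/= => /andP[ax _]; have x0 := lt_le_trans (a0 n) ax.
  by apply: derivable_powR; rewrite in_itv/= x0.
- have df x : (0 < x)%R -> derivable (fun x : R => 2 * x `^ 2^-1)%R x 1.
    move=> x0; apply: derivableM => //; apply: derivable_powR.
    by rewrite in_itv/= x0.
  have cf (x : R) : (0 < x)%R -> {for x, continuous (fun x : R => 2 * x `^ 2^-1)%R}.
    by move=> x0; apply: differentiable_continuous; apply/derivable1_diffP; exact: df.
  split.
  + move=> x; rewrite in_itv/= => /andP[ax _]; apply: df; exact: lt_trans (a0 n) ax.
  + by apply: cvg_at_right_filter; exact: cf.
  + by apply: cvg_at_left_filter; exact: cf.
- move=> x; rewrite in_itv/= => /andP[ax _]; have x0 := lt_trans (a0 n) ax.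
  rewrite derive1E deriveM//; last by apply: derivable_powR; rewrite in_itv/= x0.
  rewrite derive_cst scaler0 addr0 -derive1E powR_derive1 ?in_itv/= ?x0//.
  rewrite /GRing.scale/= mulrA mulfV// mul1r; congr (_ `^ _)%R; lra.
Qed.

(* The value at [0] dominates any value, so that bounds need not exclude [0]. *)
Definition rsqrt_sing (L x : R) : \bar R :=
  (\1_`[(- L)%R, L]%classic x * `|x| `^ (- 2^-1))%:E + +oo * (\1_[set 0%R] x)%:E.

Lemma rsqrt_sing_ge0 L x : 0 <= rsqrt_sing L x.
Proof. by rewrite /rsqrt_sing adde_ge0 ?mule_ge0 ?lee_fin ?mulr_ge0 ?powR_ge0. Qed.

Lemma measurable_rsqrt_sing L : measurable_fun setT (rsqrt_sing L : measurableTypeR R -> \bar R).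
Proof.
have mI (A : set (measurableTypeR R)) : measurable A -> measurable_fun setT (\1_A : measurableTypeR R -> R).
  by move=> mA; exact: measurable_indic.
apply: emeasurable_funD.
  apply/measurable_EFinP; apply: measurable_funM; first by apply: mI.
  have mp : measurable_fun setT (fun y : measurableTypeR R => (y `^ (- 2^-1))%R : measurableTypeR R).
    exact: measurable_powR.
  have mn : measurable_fun setT (fun x : measurableTypeR R => `|x|%R : measurableTypeR R).
    exact: normr_measurable.
  exact: (measurableT_comp mp mn).
by apply: measurable_funeM; apply/measurable_EFinP; exact: mI.
Qed.

Lemma integral_rsqrt_sing (L : R) : (0 < L)%R -> \int[mu]_x rsqrt_sing L x < +oo.
Proof.
move=> L0.
have mI (A : set (measurableTypeR R)) : measurable A -> measurable_fun setT (\1_A : measurableTypeR R -> R).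
  by move=> mA; exact: measurable_indic.
pose f (x : measurableTypeR R) := ((fun x => (x `^ (- 2^-1))%:E) \_ `[0%R, L]) x : \bar R.
have mf : measurable_fun setT f.
  by apply/(measurable_restrictT _ _).1 => //; exact: measurable_funTS.
have f0 x : 0 <= f x by apply: erestrict_ge0 => y _; rewrite lee_fin powR_ge0.
have mfN : measurable_fun setT (fun x : measurableTypeR R => f (-1 * x + 0)%R).
  exact: measurableT_comp (measurable_affine (-1) 0).
apply: (@le_lt_trans _ _ (\int[mu]_x ((f x + f (-1 * x + 0)%R) + +oo * (\1_[set 0%R] x)%:E))).
  apply: ge0_le_integral => //.
  - by move=> x _; exact: rsqrt_sing_ge0.
  - exact: measurable_rsqrt_sing.
  - apply: emeasurable_funD; first exact: emeasurable_funD.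
    by apply: measurable_funeM; apply/measurable_EFinP; exact: mI.
  move=> x _; apply: leeD => //; rewrite indicE mem_setE in_itv/=.
  rewrite /f mulN1r addr0 !patchE !mem_setE !in_itv/=.
  have [x0|x0] := leP 0%R x.
    rewrite ger0_norm// (le_trans _ x0) ?oppr_le0 ?(ltW L0)//=.
    have [xL|xL] := boolP (x <= L)%R; last by rewrite mul0r; case: ifP; rewrite ?add0e// lee_fin powR_ge0.
    rewrite mul1r; case: ifP; rewrite ?adde0// => _.
    by rewrite -EFinD lee_fin lerDl powR_ge0.
  rewrite ltr0_norm// add0e (le_trans (ltW x0)) ?(ltW L0)// andbT.
  have [xL|xL] := boolP (- L <= x)%R; last first.
    by rewrite mul0r; case: ifP; rewrite ?lee_fin ?powR_ge0.
  by rewrite mul1r oppr_ge0 (ltW x0) lerNl xL.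
have mp : measurable_fun setT (fun x : measurableTypeR R => +oo * (\1_[set 0%R] x)%:E : \bar R).
  by apply: measurable_funeM; apply/measurable_EFinP; exact: mI.
have h1 x : setT x -> 0 <= f x + f (-1 * x + 0)%R by move=> _; rewrite adde_ge0.
have h2 : measurable_fun setT (fun x : measurableTypeR R => f x + f (-1 * x + 0)%R).
  exact: emeasurable_funD.
have h3 (x : measurableTypeR R) : setT x -> 0 <= +oo * (\1_[set 0%R] x)%:E :> \bar R.
  by move=> _; rewrite mule_ge0// lee_fin.
rewrite (ge0_integralD mu measurableT h1 h2 h3 mp).
have -> : \int[mu]_x (+oo * (\1_[set 0%R] x)%:E) = 0.
  rewrite ge0_integralZl//.
  - by rewrite integral_indic// setIT [X in _ * X](_ : _ = 0) ?mule0//; exact: lebesgue_measure_set1.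
  - by apply/measurable_EFinP; exact: mI.
rewrite adde0 ge0_integralD//.
have := @ge0_integral_affine _ (-1) 0 f; rewrite oppr_eq0 oner_neq0 normrN1 mul1e => ->//.
rewrite /f -integral_mkcond lte_add_pinfty//;
  by apply: (le_lt_trans (integral_rsqrt L0)); rewrite ltry.
Qed.

(** Since c <= 1/4, the exponential is at most ((T + x^2) / x^2)^(1/4), that is, at most (T +
    L^2)^(1/4) |x|^(-1/2). At x = 0 nothing is assumed about [y], and the infinite value of
    [rsqrt_sing] takes over. *)
Lemma expR_ln_le_rsqrt_sing (T L x c : R) : (0 < T)%R -> (0 <= c <= 4^-1)%R -> (x != 0 -> `|x| <= L)%R ->
  forall y : R, (x != 0 -> y <= c * ln (1 + T / x ^+ 2))%R ->
  (expR y)%:E <= (expR (4^-1 * ln (T + L ^+ 2)))%:E * rsqrt_sing L x.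
Proof.
move=> T0 /andP[c0 c4] xL y yc; rewrite /rsqrt_sing.
have [x0|x0] := eqVneq x 0%R.
  rewrite !indicE (@mem_set _ [set 0%R])// mule1 addey ?gt0_muley ?leey// lte_fin expR_gt0//.
have {}xL := xL x0; have {}yc := yc x0.
rewrite [X in +oo * (X)%:E]indicE memNset//= ?mule0 ?adde0; last by apply/eqP.
rewrite indicE mem_set/= ?mul1r; last by rewrite in_itv/= -ler_norml.
have nx0 : (0 < `|x|)%R by rewrite normr_gt0.
have x20 : (0 < x ^+ 2)%R by rewrite exprn_even_gt0.
rewrite -EFinM lee_fin /powR gt_eqF// -expRD ler_expR.
apply: (le_trans yc).
have l0 : (0 <= ln (1 + T / x ^+ 2))%R by rewrite ln_ge0// lerDl divr_ge0// ltW.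
apply: (le_trans (ler_wpM2r l0 c4)).
rewrite (_ : 1 + T / x ^+ 2 = (T + x ^+ 2) / x ^+ 2)%R; last by field.
have Tx0 : (0 < T + x ^+ 2)%R by rewrite addr_gt0.
have lx2 : (ln (x ^+ 2) = 2 * ln `|x|)%R.
  by rewrite -real_normK ?num_real// lnXn// mulr_natl.
rewrite ln_div ?posrE// lx2.
have : (ln (T + x ^+ 2) <= ln (T + L ^+ 2))%R.
  rewrite ler_ln ?posrE//; last by rewrite ltr_wpDr// sqr_ge0.
  by rewrite lerD2l -real_normK ?num_real// ler_sqr ?nnegrE// (le_trans _ xL).
by clear; lra.
Qed.

End singular_integral.

(* Unfolding these in conversion makes [ring] and [lra] very slow. *)
Opaque heatr heat_dropr.

Lemma near_integral_arith {R : realType} (X S a h2 hk ht h4 e H T d dk : R) :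
  dk = 4 * T -> S <= X + a -> S + hk = h2 + dk -> d <= T ->
  a <= 2 * (ht - h4 + 12 * T) -> hk <= ht + 8 * d -> ht <= 2 * e * H ->
  0 <= h4 -> 0 <= d -> h2 <= X + (6 * e * H + 28 * T).
Proof. lra. Qed.

Section exponential_integrability.
Context {R : realType}.
Local Notation mu := (@lebesgue_measure R).
Local Notation mu2 := (@lebesgue2 R).
Local Open Scope ereal_scope.
Variables (g : R2 R -> \bar R).
Hypotheses (mg : measurable_fun setT g) (g0 : forall z, 0 <= g z)
  (sg : circle_superharmonic g) (gfin : exists a, g a < +oo).

Definition square (a : R2 R) (s : R) : set (R2 R) :=
  `[(a.1 - s)%R, (a.1 + s)%R]%classic `*` `[(a.2 - s)%R, (a.2 + s)%R]%classic.

Lemma squareP a s z : square a s z <-> (`|z.1 - a.1| <= s /\ `|z.2 - a.2| <= s)%R.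
Proof. by rewrite /square/= !in_itv/= -!ler_distl. Qed.

Lemma measurable_square a s : measurable (square a s).
Proof. exact: measurableX. Qed.

Lemma lebesgue2_square a (s : R) : (0 <= s)%R -> mu2 (square a s) = (4 * s ^+ 2)%:E.
Proof.
move=> s0; rewrite /lebesgue2 product_measure1E//= !lebesgue_measure_itv/= !lte_fin.
have [->|sn0] := eqVneq s 0%R; first by rewrite !subr0 !addr0 !ltxx mule0 expr0n mulr0.
have s1 : (0 < s)%R by rewrite lt_neqAle eq_sym sn0.
have lt1 (x : R) : (x - s < x + s)%R by lra.
by rewrite !lt1 -!EFinB -EFinM; congr EFin; ring.
Qed.

Section fixed_scale.
Variables (z0 : R2 R) (T m c : R) (k : nat).
Hypotheses (T0 : (0 < T)%R) (m0 : (0 < m)%R) (c0 : (0 < c)%R) (k0 : (0 < k)%N)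
  (cm : (c * m <= pi / 2)%R)
  (hm : (4 * pi * expR 4 * (heatr g T z0 - heatr g (4 * T) z0 + 12 * T) <= m)%R).

Let d := (T / k%:R)%R.
Let kR0 : (0 < k%:R :> R)%R. Proof. by rewrite ltr0n. Qed.
Let d0 : (0 < d)%R. Proof. by rewrite divr_gt0. Qed.
Let kd : (k%:R * d = T)%R. Proof. by rewrite /d mulrC divfK// gt_eqF. Qed.
Let ff := heat_drop g d.
Let ff0 z : (0 <= ff z)%R. Proof. exact: heat_drop_ge0. Qed.
Let mff : measurable_fun setT ff. Proof. exact: measurable_heat_drop. Qed.
Let near := [set w | (sqdist z0 w < 8 * T)%R].
Let mnear : measurable near.
Proof.
have h : measurable_fun setT (fun w => sqdist z0 w < 8 * T)%R.
  by apply: measurable_fun_ltr => //; exact: measurable_sqdist.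
by have := h measurableT [set true] I; rewrite setTI.
Qed.
Let Q := square z0 (Num.sqrt T).
Let K z w : R := (\sum_(1 <= j < k.+1) gauss (j%:R * d) z w)%R.
Let K0 z w : (0 <= K z w)%R.
Proof.
rewrite /K big_nat; apply: sumr_ge0 => j /andP[j0 _].
by rewrite gauss_ge0// mulr_gt0// ltr0n.
Qed.
Let mK d' (U : measurableType d') (u v : U -> R2 R) : measurable_fun setT u -> measurable_fun setT v ->
  measurable_fun setT (fun x => K (u x) (v x)).
Proof. by move=> mu_ mv; apply: measurable_sum => j; exact: measurable_gauss. Qed.
Let wgt w : R := (k%:R / T * ff w * \1_near w)%R.
Let mwgt : measurable_fun setT wgt.
Proof.
apply: (measurable_funM (f := fun w => (k%:R / T * ff w)%R)); first exact: measurable_funM.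
exact: measurable_indic.
Qed.
Let wgt0 w : (0 <= wgt w)%R.
Proof. by rewrite !mulr_ge0// ?invr_ge0 ltW. Qed.

(** [heat_dropr_le] involves the times T + d and 2 T + d. Replacing them by T and 4 T costs 4 d and
    4 (2 T - d); with the term 4 T already present the dependence on d cancels and 12 T is left. *)
Let heat_drop_T z : (k%:R * heat_dropr g d k z <= 2 * (heatr g T z - heatr g (4 * T) z + 12 * T))%R.
Proof.
apply: (le_trans (heat_dropr_le mg g0 sg gfin d0 z k0)).
have h1 := heatr_le mg g0 sg gfin z T0 d0.
have dT : (d <= T)%R by rewrite ler_pdivrMr// ler_peMr ?(ltW T0)// ler1n.
have T21 : (0 < (2 * k).+1%:R * d)%R by rewrite mulr_gt0 ?ltr0n.
have e1 : (k.+1%:R * d = T + d)%R by rewrite -natr1 mulrDl kd mul1r.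
have e2 : ((2 * k).+1%:R * d = 2 * T + d)%R by rewrite -natr1 natrM mulrDl -mulrA kd mul1r.
have h2 : (heatr g (4 * T) z <= heatr g (2 * T + d) z + 4 * (4 * T - (2 * T + d)))%R.
  have T2 : (0 < 2 * T + d)%R by rewrite -e2.
  have T4 : (2 * T + d <= 4 * T)%R.
    rewrite (_ : 4 * T = 2 * T + 2 * T)%R ?lerD2l; last by ring.
    by apply: (le_trans dT); rewrite ler_peMl ?(ltW T0)// ler1n.
  exact: (heatr_le2 mg g0 sg gfin z T2 T4).
rewrite e1 e2 kd; move: h1 h2 d0.
move: (heatr _ _ _) (heatr _ _ _) (heatr _ _ _) (heatr _ _ _) => a b e f.
by lra.
Qed.

(** Where |w - z0|^2 < 8 T the kernel at time [T] is at least exp (-4) / (2 pi T), so the mass of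
    [heat_drop] / d on [near] is at most 2 pi exp 4 times [k] times its Gaussian average at time
    [T]. Together with the factor 2 of [heat_drop_T] this is the origin of 4 pi exp 4 in [hm]. *)
Lemma near_mass : \int[mu2]_w (wgt w)%:E <= m%:E.
Proof.
have pi0 := @pi_gt0 R.
apply: (@le_trans _ _ (2 * pi * expR 4 * (k%:R * heat_dropr g d k z0))%:E); last first.
  rewrite lee_fin; apply: le_trans hm.
  have two (x : R) : (4 * pi * expR 4 * x = 2 * pi * expR 4 * (2 * x))%R by ring.
  rewrite two.
  by rewrite ler_wpM2l ?heat_drop_T// !mulr_ge0 ?expR_ge0// ltW.
rewrite EFinM [(k%:R * _)%:E]EFinM -(heat_droprE mg g0 sg gfin d0 z0 k0) kd /heat.
have mgf : measurable_fun setT (fun w => (gauss T z0 w)%:E * (ff w)%:E).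
  by apply: measurable_gaussM; exact/measurable_EFinP.
rewrite -ge0_integralZl_EFin//; last by move=> w _; rewrite mule_ge0 ?lee_fin ?gauss_ge0.
rewrite -ge0_integralZl_EFin//; last 3 first.
- by move=> w _; rewrite !mule_ge0 ?lee_fin ?gauss_ge0.
- exact: measurable_funeM.
- by rewrite !mulr_ge0 ?expR_ge0// ltW.
apply: ge0_le_integral => //.
- by move=> w _; rewrite lee_fin.
- exact/measurable_EFinP.
- by do 2 apply: measurable_funeM.
move=> w _; rewrite -!EFinM lee_fin /wgt indicE.
have [wn|_] := boolP (w \in near); last first.
  rewrite mulr0; apply: mulr_ge0; first by rewrite !mulr_ge0 ?expR_ge0 ?(ltW pi0).
  by apply: mulr_ge0 => //; apply: mulr_ge0; [exact: gauss_ge0|exact: ff0].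
rewrite mulr1 -/ff -(mulrA k%:R) (mulrCA (2 * pi * expR 4)%R) ler_wpM2l ?(ltW kR0)// mulrA ler_wpM2r//.
rewrite /gauss mulrA (_ : 2 * pi * expR 4 * (2 * pi * T)^-1 = T^-1 * expR 4)%R; last first.
  by move: (@pi R) pi0 => p p0; field; rewrite !gt_eqF.
rewrite -mulrA -expRD ler_peMr ?invr_ge0 ?(ltW T0)// -[leLHS]expR0 ler_expR.
rewrite subr_ge0 ler_pdivrMr ?mulr_gt0//.
by move: wn; rewrite inE /near/=; lra.
Qed.

Let sqdistQ z : Q z -> (sqdist z z0 <= 2 * T)%R.
Proof.
have h (x : R) : (`|x| <= Num.sqrt T)%R -> (x ^+ 2 <= T)%R.
  move=> xT; rewrite -real_normK ?num_real// -(sqr_sqrtr (ltW T0)).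
  by rewrite ler_sqr ?nnegrE ?sqrtr_ge0.
move=> /squareP[/h h1 /h h2]; rewrite sqdistC /sqdist; move: h1 h2; lra.
Qed.

(** The radius of [near] is chosen for this: |z - z0|^2 <= 2 T and |w - z0|^2 >= 8 T force |z - w|^2
    >= 2 T, where each of the [k] kernels is at most the one at time [T]. *)
Let far_kernel z w : Q z -> (8 * T <= sqdist z0 w)%R -> (K z w <= k%:R * gauss T z w)%R.
Proof.
move=> /sqdistQ Qz w8.
have zw : (2 * T <= sqdist z w)%R.
  have := sqdist_le2 z0 z w; move: Qz w8; lra.
rewrite /K [leRHS](_ : _ = \sum_(1 <= j < k.+1) gauss T z w)%R; last first.
  by rewrite sumr_const_nat subn1 mulr_natl.
apply: ler_sum_nat => j /andP[j0 jk]; apply: gauss_le_far => //.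
- by rewrite mulr_gt0// ltr0n.
- by rewrite -kd ler_wpM2r ?(ltW d0)// ler_nat.
Qed.

Let sum_dropE z : (\sum_(1 <= j < k.+1) heat_dropr g d j z)%:E = \int[mu2]_w (K z w * ff w)%:E.
Proof.
transitivity (\sum_(1 <= j < k.+1) \int[mu2]_w (gauss (j%:R * d) z w * ff w)%:E).
  rewrite -sumEFin; apply: eq_big_nat => j /andP[j0 _].
  by rewrite -(heat_droprE mg g0 sg gfin d0 z j0).
rewrite -ge0_integral_sum//.
- apply: eq_integral => w _; rewrite sumEFin -mulr_suml//.
- by move=> j; apply/measurable_EFinP; apply: measurable_funM => //; exact: measurable_gauss.
- by move=> j w _; rewrite lee_fin mulr_ge0// gauss_nneg// mulr_ge0// ltW.
Qed.

Let mKff z : measurable_fun setT (fun w => (K z w * ff w)%R).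
Proof. by apply: measurable_funM => //; exact: mK. Qed.

Let mKffn z : measurable_fun setT (fun w => (K z w * ff w * \1_near w)%R).
Proof.
by apply: (measurable_funM (f := fun w => (K z w * ff w)%R)) => //; exact: measurable_indic.
Qed.

Let far_split z : Q z ->
  \int[mu2]_w (K z w * ff w)%:E <= \int[mu2]_w (K z w * ff w * \1_near w)%:E + (k%:R * heat_dropr g d k z)%:E.
Proof.
move=> Qz; rewrite EFinM -(heat_droprE mg g0 sg gfin d0 z k0) kd /heat.
have mgf : measurable_fun setT (fun w => (gauss T z w)%:E * (ff w)%:E).
  by apply: measurable_gaussM; exact/measurable_EFinP.
rewrite -ge0_integralZl_EFin//; last first.
- by move=> w _; rewrite mule_ge0 ?lee_fin ?gauss_ge0.
rewrite -ge0_integralD//; last 4 first.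
- by move=> w _; rewrite lee_fin !mulr_ge0.
- exact/measurable_EFinP.
- by move=> w _; rewrite !mule_ge0 ?lee_fin ?gauss_ge0.
- exact: measurable_funeM.
apply: ge0_le_integral => //.
- by move=> w _; rewrite lee_fin !mulr_ge0.
- exact/measurable_EFinP.
- by apply: emeasurable_funD; [exact/measurable_EFinP|exact: measurable_funeM].
move=> w _; rewrite -!EFinM -EFinD lee_fin indicE.
have [wn|wn] := boolP (w \in near).
  rewrite mulr1 lerDl; apply: mulr_ge0 => //.
  by apply: mulr_ge0; [exact: gauss_ge0|exact: ff0].
rewrite mulr0 add0r mulrA ler_wpM2r// far_kernel// leNgt.
by apply: contra wn => wn; rewrite inE.
Qed.

(** Everything in the average of [g] at time 2 d that does not come from the near mass, uniformly on
    [Q] and in [k]. With ht the average at time T at a point of [Q], the far part gives at most 2 ht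
    + 24 T and the last term of the telescoping sum at most ht + 8 T, while 4 T is subtracted;
    [heat_shift] bounds ht by 2 exp 1 times the average at time 2 T at [z0]. *)
Definition heat_bound : R := (6 * expR 1 * heatr g (2 * T) z0 + 28 * T)%R.

Let near_integral z : Q z -> exists I : R,
  \int[mu2]_w (K z w * ff w * \1_near w)%:E = I%:E /\
  (heatr g (2 * d) z <= I + heat_bound)%R.
Proof.
move=> Qz; have := far_split Qz; set X := \int[mu2]_w (_ * \1_near w)%:E.
have X0 : 0 <= X by apply: integral_ge0 => w _; rewrite lee_fin !mulr_ge0.
have Xfin : X < +oo.
  apply: (@le_lt_trans _ _ (\int[mu2]_w (K z w * ff w)%:E)); last by rewrite -sum_dropE ltry.
  apply: ge0_le_integral => //.
  - by move=> w _; rewrite lee_fin !mulr_ge0.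
  - exact/measurable_EFinP.
  - exact/measurable_EFinP.
  move=> w _; rewrite lee_fin indicE; case: (w \in near); rewrite ?mulr1// mulr0 mulr_ge0//.
have -> : X = (fine X)%:E by rewrite fineK// ge0_fin_numE.
rewrite -sum_dropE -EFinD lee_fin => h; exists (fine X); split => //.
have S0 := sum_heat_dropr mg g0 sg gfin d0 k z (ltn0Sn 0).
rewrite add1n in S0.
have dT : (d <= T)%R by rewrite ler_pdivrMr// ler_peMr ?(ltW T0)// ler1n.
have a1 := heat_drop_T z.
have b1 : (heatr g (k.+2%:R * d) z <= heatr g T z + 8 * d)%R.
  have d20 : (0 < 2 * d)%R by rewrite mulr_gt0.
  have := heatr_le mg g0 sg gfin z T0 d20.
  have k2 : k.+2 = (k + 2)%N by rewrite addn2.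
  have -> : (k.+2%:R * d = T + 2 * d)%R by rewrite k2 natrD mulrDl kd.
  by rewrite mulrA (_ : 4 * 2 = 8)%R//; ring.
have T20 : (0 < 2 * T)%R by rewrite mulr_gt0.
have c1 : (heatr g T z <= 2 * expR 1 * heatr g (2 * T) z0)%R.
  have := heat_shift mg g0 z z0 T0; rewrite !heatrE// -EFinM lee_fin => h1.
  apply: (le_trans h1); rewrite ler_wpM2r ?heatr_ge0// ler_wpM2l// ler_expR.
  by rewrite ler_pdivrMr// mul1r; exact: sqdistQ.
have h4 : (0 <= heatr g (4 * T) z)%R by rewrite heatr_ge0// mulr_gt0.
rewrite /heat_bound.
have dk : (4 * d * k%:R = 4 * T)%R by rewrite -mulrA (mulrC d) kd.
exact: near_integral_arith dk h S0 dT a1 b1 c1 h4 (ltW d0).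
Qed.

Let L := (4 * Num.sqrt T)%R.
Let C := expR (4^-1 * ln (2 * T + L ^+ 2)).
Let E z w : R := expR (m * (c * (T / k%:R) * K z w)).
Let mE d' (U : measurableType d') (u v : U -> R2 R) : measurable_fun setT u -> measurable_fun setT v ->
  measurable_fun setT (fun x => E (u x) (v x)).
Proof.
move=> mu_ mv; apply: measurableT_comp => //; apply: measurable_funM => //.
by apply: measurable_funM => //; exact: mK.
Qed.

(** By [sum_gauss_le] the exponent is at most (c m / (2 pi)) ln (1 + 2 T / x^2) with x = w.1 - z.1,
    since d = T / k; the hypothesis [cm] says exactly that the factor is at most 1/4. The length [L]
    bounds |x|, as z.1 and w.1 are within 1 and 3 times the square root of [T] of z0.1. *)
Let kernel_sing z w : Q z -> near w ->
  (E z w)%:E <= C%:E * rsqrt_sing L (- 1 * z.1 + w.1)%R.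
Proof.
have pi0 := @pi_gt0 R.
move=> /squareP[z1 _] wn.
have st0 : (0 <= Num.sqrt T)%R by rewrite sqrtr_ge0.
have w1 : (`|w.1 - z0.1| <= 3 * Num.sqrt T)%R.
  rewrite -ler_sqr ?nnegrE ?mulr_ge0// real_normK ?num_real// exprMn sqr_sqrtr ?(ltW T0)//.
  have := sqr_ge0 (w.2 - z0.2); move: wn T0; rewrite /near/= /sqdist; lra.
rewrite mulN1r addrC; apply: (@expR_ln_le_rsqrt_sing _ (2 * T) _ _ (c * m / (2 * pi)))%R.
- by rewrite mulr_gt0.
- rewrite divr_ge0 ?mulr_ge0 ?(ltW pi0) ?(ltW m0) ?(ltW c0)//=.
  by rewrite ler_pdivrMr ?mulr_gt0//; move: cm; lra.
- move=> _; rewrite (_ : w.1 - z.1 = (w.1 - z0.1) - (z.1 - z0.1))%R; last by ring.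
  by apply: (le_trans (ler_normB _ _)); rewrite /L; move: w1 z1; lra.
rewrite subr_eq0 => wz; have := sum_gauss_le k d0 wz; rewrite -/(K z w) kd => h.
have cmT : (0 <= m * (c * (T / k%:R)))%R := mulr_ge0 (ltW m0) (mulr_ge0 (ltW c0) (ltW d0)).
apply: (@le_trans _ _ (m * (c * (T / k%:R)) * ((2 * pi * d)^-1 * ln (1 + 2 * T / (w.1 - z.1) ^+ 2))))%R.
  by rewrite mulrA ler_wpM2l.
rewrite [leLHS]mulrA le_eqVlt; apply/orP; left; apply/eqP; congr (_ * _)%R.
rewrite /d; move: (@pi R) pi0 => p p0; field.
by rewrite ?(gt_eqF p0) ?(gt_eqF T0) ?(gt_eqF kR0).
Qed.

Let S := fine (\int[mu]_x rsqrt_sing L x).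
Let L0 : (0 < L)%R. Proof. by rewrite mulr_gt0// sqrtr_gt0. Qed.
Let SE : \int[mu]_x rsqrt_sing L x = S%:E.
Proof.
rewrite /S fineK// ge0_fin_numE ?integral_rsqrt_sing//.
by apply: integral_ge0 => x _; exact: rsqrt_sing_ge0.
Qed.
Let S0 : (0 <= S)%R.
Proof. by rewrite -lee_fin -SE; apply: integral_ge0 => x _; exact: rsqrt_sing_ge0. Qed.

Let kernel_integral w : near w ->
  \int[mu2]_z (\1_Q z * E z w)%:E <= (2 * Num.sqrt T * (C * S))%:E.
Proof.
move=> wn; have st0 : (0 < Num.sqrt T)%R by rewrite sqrtr_gt0.
pose I2 : set (measurableTypeR R) := `[(z0.2 - Num.sqrt T)%R, (z0.2 + Num.sqrt T)%R]%classic.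
pose F := fun z : R2 R => C%:E * rsqrt_sing L (- 1 * z.1 + w.1)%R * (\1_I2 z.2)%:E.
have mr : measurable_fun setT (fun x : measurableTypeR R => rsqrt_sing L (- 1 * x + w.1)%R).
  exact: (measurableT_comp (measurable_rsqrt_sing L) (measurable_affine (-1) w.1)).
have mI2 : measurable_fun setT (\1_I2 : measurableTypeR R -> R).
  by apply: measurable_indic; exact: measurable_itv.
have mF : measurable_fun setT F.
  apply: emeasurable_funM.
    apply: measurable_funeM; exact: (measurableT_comp mr measurable_fst).
  by apply/measurable_EFinP; exact: (measurableT_comp mI2 measurable_snd).
have F0 z : 0 <= F z by rewrite !mule_ge0 ?rsqrt_sing_ge0 ?lee_fin ?expR_ge0.
apply: (@le_trans _ _ (\int[mu2]_z F z)).
  apply: ge0_le_integral => //.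
  - by move=> z _; rewrite lee_fin mulr_ge0 ?expR_ge0.
  - apply/measurable_EFinP; apply: measurable_funM; last exact: mE.
    by apply: measurable_indic; exact: measurable_square.
  move=> z _; rewrite indicE; have [zQ|_] := boolP (z \in Q); last by rewrite mul0r.
  rewrite mul1r /F indicE mem_set ?mule1; last by case: (set_mem zQ).
  by apply: kernel_sing => //; exact: set_mem zQ.
rewrite ge0_integral2E// /F/=.
have inner x : \int[mu]_y (C%:E * rsqrt_sing L (- 1 * x + w.1)%R * (\1_I2 y)%:E) =
    C%:E * rsqrt_sing L (- 1 * x + w.1)%R * (2 * Num.sqrt T)%:E.
  have m1 : measurable_fun setT (fun y : measurableTypeR R => (\1_I2 y : R)%:E).
    exact/measurable_EFinP.
  have f1 (y : measurableTypeR R) : setT y -> 0 <= (\1_I2 y)%:E by move=> _; rewrite lee_fin.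
  have k1 : 0 <= C%:E * rsqrt_sing L (- 1 * x + w.1)%R.
    by rewrite mule_ge0 ?rsqrt_sing_ge0 ?lee_fin ?expR_ge0.
  rewrite ge0_integralZl//.
  rewrite integral_indic ?setIT//; last exact: measurable_itv.
  congr (_ * _); rewrite [LHS](lebesgue_measure_itv) /= lte_fin (_ : _ < _)%R.
    by rewrite -EFinB; congr EFin; ring.
  by move: st0; lra.
under eq_integral do rewrite inner.
have k2 : measurable_fun setT (fun x : measurableTypeR R => C%:E * rsqrt_sing L (- 1 * x + w.1)%R).
  exact: measurable_funeM.
have k3 (x : measurableTypeR R) : setT x -> 0 <= C%:E * rsqrt_sing L (- 1 * x + w.1)%R.
  by move=> _; rewrite mule_ge0 ?rsqrt_sing_ge0 ?lee_fin ?expR_ge0.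
have k4 : 0 <= (2 * Num.sqrt T)%:E by rewrite lee_fin mulr_ge0// ltW.
rewrite ge0_integralZr//.
have k5 (x : measurableTypeR R) : setT x -> 0 <= rsqrt_sing L (- 1 * x + w.1)%R.
  by move=> _; exact: rsqrt_sing_ge0.
have k6 : 0 <= C%:E by rewrite lee_fin expR_ge0.
rewrite ge0_integralZl//.
have := @ge0_integral_affine _ (-1) w.1 (rsqrt_sing L).
rewrite oppr_eq0 oner_neq0 normrN1 mul1e => ->//; last 2 first.
- exact: measurable_rsqrt_sing.
- exact: rsqrt_sing_ge0.
by rewrite SE -!EFinM lee_fin mulrC.
Qed.

(* [heatr g d z] is bounded by a sum of Gaussian averages of [heat_drop]. Those of
   the part far from [z0] are bounded; Jensen's inequality moves the exponential
   inside the average of the near part, where the sum of the Gaussians is bounded by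
   a small multiple of the logarithm of the distance. *)
Lemma exp_heat_fixed_scale :
  \int[mu2]_(z in Q) (expR (c * heatr g (2 * d) z))%:E <=
  (expR (c * heat_bound) * (4 * T + 2 * Num.sqrt T * (C * S)))%:E.
Proof.
have mQ : measurable Q by exact: measurable_square.
have mGf : measurable_fun setT (fun x : R2 R * R2 R => (E x.1 x.2 * wgt x.2)%:E).
  apply/measurable_EFinP; apply: measurable_funM; first exact: mE.
  exact: (measurableT_comp mwgt).
pose J z := \int[mu2]_w (E z w * wgt w)%:E.
have mJ : measurable_fun setT J.
  by apply: (measurable_fun_fubini_tonelli_F _ mGf) => x; rewrite lee_fin mulr_ge0 ?expR_ge0.
have J0 z : 0 <= J z by apply: integral_ge0 => w _; rewrite lee_fin mulr_ge0 ?expR_ge0.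
have d20 : (0 < 2 * d)%R by rewrite mulr_gt0.
apply: (@le_trans _ _ (\int[mu2]_(z in Q) ((expR (c * heat_bound))%:E * (1 + m^-1%:E * J z)))).
  apply: ge0_le_integral => //.
  - apply/measurable_EFinP; apply: measurable_funTS; apply: measurableT_comp => //.
    by apply: measurable_funM => //; exact: measurable_heatr.
  - apply: measurable_funTS; apply: measurable_funeM; apply: emeasurable_funD => //.
    exact: measurable_funeM.
  move=> z Qz; have [I [IE hI]] := near_integral Qz.
  apply: (@le_trans _ _ ((expR (c * heat_bound))%:E * (expR (c * I))%:E)).
    by rewrite -EFinM -expRD lee_fin ler_expR -mulrDr addrC ler_wpM2l// ltW.
  rewrite lee_wpmul2l ?lee_fin ?expR_ge0//.
  (* The factor d = T / k is moved from the weight to the kernel, so that the mass of the weight is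
     bounded by [m] whatever the value of [k]. *)
  apply: (@expR_integral_le _ _ R mu2 (fun w => c * (T / k%:R) * K z w)%R wgt m (c * I)%R) => //.
  - by apply: measurable_funM => //; exact: mK.
  - by move=> w; exact: mulr_ge0 (mulr_ge0 (ltW c0) (ltW d0)) (K0 _ _).
  - exact: near_mass.
  rewrite EFinM -IE -ge0_integralZl_EFin//; last 3 first.
  - by move=> w _; rewrite lee_fin !mulr_ge0.
  - exact/measurable_EFinP.
  - exact: ltW.
  apply: eq_integral => w _; rewrite -EFinM /wgt; congr EFin; field.
  by rewrite ?(gt_eqF T0) ?(gt_eqF kR0).
rewrite ge0_integralZl_EFin ?expR_ge0//; last 2 first.
- by move=> z _; rewrite adde_ge0// mule_ge0// lee_fin invr_ge0 ltW.
- apply: measurable_funTS; apply: emeasurable_funD => //; exact: measurable_funeM.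
rewrite EFinM lee_wpmul2l ?lee_fin ?expR_ge0//.
rewrite ge0_integralD//; last 2 first.
- by move=> z _; rewrite mule_ge0// lee_fin invr_ge0 ltW.
- by apply: measurable_funTS; exact: measurable_funeM.
rewrite EFinD; apply: leeD.
  rewrite integral_cst// mul1e.
  have := lebesgue2_square z0 (sqrtr_ge0 T); rewrite sqr_sqrtr ?(ltW T0)// => h.
  by rewrite -h.
rewrite ge0_integralZl_EFin//; last 2 first.
- exact: measurable_funTS.
- by rewrite invr_ge0 ltW.
(* After an exchange of the integrals the integral over z is bounded uniformly for w in [near]; what
   remains is the mass of [wgt], at most [m], which cancels the factor 1 / m from Jensen's
   inequality. *)
rewrite -(@lee_pmul2l _ m%:E)// muleA -EFinM mulfV ?gt_eqF// mul1e.
pose H := fun x : R2 R * R2 R => (\1_Q x.1 * E x.1 x.2 * wgt x.2)%:E.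
have mH : measurable_fun setT H.
  apply/measurable_EFinP; apply: measurable_funM; last exact: (measurableT_comp mwgt).
  apply: measurable_funM; last exact: mE.
  have mI : measurable_fun setT (\1_Q : R2 R -> R) by exact: measurable_indic.
  exact: (measurableT_comp mI).
have H0 x : 0 <= H x.
  rewrite /H lee_fin; apply: mulr_ge0 => //; apply: mulr_ge0 => //; exact: expR_ge0.
have -> : \int[mu2]_(z in Q) J z = \int[mu2]_z \int[mu2]_w H (z, w).
  rewrite integral_mkcond; apply: eq_integral => z _; rewrite patchE /H/= indicE.
  case: ifPn => zQ; first by apply: eq_integral => w _; rewrite mul1r.
  by rewrite integral0_eq// => w _; rewrite !mul0r.
rewrite (fubini_tonelli H mH H0).
have B0 : (0 <= 2 * Num.sqrt T * (C * S))%R by rewrite !mulr_ge0 ?sqrtr_ge0 ?expR_ge0.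
apply: (@le_trans _ _ (\int[mu2]_w ((wgt w)%:E * (2 * Num.sqrt T * (C * S))%:E))).
  apply: ge0_le_integral => //.
  - by move=> w _; apply: integral_ge0.
  - exact: (measurable_fun_fubini_tonelli_G _ mH).
  - by apply: emeasurable_funM => //; exact/measurable_EFinP.
  move=> w _; rewrite /H/=.
  have -> : \int[mu2]_z (\1_Q z * E z w * wgt w)%:E = (wgt w)%:E * \int[mu2]_z (\1_Q z * E z w)%:E.
    rewrite -ge0_integralZl_EFin//.
    - by apply: eq_integral => z _; rewrite -EFinM mulrC.
    - by move=> z _; rewrite lee_fin mulr_ge0 ?expR_ge0.
    - apply/measurable_EFinP; apply: measurable_funM; last exact: mE.
      by apply: measurable_indic.
  have [wn|wn] := boolP (w \in near).
    by rewrite lee_wpmul2l ?lee_fin// kernel_integral//; exact: set_mem wn.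
  by rewrite /wgt indicE (negbTE wn) mulr0 !mul0e.
rewrite ge0_integralZr//; last 2 first.
- exact/measurable_EFinP.
- by move=> w _; rewrite lee_fin.
by rewrite lee_wpmul2r ?lee_fin// near_mass.
Qed.

End fixed_scale.

End exponential_integrability.

Definition near_lsc {R : realType} (g : R2 R -> \bar R) := forall z (A : R), (A%:E < g z)%E ->
  exists2 e : R, 0 < e & forall w, sqdist z w < e -> (A%:E < g w)%E.

Lemma lte_between {R : realType} (a : R) (x : \bar R) : (a%:E < x)%E ->
  exists2 b : R, a < b & (b%:E < x)%E.
Proof.
case: x => [r| |]//.
- by rewrite lte_fin => ar; exists ((a + r) / 2); rewrite ?lte_fin midf_lt.
- by move=> _; exists (a + 1); rewrite ?ltrDl// ltry.
Qed.

Lemma ler_increment {R : realType} (a b e q : R) : a < b + e - q -> a - b + q <= e.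
Proof. lra. Qed.

(** * The limit d -> 0, and logarithmic poles from large mass *)

Section local_integrability.
Context {R : realType}.
Local Notation mu2 := (@lebesgue2 R).
Local Open Scope ereal_scope.
Variables (g : R2 R -> \bar R).
Hypotheses (mg : measurable_fun setT g) (g0 : forall z, 0 <= g z)
  (sg : circle_superharmonic g) (gfin : exists a, g a < +oo).

(** Pointwise A <= g w + (A / e) |z - w|^2: the first term suffices inside the disc and the second
    one outside. Averaging costs the second moment, at most 4 t. *)
Lemma heatr_lower (z : R2 R) (A t e : R) : (0 <= A)%R -> (0 < t)%R -> (0 < e)%R ->
  (forall w, (sqdist z w < e)%R -> A%:E < g w) ->
  (A <= heatr g t z + A / e * (4 * t))%R.
Proof.
move=> A0 t0 e0 Ag; have Ae0 : (0 <= A / e)%R by rewrite divr_ge0// ltW.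
rewrite -lee_fin EFinD -heatrE//.
apply: (@le_trans _ _ (heat t g z + (A / e)%:E * \int[mu2]_w (gauss t z w * sqdist z w)%:E)); last first.
  apply: leeD => //; rewrite [(A / e * (4 * t))%:E]EFinM.
  by rewrite lee_wpmul2l ?lee_fin ?divr_ge0 ?(ltW e0)//; exact: integral_gauss_sqdist.
have mgs : measurable_fun setT (fun w => (gauss t z w * sqdist z w)%:E).
  apply/measurable_EFinP; apply: measurable_funM; first exact: measurable_gauss.
  exact: measurable_sqdist.
rewrite -ge0_integralZl_EFin ?divr_ge0 ?(ltW e0)//; last first.
  by move=> w _; rewrite lee_fin mulr_ge0 ?gauss_ge0 ?sqdist_ge0.
rewrite /heat -ge0_integralD//; last 4 first.
- by move=> w _; exact: gauss_mul_ge0.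
- exact: measurable_gaussM.
- by move=> w _; rewrite mule_ge0 ?lee_fin// mulr_ge0 ?gauss_ge0 ?sqdist_ge0.
- exact: measurable_funeM.
rewrite -(heat_cst z t0 A0) /heat; apply: ge0_le_integral => //.
- by move=> w _; rewrite mule_ge0 ?lee_fin ?gauss_ge0.
- exact: measurable_gaussM.
- by apply: emeasurable_funD; [exact: measurable_gaussM|exact: measurable_funeM].
move=> w _; rewrite /=; have [we|we] := ltP (sqdist z w) e.
  apply: (@le_trans _ _ ((gauss t z w)%:E * g w)).
    by rewrite lee_wpmul2l ?lee_fin ?gauss_ge0// ltW// Ag.
  by rewrite leeDl// mule_ge0 ?lee_fin// mulr_ge0 ?gauss_ge0 ?sqdist_ge0.
apply: (@le_trans _ _ ((A / e)%:E * (gauss t z w * sqdist z w)%:E)); last first.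
  by rewrite leeDr// gauss_mul_ge0.
have h : (A <= A / e * sqdist z w)%R.
  by rewrite -mulrA ler_peMr// mulrC ler_pdivlMr// mul1r.
change ((gauss t z w * A)%:E <= (A / e * (gauss t z w * sqdist z w))%:E).
rewrite lee_fin (_ : A / e * (gauss t z w * sqdist z w) = gauss t z w * (A / e * sqdist z w))%R; last by ring.
by rewrite ler_wpM2l// gauss_ge0.
Qed.

Hypothesis lscg : near_lsc g.

(** By lower semicontinuity [g] stays above any smaller value near [z], and so do its averages at
    small times, up to an error tending to 0. The inequality holds at every point, including those
    with g z = +oo, and makes Fatou's lemma applicable. *)
Lemma heatr_liminf (z : R2 R) (c T : R) : (0 < T)%R -> (0 < c)%R ->
  expeR (c%:E * g z) <= limn_einf (fun k => (expR (c * heatr g (2 * (T / k.+1%:R)) z))%:E).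
Proof.
move=> T0 c0; set u := fun k : nat => (_ : \bar R).
have tk k : (0 < 2 * (T / k.+1%:R))%R by rewrite mulr_gt0// divr_gt0.
have u0 k : 0 <= u k by rewrite /u lee_fin expR_ge0.
have step (B : R) : B%:E < g z -> (expR (c * B))%:E <= limn_einf u.
  move=> Bg; have [B0|B0] := ltP B 0%R.
    rewrite limn_einf_lim; apply: lime_ge; first exact: is_cvg_einfs.
    apply: nearW => n; apply: le_ereal_inf_tmp => _ [k /= _ <-].
    rewrite /u lee_fin ler_expR ler_wpM2l ?(ltW c0)// (le_trans (ltW B0))//.
    exact: heatr_ge0.
  have [A BA Ag] := lte_between Bg.
  have [e e0 He] := lscg Ag.
  have A0 : (0 < A)%R := le_lt_trans B0 BA.
  rewrite limn_einf_lim; apply: lime_ge; first exact: is_cvg_einfs.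
  have [N hN] : exists N, (A / e * (4 * (2 * T)) / (A - B) < N%:R)%R.
    by eexists; apply: truncnS_gt; rewrite num_real.
  near=> n; apply: le_ereal_inf_tmp => _ [k /= nk <-].
  rewrite /u lee_fin ler_expR ler_wpM2l ?(ltW c0)//.
  have := heatr_lower (ltW A0) (tk k) e0 He.
  have : (A / e * (4 * (2 * (T / k.+1%:R))) <= A - B)%R.
    rewrite (_ : _ * _ = A / e * (4 * (2 * T)) / k.+1%:R)%R; last by ring.
    rewrite ler_pdivrMr// -ler_pdivrMl ?subr_gt0// mulrC (le_trans (ltW hN))// ler_nat.
    by apply: leqW; apply: leq_trans nk; near: n; exact: nbhs_infty_ge.
  by move: (A / e * _)%R (heatr _ _ _) => p q; lra.
have l0 : 0 <= limn_einf u.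
  rewrite limn_einf_lim; apply: lime_ge; first exact: is_cvg_einfs.
  by apply: nearW => n; apply: le_ereal_inf_tmp => _ [k /= _ <-].
case lE : (limn_einf u) l0 step => [r| |]// l0 step; last by rewrite leey.
have gz : g z <= (ln r / c)%:E.
  rewrite leNgt; apply/negP => /lte_between[B rB Bg].
  have := step B Bg; rewrite lee_fin => h.
  have r0 : (0 < r)%R := lt_le_trans (expR_gt0 _) h.
  move: h; rewrite -[leRHS]lnK ?posrE// ler_expR => h.
  by move: rB; rewrite ltr_pdivrMr// mulrC ltNge h.
have r0 : (0 < r)%R.
  have : (-1)%:E < g z by rewrite (lt_le_trans _ (g0 z))// lte_fin.
  by move=> /step; rewrite lee_fin; exact: lt_le_trans (expR_gt0 _).
move: gz (g0 z); case: (g z) => [s| |]//; rewrite !lee_fin => gz s0.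
by rewrite -[leRHS]lnK ?posrE// ler_expR mulrC -ler_pdivlMr.
Unshelve. all: by end_near.
Qed.

(** The majorant is the lower limit of exp (c P_d g) as d -> 0: the bound of [exp_heat_fixed_scale]
    does not depend on [k], and Fatou's lemma preserves it. The hypothesis is [hm] for m = pi / (2
    c), the largest mass that [cm] allows. *)
Lemma local_exp_integrable (z0 : R2 R) (T c : R) : (0 < T)%R -> (0 < c)%R ->
  (4 * pi * expR 4 * (heatr g T z0 - heatr g (4 * T) z0 + 12 * T) <= pi / 2 / c)%R ->
  exists phi : R2 R -> \bar R,
    [/\ measurable_fun setT phi, forall z, 0 <= phi z,
      forall z, expeR (c%:E * g z) <= phi z &
      \int[mu2]_(z in square z0 (Num.sqrt T)) phi z < +oo].
Proof.
move=> T0 c0 hT; pose u k z := (expR (c * heatr g (2 * (T / k.+1%:R)) z))%:E.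
have pi0 := @pi_gt0 R.
have mu_ k : measurable_fun setT (u k).
  apply/measurable_EFinP; apply: measurableT_comp => //; apply: measurable_funM => //.
  by apply: measurable_heatr => //; rewrite mulr_gt0// divr_gt0.
have u0 k z : 0 <= u k z by rewrite lee_fin expR_ge0.
exists (fun z => limn_einf (u^~ z)); split.
- under eq_fun do rewrite limn_einf_lim.
  apply: (emeasurable_fun_cvg (fun n x => einfs (u^~ x) n)) => //.
  + exact: measurable_fun_einfs.
  + by move=> x _; exact: is_cvg_einfs.
- move=> z; rewrite limn_einf_lim; apply: lime_ge; first exact: is_cvg_einfs.
  by apply: nearW => n; apply: le_ereal_inf_tmp => _ [k /= _ <-].
- by move=> z; exact: heatr_liminf.
have mQ := measurable_square z0 (Num.sqrt T).
apply: le_lt_trans (fatou mu2 mQ (fun k => measurable_funTS (mu_ k)) (fun k z _ => u0 k z)) _.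
have cm : (c * (pi / 2 / c) <= pi / 2)%R by rewrite mulrC divfK// gt_eqF.
have m0 : (0 < pi / 2 / c)%R by rewrite !divr_gt0.
pose B := (expR (c * heat_bound g z0 T) * (4 * T + 2 * Num.sqrt T * (expR (4^-1 * ln (2 * T + (4 * Num.sqrt T) ^+ 2)) * fine (\int[lebesgue_measure]_x rsqrt_sing (4 * Num.sqrt T) x)%E)))%R.
apply: (@le_lt_trans _ _ B%:E); last by rewrite ltry.
rewrite limn_einf_lim; apply: lime_le; first exact: is_cvg_einfs.
apply: nearW => n; apply: (@le_trans _ _ (\int[mu2]_(z in square z0 (Num.sqrt T)) u n z)).
  by apply: ereal_inf_lbound; exists n => /=.
exact: (exp_heat_fixed_scale mg g0 sg gfin T0 m0 c0 (ltn0Sn n) cm hT).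
Qed.

(* The increments of [heatr] over the scales [4^-n] measure the Riesz mass near
   [z0]: if none of them is small then [heatr] grows linearly in [n]. *)
Lemma small_increments (z0 : R2 R) (eta : R) : (0 < eta)%R ->
  (exists2 T : R, (0 < T)%R & (heatr g T z0 - heatr g (4 * T) z0 + 12 * T <= eta)%R) \/
  (forall n : nat, eta * n%:R - 4 <= heatr g (4^-1 ^+ n) z0)%R.
Proof.
move=> eta0; have [h|h] := pselect (exists2 T : R, (0 < T)%R &
  (heatr g T z0 - heatr g (4 * T) z0 + 12 * T <= eta)%R); [by left|right].
have t0 n : (0 < 4^-1 ^+ n :> R)%R by rewrite exprn_gt0.
have {}h n : (heatr g (4^-1 ^+ n) z0 + eta - 3 * 4^-1 ^+ n <= heatr g (4^-1 ^+ n.+1) z0)%R.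
  rewrite leNgt; apply/negP => hn; apply: h; exists (4^-1 ^+ n.+1)%R => //.
  rewrite exprS mulrA mulfV// mul1r -exprS.
  have e12 : (12 * 4^-1 ^+ n.+1 = 3 * 4^-1 ^+ n :> R)%R by rewrite exprS; field.
  by rewrite e12; exact: ler_increment hn.
(* The additional term 4 * 4^-n absorbs the error 3 * 4^-n of each step, because it decreases by
   exactly that amount. *)
move=> n; have : (eta * n%:R - 4 + 4 * 4^-1 ^+ n <= heatr g (4^-1 ^+ n) z0)%R.
  elim: n => [|n IH]; first by rewrite mulr0 expr0 add0r mulr1 addNr heatr_ge0.
  apply: le_trans (h n); rewrite exprS mulrA mulfV// mul1r -natr1 mulrDr mulr1.
  by move: IH; lra.
by have := t0 n; lra.
Qed.

(** For a given [w] take the largest n with |w - z0|^2 <= 4^-n. At time 4^-n the centre can be moved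
    from [z0] to [w] at the cost of a factor 2 exp 1, and [heat_le] passes from the average to g w.
    Linear growth in n is logarithmic growth in the distance. *)
Lemma log_pole_lower_bound (z0 : R2 R) (eta : R) : (0 < eta)%R ->
  (forall n : nat, eta * n%:R - 4 <= heatr g (4^-1 ^+ n) z0)%R ->
  exists kappa : R, (0 < kappa)%R /\ exists C : R, forall w, (0 < sqdist z0 w <= 1)%R ->
    (- kappa * ln (sqdist z0 w) - C)%:E <= g w.
Proof.
move=> eta0 h; have ln4 : (0 < ln 4 :> R)%R by rewrite ln_gt0// ltr1n.
have e20 : (0 < 2 * expR 1 :> R)%R by rewrite mulr_gt0 ?expR_gt0.
exists (eta / (2 * expR 1) / ln 4)%R; split; first by rewrite !divr_gt0.
exists ((eta + 4) / (2 * expR 1) + 8)%R => w /andP[w0 w1].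
set y := (- ln (sqdist z0 w))%R.
have y0 : (0 <= y)%R by rewrite oppr_ge0 ln_le0.
have y4 : (0 <= y / ln 4)%R by rewrite divr_ge0// ltW.
have /andP[n1 n2] := truncn_itv y4; set n := Num.truncn _ in n1 n2.
set s : R := (4^-1 ^+ n)%R.
have s0 : (0 < s)%R by rewrite exprn_gt0.
have s1 : (s <= 1)%R by rewrite exprn_ile1// invf_le1// ler1n.
have sw : (sqdist z0 w <= s)%R.
  have lns : (ln s = - (n%:R * ln 4))%R by rewrite /s lnXn// lnV ?posrE// mulNrn mulr_natl.
  by rewrite -ler_ln ?posrE// lns; move: n1; rewrite ler_pdivlMr// /y lerNr.
have := heat_shift mg g0 z0 w s0.
have s20 : (0 < 2 * s)%R by rewrite mulr_gt0.
rewrite (heatrE mg g0 sg gfin z0 s0) => h1.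
have := heat_le mg g0 sg w s20 => h2.
have h3 : (heatr g s z0)%:E <= (2 * expR 1)%:E * (g w + (8 * s)%:E).
  apply: (le_trans h1); apply: lee_pmul; rewrite ?lee_fin ?heat_ge0//.
    rewrite ler_wpM2l// ler_expR ler_pdivrMr// mul1r.
    by move: sw s0; lra.
  by rewrite (_ : 8 * s = 4 * (2 * s))%R//; ring.
have := h n; rewrite -/s => h4.
have : ((eta * n%:R - 4) / (2 * expR 1))%:E <= g w + (8 * s)%:E.
  rewrite -(@lee_pmul2l _ (2 * expR 1)%:E) ?lte_fin//; apply: le_trans h3.
  by rewrite -EFinM mulrC divfK ?gt_eqF// lee_fin.
move: (g0 w); case: (g w) => [r _| _ _|]//; last by rewrite leey.
rewrite -EFinD !lee_fin ler_pdivrMr// => h5.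
have n3 : (y / ln 4 - 1 <= n%:R)%R by move: n2; rewrite -natr1; lra.
have h6 : (eta * (y / ln 4 - 1) / (2 * expR 1) <= eta * n%:R / (2 * expR 1))%R.
  by rewrite ler_pM2r ?invr_gt0// ler_pM2l.
rewrite (_ : - (eta / (2 * expR 1) / ln 4) * ln (sqdist z0 w) = eta * (y / ln 4) / (2 * expR 1))%R; last first.
  by rewrite /y; ring.
have h7 : ((eta * n%:R - 4) / (2 * expR 1) <= r + 8 * s)%R by rewrite ler_pdivrMr.
by move: h6 h7 s1; move: ((2 * expR 1)^-1)%R (y / ln 4)%R (n%:R : R) => q y' n'; lra.
Qed.

End local_integrability.

(** * Circle means and the maximum principle *)

Section circle.
Context {R : realType}.
Local Notation mu := (@lebesgue_measure R).
Implicit Types (a b z : R[i]) (r : R).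

Definition circle_pt a r t : R[i] := a + r%:C * (cos t +i* sin t).

Lemma circle_ptE a r t : circle_pt a r t = (complex.Re a + r * cos t) +i* (complex.Im a + r * sin t).
Proof. by rewrite /circle_pt; case: a => a1 a2; simpc. Qed.

Lemma normc_cossin t : Normc.normc (cos t +i* sin t : R[i]) = 1.
Proof. by rewrite normcE/= cos2Dsin2 sqrtr1. Qed.

Lemma normc_realC r : Normc.normc (r%:C : R[i]) = `|r|.
Proof. by rewrite normcE/= expr0n/= addr0 sqrtr_sqr. Qed.

Lemma normc_circle_pt a r t : 0 <= r -> Normc.normc (circle_pt a r t - a) = r.
Proof.
move=> r0; rewrite /circle_pt addrAC subrr add0r Normc.normcM normc_cossin mulr1.
by rewrite normc_realC ger0_norm.
Qed.

Local Open Scope ereal_scope.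

(** By periodicity a shift of the angle does not change the integral, so four times the integral is
    that of the sum over the quarter turns. *)
Lemma ge0_circle_integral_quarter (F : R -> \bar R) (c : R) :
  measurable_fun setT F -> (forall t, 0 <= F t) -> (forall t, F (t + 2 * pi)%R = F t) ->
  (forall t, F t + F (t + pi / 2)%R + F (t + pi)%R + F (t + (pi + pi / 2))%R <= (4 * c)%:E) ->
  \int[mu]_(t in `[0%R, (2 * pi)%R]) F t <= (2 * pi * c)%:E.
Proof.
move=> mF F0 pF Fc; have pi0 := @pi_gt0 R.
have pi20 : (0 < 2 * pi :> R)%R by rewrite mulr_gt0.
have mFs (s : R) : measurable_fun (`[0%R, (2 * pi)%R] : set R) (fun x : measurableTypeR R => F (x + s)%R).
  by apply: measurable_funTS; apply: (measurableT_comp mF); exact: measurable_funD.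
set S := \int[mu]_(t in _) F t.
have shift (s : R) : (0 <= s <= 2 * pi)%R -> \int[mu]_(t in `[0%R, (2 * pi)%R]) F (t + s)%R = S.
  by move=> s02; apply: ge0_integral_periodic_shift.
have : S + S + S + S <= (4 * (2 * pi * c))%:E.
  rewrite -{2}(shift (pi / 2)%R); last by apply/andP; split; lra.
  rewrite -{2}(shift pi); last by apply/andP; split; lra.
  rewrite -{2}(shift (pi + pi / 2)%R); last by apply/andP; split; lra.
  have mF0 : measurable_fun (`[0%R, (2 * pi)%R] : set R) F by exact: measurable_funTS.
  have mF1 := emeasurable_funD mF0 (mFs (pi / 2)%R).
  have mF2 := emeasurable_funD mF1 (mFs pi).
  have mF3 := emeasurable_funD mF2 (mFs (pi + pi / 2)%R).
  rewrite /S -!ge0_integralD//; try by move=> t _; rewrite !adde_ge0.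
  all: try exact: mFs.
  apply: (@le_trans _ _ (\int[mu]_(t in `[0%R, (2 * pi)%R]) (4 * c)%:E)).
    apply: ge0_le_integral => //.
    by move=> t _; rewrite !adde_ge0.
  rewrite integral_cst//= lebesgue_measure_itv/= lte_fin pi20 sube0 -EFinM lee_fin; lra.
have S0 : 0 <= S by apply: integral_ge0.
case: S S0 {shift} => [r| |]// _.
rewrite -!EFinD !lee_fin; lra.
Qed.

(* Averaging over quarter turns kills the terms of order 1, 2 and 3 in the Taylor expansion. *)
Lemma circle_integral_quarter (w : R -> R) (c B : R) :
  measurable_fun setT w -> (forall t, `|w t| <= B)%R -> (forall t, w (t + 2 * pi) = w t)%R ->
  (forall t, w t + w (t + pi / 2) + w (t + pi) + w (t + (pi + pi / 2)) <= 4 * c)%R ->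
  mu.-integrable `[0%R, (2 * pi)%R] (EFin \o w) /\
  \int[mu]_(t in `[0%R, (2 * pi)%R]) (w t)%:E <= (2 * pi * c)%:E.
Proof.
move=> mw wB pw wc; have pi0 := @pi_gt0 R.
have pi20 : (0 < 2 * pi :> R)%R by rewrite mulr_gt0.
have B0 : (0 <= B)%R := le_trans (normr_ge0 _) (wB 0%R).
have mitv : mu `[0%R, (2 * pi)%R] = (2 * pi)%:E.
  by rewrite lebesgue_measure_itv/= lte_fin pi20 sube0.
have bint (v : R -> R) : measurable_fun setT v -> (forall t, `|v t| <= 2 * B)%R ->
    mu.-integrable `[0%R, (2 * pi)%R] (EFin \o v).
  move=> mv vB; apply: measurable_bounded_integrable => //.
  - by apply: (@le_lt_trans _ _ (2 * pi)%:E); rewrite ?ltry// -mitv.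
  - exact: measurable_funTS.
  - exists (2 * B)%R; split; first exact: num_real.
    by move=> x Bx t _ /=; exact: le_trans (vB t) (ltW Bx).
have iw : mu.-integrable `[0%R, (2 * pi)%R] (EFin \o w).
  by apply: bint => // t; apply: (le_trans (wB t)); lra.
split => //.
have iB : mu.-integrable `[0%R, (2 * pi)%R] (EFin \o (fun=> B)).
  by apply: bint => // t; rewrite ger0_norm//; lra.
have := @ge0_circle_integral_quarter (fun t => (w t + B)%:E) (c + B)%R.
have -> : \int[mu]_(t in `[0%R, (2 * pi)%R]) (w t + B)%:E =
    \int[mu]_(t in `[0%R, (2 * pi)%R]) (w t)%:E + (B * (2 * pi))%:E.
  have mI : measurable (`[0%R, (2 * pi)%R]%classic : set (measurableTypeR R)) by [].
  transitivity (\int[mu]_(t in `[0%R, (2 * pi)%R]) (w t)%:E + \int[mu]_(t in `[0%R, (2 * pi)%R]) B%:E).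
    by rewrite -(integralD mI iw iB).
  by congr (_ + _); rewrite integral_cst// EFinM; congr (_ * _); exact: mitv.
move=> H; have {H} : \int[mu]_(t in `[0%R, (2 * pi)%R]) (w t)%:E + (B * (2 * pi))%:E <= (2 * pi * (c + B))%:E.
  apply: H.
  - by apply/measurable_EFinP; exact: measurable_funD.
  - by move=> t; rewrite lee_fin; have := wB t; rewrite ler_norml => /andP[]; lra.
  - by move=> t; rewrite pw.
  - by move=> t; rewrite -!EFinD lee_fin; have := wc t; lra.
have : (\int[mu]_(t in `[0%R, (2 * pi)%R]) (w t)%:E) \is a fin_num by apply: integrable_fin_num.
move=> /fineK <-; rewrite -EFinD !lee_fin; lra.
Qed.

End circle.

Section subharmonic_circle.
Context {R : realType}.
Local Notation mu := (@lebesgue_measure R).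
Variable u : C1 R -> \bar R.
Hypothesis subh : subharmonic u.
Local Open Scope ereal_scope.

Lemma subharmonic_lty z : u z < +oo. Proof. by case: subh. Qed.

Lemma measurable_subharmonic : measurable_fun setT (u \o of_R2).
Proof.
case: subh => _ usc _.
have := lower_semicontinuous_measurable_C1 usc.
move=> /(measurableT_comp (@oppe_measurable R setT)); apply: eq_measurable_fun => z _ /=.
by rewrite oppeK.
Qed.

Lemma measurable_circle_pt (b : R[i]) (r : R) :
  measurable_fun setT (fun t : measurableTypeR R => (complex.Re b + r * cos t, complex.Im b + r * sin t)%R : R2 R).
Proof.
by apply: measurable_pair2; apply: measurable_funD => //; apply: measurable_funM => //;
  [exact: measurable_cos|exact: measurable_sin].
Qed.

Lemma measurable_subharmonic_circle b r :
  measurable_fun setT (fun t : measurableTypeR R => u (circle_pt b r t)).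
Proof.
have := measurableT_comp measurable_subharmonic (measurable_circle_pt b r).
by apply: eq_measurable_fun => t _ /=; rewrite circle_ptE.
Qed.

(** The submean inequality subtracted from the bound on the mean of [w]. If u b = -oo the right-hand
    side is infinite; otherwise the submean inequality itself makes [u] integrable on the circle,
    which justifies the subtraction. *)
Lemma subharmonic_circle_le (b : R[i]) (r : R) (w : R -> R) (c B : R) : (0 < r)%R ->
  measurable_fun setT w -> (forall t, `|w t| <= B)%R -> (forall t, w (t + 2 * pi) = w t)%R ->
  (forall t, w t + w (t + pi / 2) + w (t + pi) + w (t + (pi + pi / 2)) <= 4 * c)%R ->
  (forall t, u (circle_pt b r t) <= (w t)%:E) ->
  \int[mu]_(t in `[0%R, (2 * pi)%R]) ((w t)%:E - u (circle_pt b r t)) <= (2 * pi)%:E * (c%:E - u b).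
Proof.
move=> r0 mw wB pw wc uw; have pi0 := @pi_gt0 R.
have pi20 : (0 < 2 * pi :> R)%R by rewrite mulr_gt0.
have [iw Iw] := circle_integral_quarter mw wB pw wc.
have [_ _ /(_ b r r0)] := subh.
rewrite /circle_mean -/(circle_pt _ _ _).
set I := \int[_]_(t in _) _; set U := fun t => u (circle_pt b r t) => ub.
have IE : I = \int[mu]_(t in `[0%R, (2 * pi)%R]) U t by [].
have [uNy|uNy] := eqVneq (u b) -oo.
  by rewrite uNy /= gt0_muley ?leey// lte_fin.
have ufin : u b \is a fin_num by rewrite fin_numElt ltNye uNy subharmonic_lty.
have mU : measurable_fun (`[0%R, (2 * pi)%R] : set R) U.
  by apply: measurable_funTS; exact: measurable_subharmonic_circle.
have INy : -oo < I.
  rewrite ltNye; apply: contra uNy => /eqP INy; move: ub; rewrite INy.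
  by rewrite gt0_muleNy ?lte_fin ?invr_gt0// leeNy_eq.
have [/integrableP[_ iwfin]] : mu.-integrable `[0%R, (2 * pi)%R] (EFin \o w) /\ True by [].
move=> _.
have posfin : \int[mu]_(t in `[0%R, (2 * pi)%R]) U^\+ t < +oo.
  apply: le_lt_trans iwfin; apply: ge0_le_integral => //.
  - exact: measurable_funepos.
  - by apply: measurableT_comp => //; apply/measurable_EFinP; exact: measurable_funTS.
  move=> t _; rewrite funeposE ge_max; apply/andP; split => //.
  by apply: (le_trans (uw t)); rewrite /= lee_fin ler_norm.
have negfin : \int[mu]_(t in `[0%R, (2 * pi)%R]) U^\- t < +oo.
  rewrite ltey; apply/eqP => negy; move: INy; rewrite IE integralE negy.
  by rewrite addeC /= addNye.
have iU : mu.-integrable `[0%R, (2 * pi)%R] U.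
  apply/integrableP; split => //.
  under eq_integral do rewrite -/((abse \o U) _) fune_abse.
  rewrite ge0_integralD//.
  - by rewrite lte_add_pinfty.
  - exact: measurable_funepos.
  - exact: measurable_funeneg.
rewrite integralB// -IE muleBr//.
rewrite -EFinM; apply: leeB => //.
rewrite -(@lee_pmul2l _ ((2 * pi)^-1)%:E) ?lte_fin ?invr_gt0//.
by rewrite muleA -EFinM mulVf ?gt_eqF// mul1e.
Qed.

End subharmonic_circle.

Section usc_max.
Context {R : realType}.
Local Open Scope ereal_scope.

(** Without a maximum the sets of points of [K] where v >= v c, for c in [K], generate a proper
    filter. Some y in [K] satisfies v y > v p at a cluster point p, and semicontinuity separates p
    from the points where v >= v y. *)
Lemma compact_usc_max (T : ptopologicalType) (K : set T) (v : T -> \bar R) :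
  compact K -> K !=set0 ->
  (forall x, K x -> forall c : R, v x < c%:E -> exists2 V, nbhs x V & forall y, K y -> V y -> v y < c%:E) ->
  (forall x, K x -> v x < +oo) ->
  exists2 b, K b & forall x, K x -> v x <= v b.
Proof.
move=> cK [k0 Kk0] usc vy; apply: contrapT => nomax.
have above x : K x -> exists2 y, K y & v x < v y.
  move=> Kx; apply: contrapT => h; apply: nomax; exists x => // y Ky.
  by rewrite leNgt; apply/negP => xy; apply: h; exists y.
pose F := filter_from K (fun c => [set y | K y /\ v c <= v y]).
have FF : ProperFilter F.
  apply: filter_from_proper; last by move=> c Kc; exists c.
  apply: filter_from_filter; first by exists k0.
  move=> c d Kc Kd; have [cd|dc] := leP (v c) (v d).
    by exists d => // y [Ky dy]; do 2 split => //; exact: le_trans dy.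
  by exists c => // y [Ky cy]; do 2 split => //; apply: le_trans cy; exact: ltW.
have FK : F K by exists k0 => // y [].
have [p [Kp clp]] := cK F FF FK.
have [y Ky py] := above p Kp.
have [c pc cy] : exists2 c : R, v p < c%:E & c%:E <= v y.
  case vyE : (v y) (vy y Ky) => [r| |]// _; first by exists r => //; rewrite -vyE.
  by move: py; rewrite vyE ltNge leNye.
have [V nV hV] := usc p Kp c pc.
have FB : F [set z | K z /\ v y <= v z] by exists y.
have [z [[Kz yz] Vz]] := clp _ _ FB nV.
by have := hV z Kz Vz; rewrite ltNge (le_trans cy yz).
Qed.

End usc_max.

Section annulus.
Context {R : realType}.

Lemma continuous_normcB (z0 : R[i]) : continuous (fun z : C1 R => Normc.normc (z - z0 : R[i]) : R^o).
Proof.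
move=> z; apply/(@cvgrPdist_lt _ R^o _ _ (nbhs_filter z)) => e e0.
have : nbhs z [set w : C1 R | Normc.normc (w - z : R[i]) < e] by apply/nbhs_C1P; exists e.
apply: filterS => w wz; apply: le_lt_trans wz.
have tri (x y t : R[i]) : Normc.normc (x - t) <= Normc.normc (y - t) + Normc.normc (x - y).
  by rewrite (_ : x - t = (y - t) + (x - y)) ?le_normcD// [RHS]addrC addrA subrK.
rewrite ler_distl lerBlDr tri/=.
by rewrite -[Normc.normc (w - z)]normcN opprB tri.
Qed.

Lemma continuous_of_R2 : continuous (fun x : R * R => (x.1 +i* x.2) : C1 R).
Proof.
move=> x; apply/cvg_ballP => e e0.
have e_real : e = (complex.Re e)%:C by rewrite RRe_real// gtr0_real.
have re0 : 0 < complex.Re e by move: e0; rewrite e_real ltcR.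
have r20 : 0 < complex.Re e / 2 by rewrite divr_gt0.
have : nbhs x [set y : R * R | `|y.1 - x.1| < complex.Re e / 2 /\ `|y.2 - x.2| < complex.Re e / 2].
  exists ([set y | `|y - x.1| < complex.Re e / 2], [set y | `|y - x.2| < complex.Re e / 2]) => /=.
    by split; apply/nbhs_ballP; exists (complex.Re e / 2) => // y /=; rewrite /ball/= distrC.
  by move=> [y1 y2] [].
apply: filterS => y [y1 y2].
rewrite -ball_normE/= distrC normc_real_norm e_real ltcR.
exact: (@normc_of_R2B_lt R x y).
Qed.

Lemma compact_annulus (z0 : R[i]) (r1 r2 : R) :
  compact [set z : C1 R | r1 <= Normc.normc (z - z0 : R[i]) <= r2].
Proof.
pose box := `[(complex.Re z0 - r2)%R, (complex.Re z0 + r2)%R]%classic `*` `[(complex.Im z0 - r2)%R, (complex.Im z0 + r2)%R]%classic : set (R * R).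
have cbox : compact box by apply: compact_setX; exact: segment_compact.
have cim : compact ((fun x : R * R => (x.1 +i* x.2) : C1 R) @` box).
  by apply: continuous_compact => //; apply: continuous_subspaceT; exact: continuous_of_R2.
apply: subclosed_compact cim _.
  have -> : [set z : C1 R | r1 <= Normc.normc (z - z0 : R[i]) <= r2] =
     (fun z : C1 R => Normc.normc (z - z0 : R[i]) : R^o) @^-1` `[r1, r2]%classic.
    by apply/seteqP; split => z /=; rewrite in_itv.
  apply: preimage_closed; last exact: itv_closed.
  by move=> z _; exact: continuous_normcB.
move=> z /= /andP[_ zr]; exists (complex.Re z, complex.Im z); last by case: z {zr}.
have := le_trans (normc_ge_Re _) zr; have := le_trans (normc_ge_Im _) zr.
rewrite !raddfB/= => h1 h2; rewrite /box/=; split; rewrite /= in_itv/= -ler_distl//.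
Qed.

Lemma cosDpihalf3 (t : R) : cos (t + (pi + pi / 2)) = sin t.
Proof. by rewrite addrA cosDpihalf sinDpi opprK. Qed.

Lemma sinDpihalf3 (t : R) : sin (t + (pi + pi / 2)) = - cos t.
Proof. by rewrite addrA sinDpihalf cosDpi. Qed.

(* The product of [|d + x|^2] over the four quarter turns of [x] is [|d^4 - x^4|^2]. *)
Lemma quarter_product_bounds (d1 d2 c s r D : R) (N : R -> R -> R) : c ^+ 2 + s ^+ 2 = 1 ->
  D = d1 ^+ 2 + d2 ^+ 2 -> (forall x y, N x y = (d1 + r * x) ^+ 2 + (d2 + r * y) ^+ 2) ->
  (D ^+ 2 - r ^+ 4) ^+ 2 <= N c s * N (- s) c * N (- c) (- s) * N s (- c) <= (D ^+ 2 + r ^+ 4) ^+ 2.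
Proof.
move=> cs DE NE; set P := N c s * _ * _ * _.
(* In the frame turned by the angle of (c, s) the quarter turns only change the signs of 2 r p and 2
   r q, so the product is ((D + r^2)^2 - 4 r^2 p^2) ((D + r^2)^2 - 4 r^2 q^2). *)
pose p := d1 * c + d2 * s; pose q := - d1 * s + d2 * c.
have pq : p ^+ 2 + q ^+ 2 = D.
  by rewrite -[RHS]mulr1 -cs DE /p /q; ring.
have r2E : r ^+ 2 = r ^+ 2 * (c ^+ 2 + s ^+ 2) by rewrite cs mulr1.
have N0 : N c s = D + r ^+ 2 + 2 * r * p.
  by rewrite NE DE /p; move: r2E; lra.
have N1 : N (- s) c = D + r ^+ 2 + 2 * r * q.
  by rewrite NE DE /q; move: r2E; lra.
have N2 : N (- c) (- s) = D + r ^+ 2 - 2 * r * p.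
  by rewrite NE DE /p; move: r2E; lra.
have N3 : N s (- c) = D + r ^+ 2 - 2 * r * q.
  by rewrite NE DE /q; move: r2E; lra.
have PE : P = (D ^+ 2 - r ^+ 4) ^+ 2 + 16 * r ^+ 4 * (p * q) ^+ 2.
  rewrite /P N0 N1 N2 N3.
  rewrite (_ : _ * _ = (D + r ^+ 2) ^+ 4 - 4 * r ^+ 2 * (p ^+ 2 + q ^+ 2) * (D + r ^+ 2) ^+ 2 + 16 * r ^+ 4 * (p * q) ^+ 2); last by ring.
  by rewrite pq; ring.
have pq2 : 4 * (p * q) ^+ 2 <= D ^+ 2.
  rewrite -pq -subr_ge0 (_ : _ - _ = (p ^+ 2 - q ^+ 2) ^+ 2) ?sqr_ge0//; ring.
have r40 : 0 <= r ^+ 4 by rewrite exprn_even_ge0.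
rewrite PE; apply/andP; split.
  by rewrite lerDl mulr_ge0 ?sqr_ge0// mulr_ge0.
rewrite -subr_ge0 (_ : _ - _ = 4 * r ^+ 4 * (D ^+ 2 - 4 * (p * q) ^+ 2)); last by ring.
by rewrite mulr_ge0 ?subr_ge0// mulr_ge0.
Qed.

(** With x = r^4 / D^2 the difference lies between 2 ln (1 - x) and 2 ln (1 + x); the restriction x
    <= 1/2 serves for - ln (1 - x) <= 2 x. *)
Lemma ln_quarter_product (P D r : R) : 0 < D -> 0 <= r -> r ^+ 4 <= D ^+ 2 / 2 ->
  (D ^+ 2 - r ^+ 4) ^+ 2 <= P <= (D ^+ 2 + r ^+ 4) ^+ 2 ->
  `|ln P - 4 * ln D| <= 4 * (r ^+ 4 / D ^+ 2).
Proof.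
move=> D0 r0 rD /andP[P1 P2]; set x := r ^+ 4 / D ^+ 2.
have D20 : 0 < D ^+ 2 by rewrite exprn_gt0.
have x0 : 0 <= x by rewrite divr_ge0 ?exprn_ge0 ?(ltW D0).
have x2 : x <= 1 / 2 by rewrite ler_pdivrMr// mulrC mulrA mulr1.
have e1 : (D ^+ 2 - r ^+ 4) ^+ 2 = D ^+ 4 * (1 - x) ^+ 2.
  by rewrite /x; field; rewrite gt_eqF.
have e2 : (D ^+ 2 + r ^+ 4) ^+ 2 = D ^+ 4 * (1 + x) ^+ 2.
  by rewrite /x; field; rewrite gt_eqF.
have D40 : 0 < D ^+ 4 by rewrite exprn_gt0.
have x1 : 0 < 1 - x by lra.
have x3 : 0 < 1 + x by lra.
have P0 : 0 < P by rewrite (lt_le_trans _ P1)// e1 mulr_gt0// exprn_gt0.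
have lnD4 : ln (D ^+ 4) = 4 * ln D by rewrite lnXn// mulr_natl.
have u1 : ln P - 4 * ln D <= 2 * ln (1 + x).
  rewrite lerBlDr -lnD4 -[2 * _](_ : ln ((1 + x) ^+ 2) = _); last by rewrite lnXn// mulr_natl.
  by rewrite addrC -lnM ?posrE ?exprn_gt0// -e2 ler_ln ?posrE// (lt_le_trans P0).
have u2 : 2 * ln (1 - x) <= ln P - 4 * ln D.
  rewrite lerBrDr -lnD4 -[2 * _](_ : ln ((1 - x) ^+ 2) = _); last by rewrite lnXn// mulr_natl.
  rewrite addrC -lnM ?posrE ?exprn_gt0// -e1 ler_ln ?posrE// e1 mulr_gt0// exprn_gt0//.
have l1 : ln (1 + x) <= x by apply: le_ln1Dx; lra.
have l2 : - ln (1 - x) <= 2 * x.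
  rewrite -lnV ?posrE//.
  have := @le_ln1Dx R ((1 - x)^-1 - 1); rewrite [1 + (_ - 1)]addrC subrK => h.
  apply: (le_trans (h _)).
    by rewrite ltrBrDl subrr invr_gt0.
  rewrite -subr_ge0 (_ : _ - _ = x * (1 - 2 * x) / (1 - x)).
    by apply: divr_ge0; [apply: mulr_ge0|exact: ltW] => //; lra.
  by field; rewrite gt_eqF.
by rewrite ler_norml; apply/andP; split; lra.
Qed.

End annulus.

(** * Logarithmic majorants on annuli *)

Section maximum_principle.
Context {R : realType}.
Variable u : C1 R -> \bar R.
Hypothesis subh : subharmonic u.

(** The choice of the radius: the circle about the interior maximum must stay in the annulus, and
    the quartic error of the logarithm must be smaller than the quadratic gain. *)
Let annulus_log (d : R[i]) (r1 r2 : R) : 0 < r1 -> r1 < Normc.normc d < r2 ->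
  forall al be eps : R, 0 < eps ->
  exists2 r, 0 < r <= Num.min (Normc.normc d - r1) (r2 - Normc.normc d) &
    `|be| * (r ^+ 4 / Normc.normc d ^+ 4) < 2 * eps * r ^+ 2 /\ r ^+ 4 <= (Normc.normc d ^+ 2) ^+ 2 / 2.
Proof.
move=> r10 /andP[dr1 dr2] al be eps eps0.
set D := Normc.normc d in dr1 dr2 *.
have D0 : 0 < D := lt_trans r10 dr1.
have b0 : 0 < `|be| + 1 by rewrite ltr_wpDl.
pose r := Num.min (Num.min (D - r1) (r2 - D)) (Num.min (Num.min 1 (D ^+ 4 / 2)) (eps * D ^+ 4 / (`|be| + 1))).
have r0 : 0 < r by rewrite !lt_min !subr_gt0 dr1 dr2 ltr01 !divr_gt0 ?mulr_gt0 ?exprn_gt0.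
have [ra rb rc rd] : [/\ r <= Num.min (D - r1) (r2 - D), r <= 1, r <= D ^+ 4 / 2 &
    r <= eps * D ^+ 4 / (`|be| + 1)].
  by have rr := lexx r; rewrite {2}/r !le_min in rr; move: rr => /andP[/andP[? ?] /andP[/andP[? ?] ?]]; rewrite le_min; split => //; apply/andP.
exists r; first by rewrite r0.
have r21 : r ^+ 2 <= r by rewrite expr2 ler_piMr// ltW.
have r42 : r ^+ 4 <= r ^+ 2 * r.
  by rewrite -[4%N]/(2 + 2)%N exprD ler_wpM2l ?exprn_ge0// ltW.
split.
  have D40 : 0 < D ^+ 4 by rewrite exprn_gt0.
  rewrite mulrA ltr_pdivrMr//.
  have h1 : `|be| * r ^+ 4 <= `|be| * (r ^+ 2 * r) by rewrite ler_wpM2l.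
  have h2 : r * (`|be| + 1) <= eps * D ^+ 4 by rewrite -ler_pdivlMr.
  have h3 : r ^+ 2 * (r * (`|be| + 1)) <= r ^+ 2 * (eps * D ^+ 4) by rewrite ler_wpM2l ?exprn_ge0// ltW.
  have h4 : 0 < r ^+ 2 * (eps * D ^+ 4) by rewrite !mulr_gt0// exprn_gt0.
  have h5 : 0 <= r ^+ 2 * r by rewrite mulr_ge0 ?exprn_ge0 ?ltW.
  by move: h1 h2 h3 h4 h5; lra.
rewrite -exprM; apply: le_trans rc; apply: (le_trans r42); apply: le_trans r21.
by rewrite ler_piMr ?exprn_ge0 ?(ltW r0).
Qed.

(* At an interior maximum [b] of [u - w0], where [w0] is the harmonic majorant
   [al + be ln |z - z0|] minus a small multiple of [|z - z0|^2], the submean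
   inequality fails on a circle of radius [r]: averaging [ln |z - z0|] over quarter
   turns leaves an error of order [r^4], which the quadratic term dominates. *)
Lemma annulus_maximum (z0 : R[i]) (r1 r2 al be : R) : 0 < r1 -> r1 < r2 ->
  (forall z, Normc.normc (z - z0) = r1 \/ Normc.normc (z - z0) = r2 ->
     (u z <= (al + be * ln (Normc.normc (z - z0)))%:E)%E) ->
  forall z, r1 <= Normc.normc (z - z0) <= r2 -> (u z <= (al + be * ln (Normc.normc (z - z0)))%:E)%E.
Proof.
move=> r10 r12 bd z1 z1r; rewrite leNgt; apply/negP => z1u.
have [m z1m mu1] := lte_between z1u.
set delta := m - (al + be * ln (Normc.normc (z1 - z0))).
have delta0 : 0 < delta by rewrite subr_gt0.
have r20 : 0 < r2 by rewrite (lt_trans r10).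
(* On the annulus [w0] exceeds the majorant by an amount between 0 and eps r2^2 = delta. Hence u -
   w0 is still positive at [z1], while it is at most 0 on both boundary circles, and its maximum is
   attained inside. *)
pose eps := delta / r2 ^+ 2.
have eps0 : 0 < eps by rewrite divr_gt0// exprn_gt0.
pose w0 (z : R[i]) := al + be * ln (Normc.normc (z - z0)) - eps * (Normc.normc (z - z0) ^+ 2 - r2 ^+ 2).
pose K := [set z : C1 R | r1 <= Normc.normc (z - z0 : R[i]) <= r2].
have w0cont z : K z -> {for z, continuous (w0 : C1 R -> R^o)}.
  move=> /andP[Kz _]; have nz : 0 < Normc.normc (z - z0) := lt_le_trans r10 Kz.
  pose phi (x : R) : R := al + be * ln x - eps * (x ^+ 2 - r2 ^+ 2).
  apply: (@cvg_comp _ _ _ (fun z : C1 R => Normc.normc (z - z0 : R[i])) phi); first exact: continuous_normcB.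
  apply: cvgB.
    by apply: cvgD; [exact: cvg_cst|apply: cvgM; [exact: cvg_cst|exact: continuous_ln]].
  apply: cvgM; first exact: cvg_cst.
  by apply: cvgB; [apply: cvgM; exact: cvg_id|exact: cvg_cst].
pose v (z : C1 R) := (u z - (w0 z)%:E)%E.
have vE z (c : R) : (v z < c%:E)%E = (u z < (c + w0 z)%:E)%E.
  by rewrite /v lteBlDr// EFinD.
have vlty z : (v z < +oo)%E.
  by rewrite /v lte_add_pinfty ?(subharmonic_lty subh)// -EFinN ltry.
have [b Kb bmax] : exists2 b, K b & forall x, K x -> (v x <= v b)%E.
  apply: compact_usc_max.
  - exact: compact_annulus.
  - by exists z1.
  - move=> x Kx c; rewrite vE => ux.
    case: subh => _ usc _.
    have [c1 uc1 c1w] : exists2 c1 : R, (u x < c1%:E)%E & c1 < c + w0 x.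
      move: ux; rewrite -lteN2 -[X in (- X < _)%E]/((c + w0 x)%:E)%E -EFinN => /lte_between[m' m1 m2].
      exists (- m'); [by rewrite EFinN lteNr|by move: m1; lra].
    have [V nV hV] : exists2 V, nbhs x V & forall y, V y -> ((- c1)%:E < - u y)%E.
      by apply: usc; rewrite EFinN lteN2.
    have nW : nbhs x [set y | c1 - c < w0 y].
      have := w0cont x Kx => /cvgrPdist_lt/(_ (c + w0 x - c1)).
      rewrite subr_gt0 => /(_ c1w); apply: filterS => y /=.
      by rewrite ltr_distl => /andP[_]; lra.
    exists (V `&` [set y | c1 - c < w0 y]); first exact: filterI.
    move=> y _ [/hV + yw]; rewrite vE EFinN lteN2 => uy.
    by apply: (lt_trans uy); rewrite lte_fin; move: yw => /=; lra.
  - by move=> x _; exact: vlty.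
have vb0 : (0 < v b)%E.
  apply: lt_le_trans (bmax z1 z1r); rewrite /v sube_gt0.
  apply: le_lt_trans mu1; rewrite lee_fin /w0.
  have : 0 <= eps * Normc.normc (z1 - z0) ^+ 2 by rewrite mulr_ge0 ?sqr_ge0 ?ltW.
  have : eps * r2 ^+ 2 = delta by rewrite /eps divfK// gt_eqF// exprn_gt0.
  by rewrite /delta; lra.
have [S vbS] : exists S, v b = S%:E.
  by move: (vlty b) vb0; case: (v b) => [S| |]// _ _; exists S.
have ub : u b = (S + w0 b)%:E.
  by rewrite EFinD -vbS /v subeK.
have interior : r1 < Normc.normc (b - z0) < r2.
  move: (Kb) => /andP[b1 b2].
  have nb : ~ (Normc.normc (b - z0) = r1 \/ Normc.normc (b - z0) = r2).
    move=> h; have := bd b h; rewrite ub lee_fin; apply/negP; rewrite -ltNge.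
    have S0 : 0 < S by rewrite -lte_fin -vbS.
    have : Normc.normc (b - z0) ^+ 2 <= r2 ^+ 2.
      by rewrite ler_sqr ?nnegrE ?normc_ge0// ltW.
    rewrite /w0 -subr_ge0 => h2; have := mulr_ge0 (ltW eps0) h2; lra.
  rewrite !lt_neqAle b1 b2 !andbT; apply/andP; split; apply/eqP => h; apply: nb; [left|right] => //.
set d := b - z0 in interior.
have [r /andP[r0 rmin] [rbe r4]] := annulus_log r10 interior al be eps0.
set D := Normc.normc d ^+ 2 in r4 *.
have nd0 : 0 < Normc.normc d by case/andP: interior => h _; exact: lt_trans h.
have D0 : 0 < D by rewrite exprn_gt0.
pose N x y := (complex.Re d + r * x) ^+ 2 + (complex.Im d + r * y) ^+ 2.
have NE t : Normc.normc (circle_pt b r t - z0) ^+ 2 = N (cos t) (sin t).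
  rewrite circle_ptE sqr_normc2 /N /d; case: (b) (z0) => b1 b2 [c1 c2] /=.
  by congr (_ ^+ 2 + _ ^+ 2); ring.
have Kpt t : K (circle_pt b r t).
  have e1 : circle_pt b r t - z0 = d + (circle_pt b r t - b) by rewrite /d; ring.
  have h := normc_circle_pt b t (ltW r0).
  move: rmin; rewrite le_min => /andP[ra rb].
  rewrite /K/= e1; apply/andP; split.
    have := le_normcD (d + (circle_pt b r t - b)) (- (circle_pt b r t - b)).
    by rewrite addrK normcN h; move: ra; lra.
  by apply: (le_trans (le_normcD _ _)); rewrite h; move: rb; lra.
pose w t := S + w0 (circle_pt b r t).
have lnE t : ln (Normc.normc (circle_pt b r t - z0)) = ln (N (cos t) (sin t)) / 2.
  have n0 : 0 < Normc.normc (circle_pt b r t - z0).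
    by have /andP[h _] := Kpt t; exact: lt_le_trans h.
  by rewrite -NE lnXn// mulr2n; lra.
have wE t : w t = S + (al + be * (ln (N (cos t) (sin t)) / 2) - eps * (N (cos t) (sin t) - r2 ^+ 2)).
  by rewrite /w /w0 lnE NE.
have Nb t : r1 ^+ 2 <= N (cos t) (sin t) <= r2 ^+ 2.
  rewrite -NE; have /andP[h1 h2] := Kpt t.
  by rewrite !ler_sqr ?nnegrE ?normc_ge0 ?(ltW r10) ?(ltW r20)// h1.
have N0 t : 0 < N (cos t) (sin t).
  by have /andP[h _] := Nb t; apply: lt_le_trans h; rewrite exprn_gt0.
have mN : measurable_fun setT (fun t : measurableTypeR R => N (cos t) (sin t)).
  by apply: measurable_funD; apply: measurable_funX; apply: measurable_funD => //;
    apply: measurable_funM => //; [exact: measurable_cos|exact: measurable_sin].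
have mw : measurable_fun setT w.
  apply: (eq_measurable_fun (fun t => S + (al + be * (ln (N (cos t) (sin t)) / 2) - eps * (N (cos t) (sin t) - r2 ^+ 2)))).
    by move=> t _; rewrite wE.
  apply: measurable_funD => //; apply: measurable_funB.
    apply: measurable_funD => //; apply: measurable_funM => //; apply: measurable_funM => //.
    exact: measurableT_comp.
  by apply: measurable_funM => //; exact: measurable_funB.
pose B := `|S| + `|al| + `|be| * (`|ln (r1 ^+ 2)| + `|ln (r2 ^+ 2)|) + eps * r2 ^+ 2.
have wB t : `|w t| <= B.
  rewrite wE /B; have /andP[n1 n2] := Nb t.
  have l1 : ln (r1 ^+ 2) <= ln (N (cos t) (sin t)) by rewrite ler_ln ?posrE ?exprn_gt0.
  have l2 : ln (N (cos t) (sin t)) <= ln (r2 ^+ 2) by rewrite ler_ln ?posrE ?exprn_gt0.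
  have l3 : `|ln (N (cos t) (sin t)) / 2| <= `|ln (r1 ^+ 2)| + `|ln (r2 ^+ 2)|.
    have a1 := ler_norm (ln (r2 ^+ 2)); have a2 := ler_norm (- ln (r1 ^+ 2)).
    rewrite normrN in a2.
    have a3 := normr_ge0 (ln (r2 ^+ 2)); have a4 := normr_ge0 (ln (r1 ^+ 2)).
    rewrite ler_norml; apply/andP; split; lra.
  have l4 : `|eps * (N (cos t) (sin t) - r2 ^+ 2)| <= eps * r2 ^+ 2.
    rewrite normrM gtr0_norm// ler_wpM2l ?(ltW eps0)// ler_norml.
    have := N0 t => ?; apply/andP; split; lra.
  have tri4 (x y z t' : R) : `|x + (y + z - t')| <= `|x| + `|y| + `|z| + `|t'|.
    have := ler_normD x (y + z - t'); have := ler_normB (y + z) t'; have := ler_normD y z; lra.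
  apply: (le_trans (tri4 _ _ _ _)); apply: lerD => //; rewrite lerD2l normrM.
  exact: ler_wpM2l.
have pw t : w (t + 2 * pi) = w t.
  by rewrite /w !circle_ptE mulr_natl cosD2pi sinD2pi.
(* A bound for the mean of [w] on the circle: relative to w b, the logarithm adds at most |be| r^4 /
   (2 D^2) and the quadratic term subtracts exactly eps r^2. The choice of [r] makes c < u b. *)
pose c := S + al + be * (ln D / 2) + `|be| / 2 * (r ^+ 4 / D ^+ 2) - eps * (D + r ^+ 2 - r2 ^+ 2).
have DE : D = complex.Re d ^+ 2 + complex.Im d ^+ 2 by rewrite /D sqr_normc2.
have wc t : w t + w (t + pi / 2) + w (t + pi) + w (t + (pi + pi / 2)) <= 4 * c.
  have cs : cos t ^+ 2 + sin t ^+ 2 = 1 by exact: cos2Dsin2.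
  have Pb := @quarter_product_bounds R _ _ _ _ r D N cs DE (fun _ _ => erefl).
  have := ln_quarter_product D0 (ltW r0) r4 Pb.
  rewrite !wE cosDpihalf sinDpihalf cosDpi sinDpi cosDpihalf3 sinDpihalf3.
  have q0 := N0 t; have := N0 (t + pi / 2); have := N0 (t + pi); have := N0 (t + (pi + pi / 2)).
  rewrite cosDpihalf sinDpihalf cosDpi sinDpi cosDpihalf3 sinDpihalf3 => q3 q2 q1.
  have sumN : N (cos t) (sin t) + N (- sin t) (cos t) + N (- cos t) (- sin t) + N (sin t) (- cos t) = 4 * (D + r ^+ 2).
    have r2E : r ^+ 2 = r ^+ 2 * (cos t ^+ 2 + sin t ^+ 2) by rewrite cs mulr1.
    by rewrite DE /N; move: r2E; lra.
  rewrite lnM ?posrE ?mulr_gt0// lnM ?posrE ?mulr_gt0// lnM ?posrE//.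
  move: sumN; rewrite /c.
  move: (N (cos t) (sin t)) (N (- sin t) (cos t)) (N (- cos t) (- sin t)) (N (sin t) (- cos t)) => n0 n1 n2 n3.
  move: (ln n0) (ln n1) (ln n2) (ln n3) (ln D) => l0 l1 l2 l3 lD sumN hl.
  have hb : be * (l0 + l1 + l2 + l3 - 4 * lD) <= `|be| * (4 * (r ^+ 4 / D ^+ 2)).
    by apply: (le_trans (ler_norm _)); rewrite normrM ler_wpM2l.
  have he : eps * (n0 + n1 + n2 + n3) = eps * (4 * (D + r ^+ 2)) by rewrite sumN.
  by move: hb he; move: (r ^+ 4 / D ^+ 2) => q; lra.
have uw t : (u (circle_pt b r t) <= (w t)%:E)%E.
  have := bmax _ (Kpt t); rewrite vbS /v /w => h.
  by rewrite EFinD -leeBlDr.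
have := subharmonic_circle_le subh r0 mw wB pw wc uw.
(* The integral of w - u is nonnegative because [b] is a maximum, yet it is bounded by 2 pi (c - u
   b), which is negative. *)
apply/negP; rewrite -ltNge; apply: (@lt_le_trans _ _ 0%E); last first.
  by apply: integral_ge0 => t _; rewrite sube_ge0 ?uw ?orbT.
rewrite ub -EFinB -EFinM lte_fin pmulr_rlt0 ?mulr_gt0 ?pi_gt0// subr_lt0 /c /w0 -/d.
have -> : ln (Normc.normc d) = ln D / 2 by rewrite /D lnXn// mulr2n; lra.
have : Normc.normc d ^+ 4 = D ^+ 2 by rewrite /D -exprM.
move=> e4; rewrite e4 in rbe; move: rbe; rewrite -/D.
move: (r ^+ 4 / D ^+ 2) => q; lra.
Qed.

End maximum_principle.

(** * Lelong numbers *)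

Lemma quarter_sum {R : realType} (A x y r c s : R) : c ^+ 2 + s ^+ 2 = 1 ->
  A + ((x + r * c) ^+ 2 + (y + r * s) ^+ 2) + (A + ((x + r * - s) ^+ 2 + (y + r * c) ^+ 2)) +
  (A + ((x + r * - c) ^+ 2 + (y + r * - s) ^+ 2)) + (A + ((x + r * s) ^+ 2 + (y + r * - c) ^+ 2)) <=
  4 * (A + (x ^+ 2 + y ^+ 2) + r ^+ 2).
Proof.
move=> cs.
rewrite [leLHS](_ : _ = 4 * (A + (x ^+ 2 + y ^+ 2) + r ^+ 2 * (c ^+ 2 + s ^+ 2))); last by ring.
by rewrite cs mulr1.
Qed.

Lemma sqdiff_le {R : realType} (A m c d x y x' y' : R) : `|x' - x| <= d -> `|y' - y| <= d ->
  d * (2 * `|x| + 2 * `|y| + 1) <= m - c ->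
  c <= m - (A + (x ^+ 2 + y ^+ 2)) + (A + (x' ^+ 2 + y' ^+ 2)).
Proof.
move=> xd yd h; have d0 : 0 <= d := le_trans (normr_ge0 _) xd.
have h1 : `|2 * x * (x' - x)| <= 2 * `|x| * d.
  by rewrite !normrM normr_nat ler_wpM2l// mulr_ge0.
have h2 : `|2 * y * (y' - y)| <= 2 * `|y| * d.
  by rewrite !normrM normr_nat ler_wpM2l// mulr_ge0.
have h3 := sqr_ge0 (x' - x); have h4 := sqr_ge0 (y' - y).
move: h1 h2; rewrite !ler_norml => /andP[h1 _] /andP[h2 _].
move: (`|x|) (`|y|) h h1 h2 => nx ny h h1 h2; nra.
Qed.

Lemma cvg_inv_ln {R : realType} : (ln r)^-1 @[r --> (0 : R)^'+] --> (0 : R).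
Proof.
apply/ltr0_cvgV0; last exact: lnNy.
near=> r; rewrite ln_lt0//; apply/andP; split; first by near: r; exact: nbhs_right_gt.
by near: r; exact: nbhs_right_lt.
Unshelve. all: by end_near.
Qed.

Lemma normc_le_shift {R : realType} (a z : R[i]) :
  Normc.normc z <= Normc.normc a + Normc.normc (z - a).
Proof. by rewrite -{1}(subrK a z) addrC; exact: le_normcD. Qed.

Section quadratic_growth.
Context {R : realType}.
Variables (u : C1 R -> \bar R) (A : R).
Hypotheses (subh : subharmonic u)
  (growth : forall z, (u z <= (A + Normc.normc z ^+ 2)%:E)%E)
  (nontriv : exists z, u z != -oo%E).

Definition growth_defect (x : R2 R) : \bar R :=
  ((A + (x.1 ^+ 2 + x.2 ^+ 2))%:E - u (of_R2 x))%E.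

Local Notation g := growth_defect.

Let growth2 (x : R2 R) : (u (of_R2 x) <= (A + (x.1 ^+ 2 + x.2 ^+ 2))%:E)%E.
Proof. by have := growth (of_R2 x); rewrite sqr_normc2. Qed.

Lemma measurable_growth_defect : measurable_fun setT g.
Proof.
apply: emeasurable_funB; last exact: measurable_subharmonic.
apply/measurable_EFinP; apply: measurable_funD => //.
by apply: measurable_funD; apply: measurable_funX.
Qed.

Lemma growth_defect_ge0 x : (0 <= g x)%E.
Proof. by rewrite /g sube_ge0 ?growth2 ?orbT. Qed.

(** The circle mean of |z|^2 exceeds its value at the centre by r^2, exactly the excess that
    [circle_superharmonic] allows; the rest is the submean inequality for [u]. That inequality is
    only given for positive radii, hence the separate case r = 0. *)
Lemma growth_defect_circle_superharmonic : circle_superharmonic g.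
Proof.
move=> a r r0; have pi0 := @pi_gt0 R.
have pi20 : 0 < 2 * pi :> R by rewrite mulr_gt0.
have [r1|r1] := ltP 0 r; last first.
  have -> : r = 0 by apply/eqP; rewrite eq_le r0 r1.
  under eq_integral => s _ do rewrite !mul0r !addr0 -surjective_pairing.
  rewrite expr0n/= adde0 integral_cst//= lebesgue_measure_itv/= lte_fin pi20 sube0.
  by rewrite muleC.
pose w t := A + ((a.1 + r * cos t) ^+ 2 + (a.2 + r * sin t) ^+ 2).
pose B := `|A| + ((`|a.1| + r) ^+ 2 + (`|a.2| + r) ^+ 2).
have mw : measurable_fun setT w.
  apply: measurable_funD => //; apply: measurable_funD; apply: measurable_funX;
    apply: measurable_funD => //; apply: measurable_funM => //;
    [exact: measurable_cos|exact: measurable_sin].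
have wB t : `|w t| <= B.
  have sq (x y c : R) : `|c| <= 1 -> `|(x + r * c) ^+ 2| <= (`|x| + r) ^+ 2.
    move=> c1; rewrite normrX ler_sqr ?nnegrE ?addr_ge0//.
    apply: (le_trans (ler_normD _ _)); rewrite lerD2l normrM gtr0_norm//.
    by rewrite -[leRHS]mulr1 ler_wpM2l.
  apply: (le_trans (ler_normD _ _)); rewrite lerD2l; apply: (le_trans (ler_normD _ _)).
  by apply: lerD; apply: sq; rewrite ?ler_norml ?cos_geN1 ?cos_le1 ?sin_geN1 ?sin_le1.
have pw t : w (t + 2 * pi) = w t by rewrite /w mulr_natl cosD2pi sinD2pi.
have wc t : w t + w (t + pi / 2) + w (t + pi) + w (t + (pi + pi / 2)) <=
    4 * (A + (a.1 ^+ 2 + a.2 ^+ 2) + r ^+ 2).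
  rewrite /w cosDpihalf sinDpihalf cosDpi sinDpi cosDpihalf3 sinDpihalf3.
  by apply: quarter_sum; rewrite cos2Dsin2.
have uw t : (u (circle_pt (of_R2 a) r t) <= (w t)%:E)%E.
  by have := growth2 (a.1 + r * cos t, a.2 + r * sin t); rewrite circle_ptE.
have := subharmonic_circle_le subh r1 mw wB pw wc uw.
have -> : (g a + (r ^+ 2)%:E = (A + (a.1 ^+ 2 + a.2 ^+ 2) + r ^+ 2)%:E - u (of_R2 a))%E.
  by rewrite /g addeAC -EFinD.
apply: le_trans; rewrite le_eqVlt; apply/orP; left; apply/eqP.
by apply: eq_integral => t _; rewrite /g/= circle_ptE.
Qed.

Lemma growth_defect_fin : exists a, (g a < +oo)%E.
Proof.
case: nontriv => z uz; exists (complex.Re z, complex.Im z).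
have -> : g (complex.Re z, complex.Im z) = ((A + (complex.Re z ^+ 2 + complex.Im z ^+ 2))%:E - u z)%E.
  by rewrite /g/=; congr (_ - u _)%E; case: z {uz}.
by move: uz (subharmonic_lty subh z); case: (u z) => // r _ _; rewrite -EFinB ltry.
Qed.

Lemma growth_defect_near_lsc : near_lsc g.
Proof.
move=> z c cg.
have [m cm mg] := lte_between cg.
pose q (x : R2 R) := A + (x.1 ^+ 2 + x.2 ^+ 2).
have [_ usc _] := subh.
have um : ((m - q z)%:E < - u (of_R2 z))%E.
  by move: mg; rewrite /g addeC -/(q z) EFinB -lteBlDr.
have [V nV hV] := usc (of_R2 z) _ um.
move/nbhs_C1P : nV => [e e0 eV].
pose K := 2 * `|z.1| + 2 * `|z.2| + 1.
have K0 : 0 < K by rewrite /K; have := normr_ge0 z.1; have := normr_ge0 z.2; lra.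
have mc : 0 < (m - c) / K by rewrite divr_gt0// subr_gt0.
pose e' := Num.min e ((m - c) / K).
have e'0 : 0 < e' by rewrite lt_min e0.
exists (e' ^+ 2); first by rewrite exprn_gt0.
move=> w zw.
have e1 : Normc.normc (of_R2 w - of_R2 z : R[i]) < e'.
  rewrite -ltr_sqr ?nnegrE ?normc_ge0 ?(ltW e'0)//.
  by rewrite sqr_normc2.
have hm := normc_ge_Re (of_R2 w - of_R2 z : R[i]).
have hi := normc_ge_Im (of_R2 w - of_R2 z : R[i]).
rewrite /= in hm hi.
move: (e1); rewrite lt_min => /andP[/eV/hV uw d1].
have gw : ((m - q z + q w)%:E < g w)%E.
  by rewrite EFinD /g [X in (_ < X)%E]addeC; apply: lte_leD.
apply: le_lt_trans gw; rewrite lee_fin.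
have := ltW d1; rewrite ler_pdivlMr// => {}d1.
exact: sqdiff_le hm hi d1.
Qed.

Let circle_bound (z0 : R[i]) (r : R) (z : C1 R) : Normc.normc (z - z0) <= r ->
  (u z <= (A + (Normc.normc z0 + r) ^+ 2)%:E)%E.
Proof.
move=> zr; apply: (le_trans (growth z)); rewrite lee_fin lerD2l ler_sqr ?nnegrE ?normc_ge0//.
  apply: (@le_trans _ _ (Normc.normc z0 + Normc.normc (z - z0))); last by rewrite lerD2l.
  exact: normc_le_shift.
by rewrite addr_ge0 ?normc_ge0// (le_trans (normc_ge0 _) zr).
Qed.

(** If [u] were -oo on the whole circle, the maximum principle with ever steeper majorants would
    make it -oo on the annulus up to radius 2 r. Then [growth_defect] would be infinite on a disc,
    against the finiteness of its Gaussian averages. *)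
Let circle_not_pole (z0 : R[i]) (r : R) : 0 < r ->
  exists2 z, Normc.normc (z - z0) = r & u z != -oo%E.
Proof.
move=> r0; apply: contrapT => h.
have {h} uNy z : Normc.normc (z - z0) = r -> u z = -oo%E.
  by move=> zr; apply/eqP; apply: contrapT => /negP uz; apply: h; exists z.
have r2 : r < 2 * r by rewrite ltr_pMl// ltr1n.
pose B := A + (Normc.normc z0 + 2 * r) ^+ 2.
have ann z : r < Normc.normc (z - z0) < 2 * r -> u z = -oo%E.
  move=> /andP[z1 z2]; apply/eqP; rewrite -leeNy_eq leNgt; apply/negP => uz.
  have [m [um]] : exists m : R, (m%:E < u z)%E /\ (m <= B).
    move: uz (subharmonic_lty subh z); case: (u z) => // x _ _.
    exists (Num.min B (x - 1)); split; last by rewrite ge_min lexx.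
    by rewrite lte_fin gt_min orbC ltrBlDr ltrDl ltr01.
  move=> mB.
  have n0 : 0 < Normc.normc (z - z0) := lt_trans r0 z1.
  have d0 : 0 < ln (2 * r) - ln (Normc.normc (z - z0)).
    by rewrite subr_gt0 ltr_ln// posrE// mulr_gt0.
  (* The majorant takes the value [B] on the outer circle and [m] at [z]; on the inner circle u =
     -oo leaves nothing to check. *)
  pose be := (B - m) / (ln (2 * r) - ln (Normc.normc (z - z0))).
  have H := @annulus_maximum R u subh z0 r (2 * r) (B - be * ln (2 * r)) be r0 r2.
  have : (u z <= m%:E)%E.
    rewrite [m](_ : _ = B - be * ln (2 * r) + be * ln (Normc.normc (z - z0))).
      apply: H; last by rewrite (ltW z1) (ltW z2).
      move=> w [/uNy ->|w2]; first exact: leNye.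
      by rewrite w2 subrK; apply: circle_bound; rewrite w2.
    have : be * (ln (2 * r) - ln (Normc.normc (z - z0))) = B - m by rewrite /be divfK// gt_eqF.
    lra.
  by rewrite leNgt um.
pose c : R2 R := (complex.Re z0 + 3 / 2 * r, complex.Im z0).
pose e := (r / 2) ^+ 2.
have e0 : 0 < e by rewrite exprn_gt0// divr_gt0.
(* At time e / 8 the error term of [heatr_lower] is a / 2, so that a / 2 would be bounded by one
   finite number for all a. *)
have t0 : 0 < e / 8 by rewrite divr_gt0.
have gy w : sqdist c w < e -> g w = +oo%E.
  move=> cw; rewrite /g ann//.
  have cwr : Normc.normc (of_R2 w - of_R2 c : R[i]) < r / 2.
    by rewrite -ltr_sqr ?nnegrE ?normc_ge0 ?divr_ge0 ?(ltW r0)// sqr_normc2.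
  have cz : Normc.normc (of_R2 c - z0) = 3 / 2 * r.
    rewrite normcE /c; case: (z0) => x y /=; rewrite subrr expr0n addr0 addrAC subrr add0r.
    by rewrite sqrtr_sqr ger0_norm// mulr_ge0 ?(ltW r0).
  have e1 : of_R2 w - z0 = (of_R2 c - z0) + (of_R2 w - of_R2 c).
    by rewrite [RHS]addrC addrA subrK.
  have h1 := le_normcD (of_R2 c - z0) (of_R2 w - of_R2 c).
  have h2 := le_normcD (of_R2 w - z0) (- (of_R2 w - of_R2 c)).
  rewrite e1 addrK normcN -e1 cz in h2; rewrite -e1 cz in h1.
  by move: h1 h2 cwr; move: (Normc.normc (of_R2 w - z0)) (Normc.normc (of_R2 w - of_R2 c)) => p q; lra.
have big (a : R) : 0 <= a -> a <= heatr g (e / 8) c + a / e * (4 * (e / 8)).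
  move=> a0; apply: (heatr_lower measurable_growth_defect growth_defect_ge0
    growth_defect_circle_superharmonic growth_defect_fin) => // w /gy ->; exact: ltry.
have hr0 : 0 <= heatr g (e / 8) c.
  exact: (heatr_ge0 measurable_growth_defect growth_defect_ge0
    growth_defect_circle_superharmonic growth_defect_fin).
have := big (2 * heatr g (e / 8) c + 2); rewrite addr_ge0 ?mulr_ge0// => /(_ isT).
have -> : (2 * heatr g (e / 8) c + 2) / e * (4 * (e / 8)) = heatr g (e / 8) c + 1.
  by field; rewrite gt_eqF.
lra.
Qed.

Let circle_max_ge (z0 z : R[i]) : (u z <= circle_max u z0 (Normc.normc (z - z0)%R))%E.
Proof. by apply: ereal_sup_ubound; exists (z - z0) => //; rewrite addrC subrK. Qed.

Let circle_max_le (z0 : R[i]) (r : R) (c : \bar R) :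
  (forall z, Normc.normc (z - z0) = r -> (u z <= c)%E) -> (circle_max u z0 r <= c)%E.
Proof.
move=> h; apply: ge_ereal_sup => _ [l /= lr <-]; apply: h.
by rewrite addrAC subrr add0r.
Qed.

Let circle_maxE (z0 : R[i]) (r : R) : 0 < r ->
  circle_max u z0 r = (fine (circle_max u z0 r))%:E.
Proof.
move=> r0; rewrite fineK// fin_numElt; apply/andP; split.
  have [z zr uz] := circle_not_pole z0 r0.
  rewrite (@lt_le_trans _ _ (u z)) ?ltNye//.
  by have := circle_max_ge z0 z; rewrite zr.
apply: (@le_lt_trans _ _ (A + (Normc.normc z0 + r) ^+ 2)%:E); last exact: ltry.
by apply: circle_max_le => z zr; apply: circle_bound; rewrite zr.
Qed.

(** Three circles: the majorant that equals M r1 and M 1 on the circles of radius r1 and 1 shows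
    that q is nondecreasing. The normalisation by M 1 disappears in the limit, as 1 / ln r -> 0.
    Since [lelong] is defined by [lim], convergence is what gives it a meaning. *)
Theorem lelong_cvg (z0 : R[i]) : exists2 l : R,
  (fine (circle_max u z0 r) / ln r) @[r --> 0^'+] --> l & lelong u z0 = l%:E.
Proof.
pose M r := fine (circle_max u z0 r).
suff [l Ml] : exists l : R, (M r / ln r) @[r --> 0^'+] --> l.
  exists l => //; apply/cvg_lim; first exact: ereal_hausdorff.
  apply: (@cvg_trans _ ((M r / ln r)%:E @[r --> 0^'+])); last by apply: cvg_EFin => //; exact: nearW.
  apply: near_eq_cvg; near=> r.
  have r0 : 0 < r by near: r; exact: nbhs_right_gt.
  by rewrite EFinM -circle_maxE.
pose q r := (M r - M 1) / ln r.
have uM z : 0 < Normc.normc (z - z0) -> (u z <= (M (Normc.normc (z - z0)))%:E)%E.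
  by move=> zz; rewrite /M -circle_maxE// circle_max_ge.
have nd r1 r2 : 0 < r1 -> r1 <= r2 -> r2 < 1 -> q r1 <= q r2.
  move=> r10 r12 r21; have r20 := lt_le_trans r10 r12.
  have lnr2 : ln r2 < 0 by rewrite ln_lt0// r20.
  have lnr1 : ln r1 < 0 by rewrite ln_lt0// r10 (le_lt_trans r12).
  rewrite /q ler_ndivlMr// lerBlDl -lee_fin -circle_maxE//.
  apply: circle_max_le => z zr; rewrite -zr.
  apply: (@annulus_maximum R u subh z0 r1 1) => //.
  - exact: le_lt_trans r12 r21.
  - move=> w [wr|wr]; have := uM w; rewrite wr => /(_ _)/le_trans; apply => //.
      by rewrite /q divfK ?lt_eqF// addrC subrK.
    by rewrite ln1 mulr0 addr0.
  - by rewrite zr r12 ltW.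
pose B := Num.max 0 (A + (Normc.normc z0 + 1) ^+ 2 - M 1).
(* Below exp (-1) the logarithm is less than -1, so an upper bound [B] for M r - M 1 gives the lower
   bound - B for the quotient. *)
have lb r : 0 < r -> r < expR (-1) -> - B <= q r.
  move=> r0 r1; have lnr : ln r < -1 by rewrite -(expRK (-1)) ltr_ln ?posrE ?expR_gt0.
  have B0 : 0 <= B by rewrite le_max lexx.
  have r11 : r <= 1.
    by rewrite ltW// (lt_le_trans r1)// -expR0 ler_expR; lra.
  rewrite /q ler_ndivlMr; last lra.
  apply: (@le_trans _ _ B); last by nra.
  rewrite le_max; apply/orP; right; rewrite lerD2r -lee_fin -circle_maxE//.
  by apply: circle_max_le => z zr; apply: circle_bound; rewrite zr.
have [l ql] : exists l : R, q r @[r --> 0^'+] --> l.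
  exists (inf (q @` `]0, (expR (-1) : R)[)).
  have e1 : expR (-1) < 1 :> R by rewrite expR_lt1; lra.
  apply: (@nondecreasing_at_right_cvgr R q 0 (BLeft (expR (-1)))).
  - by rewrite bnd_simp expR_gt0.
  - move=> x y; rewrite !in_itv/= => /andP[x0 _] /andP[_ y1] xy.
    by apply: nd => //; exact: lt_trans y1 e1.
  - by exists (- B) => _ [r + <-]; rewrite /= in_itv/= => /andP[]; exact: lb.
exists (l + M 1 * 0).
apply: (@cvg_trans _ ((q r + M 1 * (ln r)^-1) @[r --> 0^'+])).
  apply: near_eq_cvg; near=> r.
  by rewrite /q mulrBl subrK.
by apply: cvgD => //; apply: cvgM; [exact: cvg_cst|exact: cvg_inv_ln].
Unshelve. all: by end_near.
Qed.

Lemma lelong_gt0 (z0 : R[i]) (C kappa : R) : 0 < kappa ->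
  (forall z, 0 < Normc.normc (z - z0) <= 1 -> (u z <= (C + kappa * ln (Normc.normc (z - z0)))%:E)%E) ->
  lelong u z0 != 0%E.
Proof.
move=> k0 h; have [l Ml ->] := lelong_cvg z0.
have Cl : (C * (ln r)^-1 + kappa) @[r --> (0 : R)^'+] --> C * 0 + kappa.
  apply: cvgD; last exact: cvg_cst.
  by apply: cvgM; [exact: cvg_cst|exact: cvg_inv_ln].
have : C * 0 + kappa <= l.
  apply: (ler_cvg_to Cl Ml); near=> r.
  have r0 : 0 < r by near: r; exact: nbhs_right_gt.
  have r1 : r < 1 by near: r; exact: nbhs_right_lt.
  have lnr : ln r < 0 by rewrite ln_lt0// r0.
  rewrite ler_ndivlMr// mulrDl divfK ?lt_eqF// -lee_fin -circle_maxE//.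
  by apply: circle_max_le => z zr; have := h z; rewrite zr; apply; rewrite r0 ltW.
by rewrite mulr0 add0r => kl; rewrite eqe gt_eqF// (lt_le_trans k0).
Unshelve. all: by end_near.
Qed.

(** The limit l is nonnegative because [u] is bounded above near [z0]; being nonzero it is positive,
    and kappa = l / 2 is admissible at all small radii. *)
Lemma lelong_neq0 (z0 : R[i]) : lelong u z0 != 0%E ->
  exists kappa r0 : R, [/\ 0 < kappa, 0 < r0 < 1 &
    forall z, 0 < Normc.normc (z - z0) < r0 -> (u z <= (kappa * ln (Normc.normc (z - z0)))%:E)%E].
Proof.
have [l Ml ->] := lelong_cvg z0; rewrite eqe => l0.
have Cl : ((A + (Normc.normc z0 + 1) ^+ 2) * (ln r)^-1) @[r --> (0 : R)^'+] --> (A + (Normc.normc z0 + 1) ^+ 2) * 0.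
  by apply: cvgM; [exact: cvg_cst|exact: cvg_inv_ln].
have : (A + (Normc.normc z0 + 1) ^+ 2) * 0 <= l.
  apply: (ler_cvg_to Cl Ml); near=> r.
  have r0 : 0 < r by near: r; exact: nbhs_right_gt.
  have r1 : r < 1 by near: r; exact: nbhs_right_lt.
  have lnr : ln r < 0 by rewrite ln_lt0// r0.
  rewrite ler_ndivlMr// divfK ?lt_eqF// -lee_fin -circle_maxE//.
  by apply: circle_max_le => z zr; apply: circle_bound; rewrite zr ltW.
rewrite mulr0 le_eqVlt eq_sym (negbTE l0)/= => {}l0.
have l2 : l / 2 < l by rewrite ltr_pdivrMr// ltr_pMr// ltr1n.
have [e /= e0 he] : \forall r \near 0^'+, l / 2 < fine (circle_max u z0 r) / ln r.
  exact: (cvgr_gt _ Ml).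
exists (l / 2), (Num.min e (1 / 2)); split.
- by rewrite divr_gt0.
- by rewrite lt_min e0 gt_min divr_gt0//=; apply/orP; right; lra.
move=> z; rewrite lt_min => /andP[z0r /andP[ze z1]].
have : l / 2 < fine (circle_max u z0 (Normc.normc (z - z0))) / ln (Normc.normc (z - z0)).
  by apply: he => //; rewrite /ball/= sub0r normrN gtr0_norm.
have lnz : ln (Normc.normc (z - z0)) < 0 by rewrite ln_lt0// z0r (lt_trans z1)//; lra.
rewrite ltr_ndivlMr// => h.
by apply: (le_trans (circle_max_ge z0 z)); rewrite circle_maxE// lee_fin ltW.
Unshelve. all: by end_near.
Qed.

(** The dichotomy of [small_increments]: either some scale has mass below the threshold, or [u] has
    a logarithmic pole, which a vanishing Lelong number excludes. *)
Lemma lelong0_exp_integrable (z0 : R2 R) (c : R) : 0 < c -> lelong u (of_R2 z0) = 0%E ->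
  exists2 s : R, 0 < s & exists phi : R2 R -> \bar R,
    [/\ measurable_fun setT phi, forall z, (0 <= phi z)%E,
      forall z, (expeR (c%:E * g z) <= phi z)%E &
      (\int[lebesgue2]_(z in square z0 s) phi z < +oo)%E].
Proof.
(* With this value 4 pi exp 4 eta is the bound pi / (2 c) required by [local_exp_integrable]. *)
move=> c0 lel0; pose eta := pi / 2 / c / (4 * pi * expR 4).
have pi0 := @pi_gt0 R.
have eta0 : 0 < eta by rewrite !divr_gt0// !mulr_gt0// expR_gt0.
have mg := measurable_growth_defect; have g0 := growth_defect_ge0.
have sg := growth_defect_circle_superharmonic; have gf := growth_defect_fin.
have [[T T0 hT]|h] := small_increments mg g0 sg gf z0 eta0.
  exists (Num.sqrt T); first by rewrite sqrtr_gt0.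
  apply: (local_exp_integrable mg g0 sg gf growth_defect_near_lsc T0 c0).
  rewrite [leRHS](_ : _ = 4 * pi * expR 4 * eta).
    by rewrite ler_wpM2l// !mulr_ge0 ?expR_ge0// ltW.
  by rewrite /eta [RHS]mulrC divfK// gt_eqF// !mulr_gt0// expR_gt0.
have [kappa [k0 [C hC]]] := log_pole_lower_bound mg g0 sg gf eta0 h.
have : lelong u (of_R2 z0) != 0%E.
  (* The pole is given in terms of the squared distance, hence 2 kappa; on the unit disc about [z0]
     the term |z|^2 goes into the constant. *)
  apply: (@lelong_gt0 _ (C + A + (Normc.normc (of_R2 z0) + 1) ^+ 2) (2 * kappa)).
    by rewrite mulr_gt0.
  move=> z /andP[z1 z2].
  have zE : of_R2 (complex.Re z, complex.Im z) = z by case: (z).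
  have sE : sqdist z0 (complex.Re z, complex.Im z) = Normc.normc (z - of_R2 z0) ^+ 2.
    by rewrite sqr_normc2; case: (z).
  have := hC (complex.Re z, complex.Im z).
  rewrite sE exprn_gt0//= exprn_ile1 ?normc_ge0// => /(_ isT).
  rewrite lnXn// /g zE /= => h1.
  have h2 : Normc.normc z ^+ 2 <= (Normc.normc (of_R2 z0) + 1) ^+ 2.
    rewrite ler_sqr ?nnegrE ?normc_ge0 ?addr_ge0 ?normc_ge0//.
    apply: (@le_trans _ _ (Normc.normc (of_R2 z0) + Normc.normc (z - of_R2 z0))); last by rewrite lerD2l.
    exact: normc_le_shift.
  rewrite sqr_normc2 in h2.
  move: h1 (subharmonic_lty subh z); case: (u z) => [x| |]//; last by rewrite leNye.
  rewrite -EFinB !lee_fin mulr2n => h1 _; move: h1 h2.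
  move: (complex.Re z ^+ 2) (complex.Im z ^+ 2) ((Normc.normc (of_R2 z0) + 1) ^+ 2) (ln _) => p q s L; lra.
by rewrite lel0 eqxx.
Qed.

End quadratic_growth.

(** * Polynomial functions *)

Section polynomial_functions.
Context {R : realType}.

(** Differentiability, measurability and polynomial growth are all proved by this single induction
    over the algebra generated by the coordinates. *)
Lemma poly_fun_ind (Phi : (C2 R -> C1 R) -> Prop) :
  (forall c : R[i], Phi (fun=> c)) -> Phi (fun z => z.1) -> Phi (fun z => z.2) ->
  (forall f1 f2, Phi f1 -> Phi f2 -> Phi (fun z => f1 z + f2 z)) ->
  (forall f1 f2, Phi f1 -> Phi f2 -> Phi (fun z => (f1 z : R[i]) * f2 z)) ->
  forall P, Phi (poly_fun P).
Proof.
move=> Phic Phi1 Phi2 PhiD PhiM.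
have inner (p : {poly R[i]}) : Phi (fun z => p.[z.1 : R[i]]).
  elim/poly_ind: p => [|p c IH].
    by rewrite [X in Phi X](_ : _ = fun=> (0 : R[i])) //; apply/funext => z; rewrite horner0.
  rewrite [X in Phi X](_ : _ = fun z => (p.[z.1 : R[i]] * z.1 : R[i]) + c).
    by apply: PhiD => //; exact: PhiM.
  by apply/funext => z; rewrite hornerMXaddC.
move=> P; elim/poly_ind: P => [|P c IH].
  by rewrite [X in Phi X](_ : _ = fun=> (0 : R[i])) //; apply/funext => z; rewrite /poly_fun !horner0.
rewrite [X in Phi X](_ : _ = fun z => (poly_fun P z : R[i]) * z.2 + c.[z.1 : R[i]]).
  by apply: PhiD => //; exact: PhiM.
by apply/funext => z; rewrite /poly_fun hornerMXaddC hornerD hornerM hornerC.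
Qed.

Lemma poly_fun_differentiable P (z : C2 R) : differentiable (poly_fun P : C2 R -> C1 R) z.
Proof.
apply: (@poly_fun_ind (fun f => differentiable (f : C2 R -> C1 R) z)) => [c|||f1 f2 d1 d2|f1 f2 d1 d2].
- exact: differentiable_cst.
- apply: (@linear_differentiable _ _ _ (fst : {linear C2 R -> C1 R})).
  by move=> x; exact: cvg_fst.
- apply: (@linear_differentiable _ _ _ (snd : {linear C2 R -> C1 R})).
  by move=> x; exact: cvg_snd.
- exact: differentiableD.
- exact: (@differentiableM _ _ (f1 : C2 R -> R[i]) (f2 : C2 R -> R[i])).
Qed.

Lemma measurable_poly_fun P :
  measurable_fun setT (fun x : R4 R => complex.Re (poly_fun P (of_reals x))) /\
  measurable_fun setT (fun x : R4 R => complex.Im (poly_fun P (of_reals x))).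
Proof.
pose mf (f : C2 R -> C1 R) := measurable_fun setT (fun x : R4 R => complex.Re (f (of_reals x))) /\
  measurable_fun setT (fun x : R4 R => complex.Im (f (of_reals x))).
apply: (@poly_fun_ind mf) => [c|||f1 f2 [r1 i1] [r2 i2]|f1 f2 [r1 i1] [r2 i2]].
- by split; exact: measurable_cst.
- split; [exact: (measurableT_comp measurable_fst measurable_fst)|
    exact: (measurableT_comp measurable_snd measurable_fst)].
- split; [exact: (measurableT_comp measurable_fst measurable_snd)|
    exact: (measurableT_comp measurable_snd measurable_snd)].
- split.
    apply: (eq_measurable_fun (fun x => complex.Re (f1 (of_reals x)) + complex.Re (f2 (of_reals x)))).
      by move=> x _; case: (f1 _) (f2 _) => ? ? [].
    exact: measurable_funD.
  apply: (eq_measurable_fun (fun x => complex.Im (f1 (of_reals x)) + complex.Im (f2 (of_reals x)))).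
    by move=> x _; case: (f1 _) (f2 _) => ? ? [].
  exact: measurable_funD.
- split.
    apply: (eq_measurable_fun (fun x => complex.Re (f1 (of_reals x)) * complex.Re (f2 (of_reals x)) -
       complex.Im (f1 (of_reals x)) * complex.Im (f2 (of_reals x)))).
      by move=> x _; case: (f1 _) (f2 _) => ? ? [].
    by apply: measurable_funB; exact: measurable_funM.
  apply: (eq_measurable_fun (fun x => complex.Re (f1 (of_reals x)) * complex.Im (f2 (of_reals x)) +
       complex.Im (f1 (of_reals x)) * complex.Re (f2 (of_reals x)))).
    by move=> x _; case: (f1 _) (f2 _) => ? ? [].
  by apply: measurable_funD; exact: measurable_funM.
Qed.

Lemma measurable_sqr_poly_fun P :
  measurable_fun setT (fun x : R4 R => Normc.normc (poly_fun P (of_reals x)) ^+ 2).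
Proof.
have [mRe mIm] := measurable_poly_fun P.
apply: (eq_measurable_fun (fun x => complex.Re (poly_fun P (of_reals x)) ^+ 2 + complex.Im (poly_fun P (of_reals x)) ^+ 2)).
  by move=> x _; rewrite sqr_normc2.
by apply: measurable_funD; exact: measurable_funX.
Qed.

Definition sqnorm (z : C2 R) : R := Normc.normc z.1 ^+ 2 + Normc.normc z.2 ^+ 2.

Lemma sqnorm_ge0 z : 0 <= sqnorm z.
Proof. by rewrite addr_ge0// sqr_ge0. Qed.

Lemma poly_fun_growth P : exists C m, 0 <= C /\
  forall z : C2 R, Normc.normc (poly_fun P z) ^+ 2 <= C * (1 + sqnorm z) ^+ m.
Proof.
pose gf (f : C2 R -> C1 R) := exists (C : R) (m : nat), 0 <= C /\
  forall z : C2 R, Normc.normc (f z) ^+ 2 <= C * (1 + sqnorm z) ^+ m.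
have s1 z : 1 <= 1 + sqnorm z by rewrite lerDl sqnorm_ge0.
apply: (@poly_fun_ind gf) => [c|||f1 f2 [C1 [m1 [c1 h1]]] [C2 [m2 [c2 h2]]]|f1 f2 [C1 [m1 [c1 h1]]] [C2 [m2 [c2 h2]]]].
- exists (Normc.normc c ^+ 2), 0%N; split; first exact: sqr_ge0.
  by move=> z; rewrite expr0 mulr1.
- exists 1, 1%N; split => // z; rewrite mul1r expr1 /sqnorm addrCA lerDl; apply: addr_ge0 => //; exact: sqr_ge0.
- exists 1, 1%N; split => // z; rewrite mul1r expr1 /sqnorm addrA lerDr; apply: addr_ge0 => //; exact: sqr_ge0.
- exists (2 * (C1 + C2)), (m1 + m2)%N; split; first by rewrite mulr_ge0// addr_ge0.
  move=> z; have p1 : (1 + sqnorm z) ^+ m1 <= (1 + sqnorm z) ^+ (m1 + m2) by rewrite ler_weXn2l ?leq_addr.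
  have p2 : (1 + sqnorm z) ^+ m2 <= (1 + sqnorm z) ^+ (m1 + m2) by rewrite ler_weXn2l ?leq_addl.
  have q1 := le_trans (h1 z) (ler_wpM2l c1 p1); have q2 := le_trans (h2 z) (ler_wpM2l c2 p2).
  have tri : Normc.normc (f1 z + f2 z) ^+ 2 <= (Normc.normc (f1 z) + Normc.normc (f2 z)) ^+ 2.
    by rewrite ler_sqr ?nnegrE ?addr_ge0 ?normc_ge0// le_normcD.
  have s := sqr_ge0 (Normc.normc (f1 z) - Normc.normc (f2 z)).
  move: tri s q1 q2; move: (Normc.normc (f1 z)) (Normc.normc (f2 z)) (Normc.normc _) => a b c.
  move: ((1 + sqnorm z) ^+ (m1 + m2)) => S; lra.
- exists (C1 * C2), (m1 + m2)%N; split; first by rewrite mulr_ge0.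
  move=> z; rewrite Normc.normcM exprMn exprD [leRHS]mulrACA.
  by apply: ler_pM; [exact: sqr_ge0|exact: sqr_ge0|exact: h1|exact: h2].
Qed.

End polynomial_functions.

(** * From local to global integrability by compactness *)

Section local_properties.
Context {R : realType}.

(** If no set satisfying [P] covers [K], the differences of [K] and such sets generate a proper
    filter, and a cluster point contradicts the local hypothesis. *)
Lemma compact_ideal (T : topologicalType) (K : set T) (P : set T -> Prop) :
  compact K -> P set0 -> (forall A B, P A -> P B -> P (A `|` B)) ->
  (forall x, K x -> exists2 B, P B & nbhs x B) -> exists2 B, P B & K `<=` B.
Proof.
move=> cK P0 PU Ploc; apply: contrapT => noB.
pose F := filter_from P (fun B => K `\` B).
have FF : ProperFilter F.
  apply: filter_from_proper.
    apply: filter_from_filter; first by exists set0.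
    move=> A B PA PB; exists (A `|` B); first exact: PU.
    by move=> x [Kx nAB]; split; split => // ?; apply: nAB; [left|right].
  move=> B PB; apply: contrapT => h; apply: noB; exists B => // x Kx.
  by apply: contrapT => nBx; apply: h; exists x.
have FK : F K by exists set0 => // x [].
have [p [Kp clp]] := cK F FF FK.
have [B PB pB] := Ploc p Kp.
have FB : F (K `\` B) by exists B.
by have [z [[_ nBz] Bz]] := clp _ _ FB pB.
Qed.

(** Finiteness of an upper integral: neither [f] nor [B] has to be measurable, and finite unions are
    treated by adding the majorants. *)
Definition integrably_dominated (f : R2 R -> \bar R) (B : set (R2 R)) : Prop :=
  exists phi : R2 R -> \bar R, [/\ measurable_fun setT phi, forall z, (0 <= phi z)%E,
    forall z, B z -> (f z <= phi z)%E & (\int[lebesgue2]_z phi z < +oo)%E].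

Lemma integrably_dominatedU f A B : integrably_dominated f A ->
  integrably_dominated f B -> integrably_dominated f (A `|` B).
Proof.
move=> [p [mp p0 fp ip]] [q [mq q0 fq iq]]; exists (fun z => p z + q z)%E; split.
- exact: emeasurable_funD.
- by move=> z; rewrite adde_ge0.
- by move=> z [/fp|/fq] /le_trans; apply; [rewrite leeDl|rewrite leeDr].
- by rewrite ge0_integralD// lte_add_pinfty.
Qed.

Lemma integrably_dominated_set0 f : integrably_dominated f set0.
Proof.
exists (fun=> 0%E); split => //.
by rewrite integral0 ltry.
Qed.

Lemma nbhs_square (z : R * R) (s : R) : 0 < s -> nbhs z (square z s : set (R * R)).
Proof.
move=> s0; exists (ball z.1 s, ball z.2 s) => /=.
  by split; exact: nbhsx_ballx.
move=> [x y] [/= h1 h2]; apply/squareP; rewrite /=.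
by split; rewrite distrC; apply: ltW.
Qed.

Lemma compact_square (z : R * R) (s : R) : compact (square z s : set (R * R)).
Proof. by apply: compact_setX; exact: segment_compact. Qed.

Lemma integrably_dominated_square f (z : R2 R) (M : R) :
  (forall x, square z M x -> exists2 s, 0 < s & integrably_dominated f (square x s)) ->
  integrably_dominated f (square z M).
Proof.
move=> h.
have loc (x : (R * R)%type) : square z M x -> exists2 B : set (R * R), integrably_dominated f B & nbhs x B.
    move=> /h[s s0 fs]; exists (square x s : set (R * R)) => //; exact: nbhs_square.
have [B fB zB] := compact_ideal (@compact_square z M) (integrably_dominated_set0 f)
  (@integrably_dominatedU f) loc.
by case: fB => p [mp p0 fp ip]; exists p; split => // x /zB; exact: fp.
Qed.

End local_properties.

(** * Gauges and their slices *)

Section gauge.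
Context {R : realType}.
Variable h : C2 R -> R.
Hypothesis hg : homogeneous_gauge h.

Lemma gauge_ge0 z : 0 <= h z. Proof. by case: hg. Qed.

Lemma gaugeZ (l : R[i]) z : h (l *: z) = Normc.normc l * h z. Proof. by case: hg. Qed.

Lemma gauge0 : h 0 = 0.
Proof. by rewrite -(scale0r (0 : C2 R)) gaugeZ Normc.normc0 mul0r. Qed.

Lemma gauge_usc (z : C2 R) (a : R) : h z < a -> \forall w \near z, h w < a.
Proof.
move=> za; case: hg => _ usc _.
have /(usc z (- a))[V nV hV] : ((- a)%:E < - (h z)%:E)%E by rewrite lte_fin ltrN2.
by apply: filterS nV => w /hV; rewrite lte_fin ltrN2.
Qed.

Lemma open_balanced_domain : open (balanced_domain h).
Proof. by rewrite openE => z /gauge_usc. Qed.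

(** Semicontinuity at 0 gives h < 1 on a small bidisc, and homogeneity carries this bound to all of
    C^2. *)
Lemma gauge_bound : exists2 K : R, 0 < K & forall z, h z <= K * (Normc.normc z.1 + Normc.normc z.2).
Proof.
have := @gauge_usc 0 1; rewrite gauge0 ltr01 => /(_ isT) /nbhs_C2P[e e0 he].
exists (2 / e); first by rewrite divr_gt0.
move=> z; set s := Normc.normc z.1 + Normc.normc z.2.
have n1 := normc_ge0 z.1; have n2 := normc_ge0 z.2.
have [s0|s0] := ltP 0 s; last first.
  have z1 : z.1 = 0 by apply: Normc.eq0_normc; apply/eqP; rewrite eq_le n1 andbT; move: s0; rewrite /s; lra.
  have z2 : z.2 = 0 by apply: Normc.eq0_normc; apply/eqP; rewrite eq_le n2 andbT; move: s0; rewrite /s; lra.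
  have -> : z = 0 by rewrite (surjective_pairing z) z1 z2.
  by rewrite gauge0 mulr_ge0 ?divr_ge0 ?(ltW e0)// addr_ge0.
pose l := e / (2 * s).
have l0 : 0 < l by rewrite divr_gt0// mulr_gt0.
have le2 : l * s = e / 2 by rewrite /l; field; rewrite gt_eqF.
have := he (l%:C *: z).
rewrite /= !subr0 !Normc.normcM !normc_realC gtr0_norm// gaugeZ normc_realC gtr0_norm//.
have q1 : l * Normc.normc z.1 < e.
  have : l * Normc.normc z.1 <= l * s by rewrite ler_pM2l// /s lerDl.
  by rewrite le2; lra.
have q2 : l * Normc.normc z.2 < e.
  have : l * Normc.normc z.2 <= l * s by rewrite ler_pM2l// /s lerDr.
  by rewrite le2; lra.
move=> /(_ q1 q2); rewrite -ltr_pdivlMl// mulr1 => /ltW /le_trans; apply.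
by rewrite /l invf_div; rewrite le_eqVlt; apply/orP; left; apply/eqP; field; rewrite gt_eqF.
Qed.

Hypothesis hp : pseudoconvex_gauge h.

Lemma subharmonic_slice (w : R[i]) : subharmonic (fun l : C1 R => log_fun h (l, w)).
Proof.
case: hp => _ _ /(_ (0, w) (1, 0)).
congr subharmonic; apply/funext => l; congr (log_fun h _).
rewrite [LHS]surjective_pairing /= add0r; congr pair; first exact: mulr1.
by rewrite scaler0 addr0.
Qed.

Lemma log_fun_le (z : C2 R) (a : R) : h z <= expR a -> (log_fun h z <= a%:E)%E.
Proof.
move=> za; rewrite /log_fun; have [h0|h0] := ltP 0 (h z).
  by rewrite lne_EFin// lee_fin -ler_expR lnK.
by rewrite le0_lneNy ?leNye.
Qed.

Lemma log_funE (z : C2 R) : h z != 0 -> log_fun h z = (ln (h z))%:E.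
Proof. by move=> z0; rewrite /log_fun lne_EFin// lt0r z0 gauge_ge0. Qed.

Lemma log_fun0 (z : C2 R) : h z = 0 -> log_fun h z = -oo%E.
Proof. by move=> z0; rewrite /log_fun z0 le0_lneNy. Qed.

(** Far from sharp, as the slice grows logarithmically; the quadratic form is the one that makes
    [growth_defect] nonnegative. *)
Lemma slice_growth (w : R[i]) : exists2 A : R, 0 <= A &
  forall l : C1 R, (log_fun h (l, w) <= (A + Normc.normc l ^+ 2)%:E)%E.
Proof.
have [K K0 hK] := gauge_bound; have w0 := normc_ge0 w.
exists (K * Normc.normc w + K ^+ 2); first by rewrite addr_ge0 ?sqr_ge0// mulr_ge0// ltW.
move=> l; apply: log_fun_le; apply: (le_trans (hK _)) => /=.
apply: le_trans (expR_ge1Dx _).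
have s1 := sqr_ge0 (K - Normc.normc l); have s2 := sqr_ge0 (K + Normc.normc l).
rewrite mulrDr; move: s1 s2; move: (K * Normc.normc w) (Normc.normc l) => p q; lra.
Qed.

(** If the slice were identically -oo, homogeneity would make [h] vanish off the line z2 = 0. A
    nonzero value on that line is then excluded by the submean inequality in the transverse
    direction. *)
Lemma slice_nontrivial (w : R[i]) : w != 0 -> (exists z, h z != 0) ->
  exists l : C1 R, log_fun h (l, w) != -oo%E.
Proof.
move=> w0 [[a b] hab]; apply: contrapT => H.
have hw l : h (l, w) = 0.
  apply/eqP; apply: contrapT => /negP hl; apply: H; exists l.
  by rewrite log_funE.
have hx l v : v != 0 -> h (l, v) = 0.
  move=> v0; have -> : (l, v) = (v / w) *: ((l * (w / v), w) : C2 R).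
    rewrite [RHS]surjective_pairing /=; congr pair; last by rewrite [RHS]divfK.
    change (l = (v / w) * (l * (w / v))).
    by rewrite mulrCA -invf_div mulVf ?mulr1// mulf_neq0// invr_eq0.
  by rewrite gaugeZ hw mulr0.
have [b0|b0] := eqVneq b 0; last by move: hab; rewrite hx// eqxx.
subst b; have a0 : a != 0.
  by apply: contra_neq hab => ->; exact: gauge0.
(* The unit circle about (a, 0) in the complex line z1 = a avoids z2 = 0, so log h is -oo on all of
   it. *)
case: hp => _ _ /(_ (a, 0) (0, 1))[_ _ /(_ 0 1 ltr01)].
rewrite scale0r addr0 log_funE// leNgt => /negP; apply.
rewrite /circle_mean (eq_integral (cst -oo%E)).
  rewrite integral_cst//= lebesgue_measure_itv/= lte_fin mulr_gt0 ?pi_gt0// sube0.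
  by rewrite gt0_mulNye ?lte_fin ?mulr_gt0 ?pi_gt0// gt0_muleNy ?lte_fin ?invr_gt0 ?mulr_gt0 ?pi_gt0// ltNyr.
move=> t _ /=; rewrite log_fun0//.
rewrite [X in h X]surjective_pairing/=; apply: hx; rewrite !add0r.
apply/eqP => /(congr1 (@Normc.normc R)).
rewrite [X in Normc.normc X = _](_ : _ = 1%:C * (cos t +i* sin t)); last exact: mulr1.
rewrite Normc.normcM normc_cossin normc_realC mulr1 normr1 Normc.normc0 => /eqP.
by rewrite oner_eq0.
Qed.

End gauge.

(** * Exchange of the two coordinates *)

Section swap.
Context {R : realType}.
Local Open Scope ereal_scope.

Lemma lebesgue4_swap (f : R4 R -> \bar R) : measurable_fun setT f ->
  (forall x, 0 <= f x) ->
  \int[lebesgue4]_x f (x.2, x.1) = \int[lebesgue4]_x f x.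
Proof.
move=> mf f0.
have ms : measurable_fun setT (fun x : R4 R => f (x.2, x.1)).
  apply: (measurableT_comp mf); apply: measurable_fun_pair;
    [exact: measurable_snd|exact: measurable_fst].
rewrite -[LHS]/(\int[lebesgue2 \x lebesgue2]_x f (x.2, x.1)).
rewrite -[RHS]/(\int[lebesgue2 \x lebesgue2]_x f x).
by rewrite (fubini_tonelli1 _ ms)// (fubini_tonelli2 _ mf).
Qed.

Variable h : C2 R -> R.
(** Brings the point l = oo of the projective line, the branch v.2 = 0 of [lelong_proj], to the
    point 0 of the chart. *)
Definition swap_gauge (z : C2 R) : R := h (z.2, z.1).

Lemma swap_gauge_homogeneous : homogeneous_gauge h -> homogeneous_gauge swap_gauge.
Proof.
move=> hg; split.
- by move=> z; exact: (gauge_ge0 hg).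
- move=> z a; case: hg => _ usc _ /usc[V /nbhs_C2P[e e0 eV] hV].
  exists [set w : C2 R | V (w.2, w.1)]; last by move=> y; exact: hV.
  by apply/nbhs_C2P; exists e => // w w1 w2; apply: eV.
- by move=> l z; case: hg => _ _ /(_ l (z.2, z.1)).
Qed.

Lemma swap_gauge_pseudoconvex : pseudoconvex_gauge h -> pseudoconvex_gauge swap_gauge.
Proof.
case=> fin usc sub; split.
- by move=> z; exact: fin.
- move=> z a /usc[V /nbhs_C2P[e e0 eV] hV].
  exists [set w : C2 R | V (w.2, w.1)]; last by move=> y; exact: hV.
  by apply/nbhs_C2P; exists e => // w w1 w2; apply: eV.
- by move=> a b; exact: (sub (a.2, a.1) (b.2, b.1)).
Qed.

Lemma swap_gauge_neq0 : (exists z, h z != 0%R) -> exists z, swap_gauge z != 0%R.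
Proof. by case=> z hz; exists (z.2, z.1); rewrite /swap_gauge/= -surjective_pairing. Qed.

End swap.

Section gauge_slice.
Context {R : realType}.
Variable h : C2 R -> R.
Hypotheses (hg : homogeneous_gauge h) (hp : pseudoconvex_gauge h)
  (h_neq0 : exists z, h z != 0).
Local Notation slice w := (fun l : C1 R => log_fun h (l, w)).

Lemma slice_lelong0 (z0 : R2 R) (c : R) : 0 < c -> lelong (slice 1) (of_R2 z0) = 0%E ->
  exists2 s : R, 0 < s &
    integrably_dominated (fun z => expeR (c%:E * - log_fun h (of_R2 z, 1%R : R[i]))%E) (square z0 s).
Proof.
move=> c0 lel0; have [A A0 growth] := slice_growth hg 1.
have nt := slice_nontrivial hg hp (oner_neq0 _) h_neq0.
have [s s0 [phi [mphi phi0 ephi iphi]]] :=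
  lelong0_exp_integrable (subharmonic_slice hp 1) growth nt c0 lel0.
exists s => //; exists (phi \_ (square z0 s)); split.
- apply/measurable_restrict => //; first exact: measurable_square.
  by rewrite setTI; exact: measurable_funTS.
- by move=> z; rewrite /patch; case: ifP.
- move=> z zs; rewrite patchE mem_set//; apply: le_trans (ephi z).
  rewrite lee_expeR lee_pmul2l ?lte_fin//.
  (* Since A + |z|^2 >= 0, the exponential of c g dominates the one of - c log h. *)
  rewrite /growth_defect; rewrite addeC leeDl// lee_fin.
  by rewrite addr_ge0// addr_ge0// sqr_ge0.
- by rewrite -integral_mkcond.
Qed.

(** By homogeneity h (w l, w) = |w| h (l, 1), so a pole at [z0] at height [w] becomes a pole at z0 /
    w at height 1; the constant collects the powers of |w|. *)
Lemma slice_pole (w z0 : R[i]) : w != 0 -> lelong (slice w) z0 != 0%E ->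
  exists kappa C r0 : R, [/\ 0 < kappa, 0 < C, 0 < r0 &
    forall l : R[i], 0 < Normc.normc (l - z0 / w) < r0 ->
      h (l, 1) <= C * expR (kappa * ln (Normc.normc (l - z0 / w)))].
Proof.
move=> w0 lel; have [A A0 growth] := slice_growth hg w.
have nt := slice_nontrivial hg hp w0 h_neq0.
have [k [r0 [k0 /andP[r00 r01] hk]]] := lelong_neq0 (subharmonic_slice hp w) growth nt lel.
have nw : 0 < Normc.normc w.
  rewrite lt_neqAle normc_ge0 andbT eq_sym; apply: contra w0 => /eqP w0.
  by apply/eqP; exact: Normc.eq0_normc.
exists k, ((Normc.normc w)^-1 * expR (k * ln (Normc.normc w))), (r0 / Normc.normc w).
split => //; first by rewrite mulr_gt0 ?invr_gt0 ?expR_gt0.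
  by rewrite divr_gt0.
move=> l /andP[l1 l2].
have e1 : w * l - z0 = w * (l - z0 / w) by rewrite mulrBr mulrCA divff// mulr1.
have e2 : Normc.normc (w * l - z0) = Normc.normc w * Normc.normc (l - z0 / w).
  by rewrite e1 Normc.normcM.
have := hk (w * l); rewrite e2 mulr_gt0// mulrC -ltr_pdivlMr// => /(_ l2).
have hE : h (w * l, w) = Normc.normc w * h (l, 1).
  rewrite -(gaugeZ hg); congr h; rewrite [RHS]surjective_pairing/=; congr pair.
  by rewrite -[LHS]mulr1.
have [h0|h0] := eqVneq (h (l, 1)) 0.
  by rewrite h0 => _; rewrite !mulr_ge0 ?invr_ge0 ?(ltW nw) ?expR_ge0.
rewrite log_funE//; last by rewrite hE mulf_neq0// gt_eqF.
rewrite lee_fin => H.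
have : expR (ln (h (w * l, w))) <= expR (k * ln (Normc.normc (l - z0 / w) * Normc.normc w)).
  by rewrite ler_expR.
rewrite lnK ?posrE; last by rewrite hE mulr_gt0// lt0r h0 gauge_ge0.
rewrite hE mulrC -ler_pdivlMr// => /le_trans; apply.
have -> : expR (k * ln (Normc.normc (l - z0 / w) * Normc.normc w)) =
    expR (k * ln (Normc.normc (l - z0 / w))) * expR (k * ln (Normc.normc w)).
  by rewrite lnM ?posrE// mulrDr expRD.
by rewrite mulrC [X in _ * X]mulrC mulrA.
Qed.

End gauge_slice.

(** * Integrals over balanced domains *)

Section divergence.
Context {R : realType}.
Local Notation mu2 := (@lebesgue2 R).
Variable h : C2 R -> R.
Hypothesis hg : homogeneous_gauge h.
Let D' := of_reals @^-1` (balanced_domain h) : set (R4 R).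

Lemma measurable_balanced_domain : measurable D'.
Proof. by apply: measurable_C2_open; exact: open_balanced_domain. Qed.

Definition mulc2 (z w : R2 R) : R2 R := ((z.1 * w.1 - z.2 * w.2)%R, (z.2 * w.1 + z.1 * w.2)%R).

Lemma of_R2_mulc2 z w : of_R2 (mulc2 z w) = (of_R2 z : R[i]) * of_R2 w.
Proof. by rewrite /of_R2 /mulc2/=; simpc; rewrite [X in _ +i* X]addrC. Qed.

Definition sqabs (z : R2 R) : R := z.1 ^+ 2 + z.2 ^+ 2.

Lemma sqabs_ge0 z : 0 <= sqabs z. Proof. by rewrite addr_ge0// sqr_ge0. Qed.

Lemma sqabsE z : sqabs z = Normc.normc (of_R2 z : R[i]) ^+ 2.
Proof. by rewrite sqr_normc2. Qed.

Lemma measurable_sqabs : measurable_fun setT sqabs.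
Proof. by apply: measurable_funD; apply: measurable_funX. Qed.

Lemma ge0_integral_mulc2 (f : R2 R -> \bar R) z : sqabs z != 0 -> measurable_fun setT f ->
  (forall x, 0 <= f x)%E ->
  (\int[mu2]_w f w = (sqabs z)%:E * \int[mu2]_w f (mulc2 z w))%E.
Proof. by move=> z0 mf f0; rewrite -(@ge0_integral2_mulc _ f z.1 z.2). Qed.

Lemma measurable_mulc2 d (T : measurableType d) (f g : T -> R2 R) :
  measurable_fun setT f -> measurable_fun setT g -> measurable_fun setT (fun x => mulc2 (f x) (g x)).
Proof.
move=> mf mg.
have f1 := measurableT_comp measurable_fst mf; have f2 := measurableT_comp measurable_snd mf.
have g1 := measurableT_comp measurable_fst mg; have g2 := measurableT_comp measurable_snd mg.
by apply: measurable_pair2; [apply: measurable_funB|apply: measurable_funD]; exact: measurable_funM.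
Qed.

Lemma chart_domainE (z w : R2 R) : D' (mulc2 z w, z) <->
  Normc.normc (of_R2 z : R[i]) * h (of_R2 w, 1%R : R[i]) < 1.
Proof.
have -> : Normc.normc (of_R2 z : R[i]) * h (of_R2 w, 1%R : R[i]) = h ((of_R2 z : R[i]) *: ((of_R2 w, 1%R : R[i]) : C2 R)).
  by rewrite gaugeZ.
rewrite /D'/= /balanced_domain/=.
suff -> : of_reals (mulc2 z w, z) = (of_R2 z : R[i]) *: ((of_R2 w, 1%R : R[i]) : C2 R) by [].
rewrite [RHS]surjective_pairing/= -[LHS]/(of_R2 (mulc2 z w), of_R2 z); congr pair.
  exact: of_R2_mulc2.
by rewrite -[LHS]mulr1.
Qed.

(* In the coordinates [z1 = z2 * l] the Lebesgue measure of C^2 is [|z2|^2 dl dz2]. *)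
Lemma integral4_chart_ge (f : R4 R -> \bar R) (A B : set (R2 R)) (c : R) : 0 <= c ->
  measurable A -> measurable B -> measurable_fun setT f -> (forall x, 0 <= f x)%E ->
  (forall z, B z -> sqabs z != 0) ->
  (forall z w, B z -> A w -> (c%:E <= (sqabs z)%:E * f (mulc2 z w, z))%E) ->
  (c%:E * mu2 A * mu2 B <= \int[lebesgue4]_x f x)%E.
Proof.
move=> c0 mA mB mf f0 B0 cf.
rewrite -[leRHS]/(\int[mu2 \x mu2]_x f x)%E (fubini_tonelli2 _ mf)//.
have cA0 : (0 <= c%:E * mu2 A)%E by rewrite mule_ge0.
apply: (@le_trans _ _ (\int[mu2]_z (c%:E * mu2 A * (\1_B z)%:E))%E).
  rewrite ge0_integralZl//; last by apply/measurable_EFinP; exact: measurable_indic.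
  by rewrite integral_indic// setIT.
have mfz z : measurable_fun setT (fun y => f (y, z)).
  by apply: (measurableT_comp mf); apply: measurable_fun_pair => //; exact: measurable_cst.
apply: ge0_le_integral => //.
- by move=> z _; rewrite mule_ge0.
- by apply: measurable_funeM; apply/measurable_EFinP; exact: measurable_indic.
- exact: measurable_fun_fubini_tonelli_G.
move=> z _; rewrite /fubini_G; have [Bz|nBz] := pselect (B z); last first.
  by rewrite indicE memNset// mule0 integral_ge0.
rewrite indicE mem_set// mule1 (ge0_integral_mulc2 (B0 z Bz))//.
have mfm : measurable_fun setT (fun w => f (mulc2 z w, z)).
  exact: (measurableT_comp (mfz z) (measurable_mulc2 (measurable_cst z) (@measurable_id _ _ _))).
rewrite -[X in (_ <= X)%E]ge0_integralZl//; last by rewrite lee_fin sqabs_ge0.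
apply: (@le_trans _ _ (\int[mu2]_w (c%:E * (\1_A w)%:E))%E).
  rewrite ge0_integralZl//; last by apply/measurable_EFinP; exact: measurable_indic.
  by rewrite integral_indic// setIT.
apply: ge0_le_integral => //.
- by move=> w _; rewrite mule_ge0.
- by apply: measurable_funeM; apply/measurable_EFinP; exact: measurable_indic.
- exact: measurable_funeM.
move=> w _; have [Aw|nAw] := pselect (A w).
  by rewrite indicE mem_set// mule1; exact: cf.
by rewrite indicE memNset// mule0 mule_ge0// lee_fin sqabs_ge0.
Qed.

Lemma integral4_patch (f : R4 R -> \bar R) :
  (\int[lebesgue4]_(x in D') f x = \int[lebesgue4]_x (f \_ D') x)%E.
Proof. exact: integral_mkcond. Qed.

(** A square inside an annulus about [a]. Squares replace the discs of the heuristic argument since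
    their measure is explicit, and the distance from the centre provides a lower bound for the
    integrand. *)
Lemma corner_square (a : R2 R) (r : R) (w : R2 R) : 0 < r ->
  square (a.1 + 3 / 8 * r, a.2 + 3 / 8 * r) (r / 8) w ->
  (r / 4) ^+ 2 <= sqdist a w < r ^+ 2.
Proof.
move=> r0 /squareP[/=]; rewrite !ler_norml /sqdist.
move: (w.1 : R) (w.2 : R) (a.1 : R) (a.2 : R) => x y p q /andP[h1 h2] /andP[h3 h4].
have x1 : r / 4 <= x - p by lra.
have x2 : x - p <= r / 2 by lra.
have y1 : r / 4 <= y - q by lra.
have y2 : y - q <= r / 2 by lra.
move: (x - p) (y - q) x1 x2 y1 y2 => s t x1 x2 y1 y2.
by apply/andP; split; nra.
Qed.

(** For r = exp (-s) and rho = exp (kappa s) / C, the points with |l - z0| of order r and |z2| of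
    order rho belong to the domain and contribute at least a constant times rho^(2b+4) r^2, that is,
    exp ((kappa (2b+4) - 2) s). One such set for each s is enough, as s -> oo. *)
Lemma pole_not_integrable (z0 : R2 R) (kappa C r0 : R) : 0 < kappa -> 0 < C -> 0 < r0 ->
  (forall l : R[i], 0 < Normc.normc (l - of_R2 z0) < r0 ->
     h (l, 1) <= C * expR (kappa * ln (Normc.normc (l - of_R2 z0)))) ->
  exists b : nat, ~ (\int[lebesgue4]_(x in D') ((sqabs x.2) ^+ b)%:E < +oo)%E.
Proof.
move=> k0 C0 r00 pole.
(* The bound 3, one more than the 2 lost to r^2, leaves at least exp s, which exceeds s. *)
have [b bk] : exists b : nat, 3 <= kappa * (2 * b%:R + 4).
  exists (Num.bound (2 / kappa)).
  have := archi_boundP (divr_ge0 (ler0n R 2) (ltW k0)); rewrite ltr_pdivrMr// => hb.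
  by lra.
exists b => I.
have mD := measurable_balanced_domain.
pose f := (fun x : R4 R => ((sqabs x.2) ^+ b)%:E) \_ D'.
have f0 x : (0 <= f x)%E.
  by rewrite /f patchE; case: ifP => // _; rewrite lee_fin exprn_ge0// sqabs_ge0.
have mf : measurable_fun setT f.
  apply/measurable_restrict => //; rewrite setTI; apply/measurable_EFinP.
  apply: measurable_funTS; apply: measurable_funX.
  exact: (measurableT_comp measurable_sqabs measurable_snd).
rewrite integral4_patch -/f in I.
have key (s : R) : - s < ln r0 ->
   ((expR (kappa * s) / C / 4) ^+ 2) ^+ b.+1 * (expR (- s) ^+ 2 / 16) * ((expR (kappa * s) / C) ^+ 2 / 16) <=
   fine (\int[lebesgue4]_x f x)%E.
  move=> sr; set r := expR (- s); set rho := expR (kappa * s) / C.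
  have r_gt0 : 0 < r by exact: expR_gt0.
  have rho0 : 0 < rho by rewrite divr_gt0// expR_gt0.
  have r8 : 0 <= r / 8 by rewrite divr_ge0// ltW.
  have rho8 : 0 <= rho / 8 by rewrite divr_ge0// ltW.
  have rho4 : 0 < rho / 4 by apply: divr_gt0.
  have sq0 (z : R2 R) : sqdist (0, 0) z = sqabs z by rewrite /sqdist /sqabs !subr0.
  have rr0 : r < r0 by rewrite -(@lnK _ r0)// ltr_expR.
  rewrite -lee_fin fineK; last by rewrite ge0_fin_numE// integral_ge0.
  have H := @integral4_chart_ge f (square (z0.1 + 3 / 8 * r, z0.2 + 3 / 8 * r) (r / 8))
    (square (0 + 3 / 8 * rho, 0 + 3 / 8 * rho) (rho / 8)) (((rho / 4) ^+ 2) ^+ b.+1).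
  apply: le_trans (H _ _ _ _ _ _ _) => //.
  - rewrite !lebesgue2_square//.
    rewrite -[leRHS]/((((rho / 4) ^+ 2) ^+ b.+1 * (4 * (r / 8) ^+ 2) * (4 * (rho / 8) ^+ 2))%:E) lee_fin.
    have sq (x : R) : 4 * (x / 8) ^+ 2 = x ^+ 2 / 16 by field.
    by rewrite !sq lexx.
  - by rewrite exprn_ge0// exprn_ge0// ltW.
  - exact: measurable_square.
  - exact: measurable_square.
  - move=> z /(@corner_square (0, 0) rho z rho0) /andP[z1 _].
    rewrite sq0 in z1.
    by rewrite gt_eqF// (lt_le_trans _ z1)// exprn_gt0.
  move=> z w /(@corner_square (0, 0) rho z rho0) zB /(corner_square r_gt0) wA.
  have {}zB : (rho / 4) ^+ 2 <= sqabs z < rho ^+ 2.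
    by move: zB; rewrite sq0.
  have {}wA : (r / 4) ^+ 2 <= Normc.normc (of_R2 w - of_R2 z0 : R[i]) ^+ 2 < r ^+ 2.
    by rewrite sqr_normc2.
  move: zB wA => /andP[z1 z2] /andP[w1 w2].
  have wr : Normc.normc (of_R2 w - of_R2 z0 : R[i]) < r.
    by rewrite -ltr_sqr ?nnegrE ?normc_ge0 ?(ltW r_gt0).
  have w0 : 0 < Normc.normc (of_R2 w - of_R2 z0 : R[i]).
    rewrite lt0r normc_ge0 andbT; apply/eqP => w0; move: w1; rewrite w0 expr0n/= leNgt.
    by rewrite exprn_gt0// divr_gt0.
  have zr : Normc.normc (of_R2 z : R[i]) < rho.
    by rewrite -ltr_sqr ?nnegrE ?normc_ge0 ?(ltW rho0)// -sqabsE.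
  have hw : h (of_R2 w, 1) <= C * expR (- (kappa * s)).
    apply: (le_trans (pole _ _)); first by rewrite w0 (lt_trans wr).
    rewrite ler_pM2l// ler_expR -mulrN ler_pM2l// -(expRK (- s)) ler_ln ?posrE ?expR_gt0//.
    exact: ltW.
  have Dz : D' (mulc2 z w, z).
    apply/chart_domainE.
    have rhoE : rho * (C * expR (- (kappa * s))) = 1.
      by rewrite /rho mulrA divfK ?gt_eqF// expRN divff// gt_eqF// expR_gt0.
    rewrite -rhoE; apply: (@le_lt_trans _ _ (Normc.normc (of_R2 z : R[i]) * (C * expR (- (kappa * s))))).
      by rewrite ler_wpM2l ?normc_ge0.
    by rewrite ltr_pM2r// mulr_gt0 ?expR_gt0.
  rewrite /f patchE mem_set//= -EFinM lee_fin -exprS.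
  by rewrite lerXn2r ?nnegrE ?sqabs_ge0// exprn_ge0// divr_ge0// ltW.
pose L := fine (\int[lebesgue4]_x f x)%E.
pose c := (((4 * C)^-1 ^+ 2) ^+ b.+1) * ((16 * C)^-1 ^+ 2).
have c0 : 0 < c by rewrite mulr_gt0 ?exprn_gt0 ?invr_gt0 ?mulr_gt0.
have key2 s : 0 <= s -> - s < ln r0 -> c * s <= L.
  move=> s0 /key; apply: le_trans.
  have -> : ((expR (kappa * s) / C / 4) ^+ 2) ^+ b.+1 * (expR (- s) ^+ 2 / 16) * ((expR (kappa * s) / C) ^+ 2 / 16) =
    c * expR ((kappa * (2 * b%:R + 4) - 2) * s).
    have -> : (kappa * (2 * b%:R + 4) - 2) * s = (kappa * s) * (2 * b.+1 + 2)%:R + (- s) * 2%:R.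
      by rewrite natrD natrM -natr1; ring.
    rewrite expRD !expRM_natr exprD exprM /c.
    have -> : (expR (kappa * s) / C / 4) ^+ 2 = (4 * C)^-1 ^+ 2 * expR (kappa * s) ^+ 2.
      by field; rewrite gt_eqF.
    rewrite exprMn; move: ((_ ^+ 2) ^+ b.+1) ((_ ^+ 2) ^+ b.+1) => X Y.
    by field; rewrite gt_eqF.
  rewrite ler_pM2l//; apply: le_trans (expR_ge1Dx _).
  apply: (@le_trans _ _ ((kappa * (2 * b%:R + 4) - 2) * s)); last by rewrite lerDr.
  by rewrite ler_peMl//; lra.
(* Large enough for the radius to be below [r0] and for c s to exceed the value [L] of the
   integral. *)
pose s := `|ln r0| + 1 + `|L / c|.
have s0 : 0 <= s by rewrite !addr_ge0.
have sr : - s < ln r0.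
  by have := ler_norm (- ln r0); have := normr_ge0 (L / c); rewrite normrN /s; lra.
have := key2 s s0 sr; rewrite mulrC -ler_pdivlMr//.
by have := ler_norm (L / c); have := normr_ge0 (ln r0); rewrite /s; lra.
Qed.

End divergence.

(** * Finiteness over a cone in the chart *)

Section convergence.
Context {R : realType}.
Local Notation mu2 := (@lebesgue2 R).

Lemma mulc2_sqabs (z w : R2 R) : sqabs (mulc2 z w) = sqabs z * sqabs w.
Proof. by rewrite !sqabsE of_R2_mulc2 Normc.normcM exprMn. Qed.

Lemma integral2_le_square (g : R2 R -> \bar R) (a c : R) : 0 <= a -> 0 <= c ->
  measurable_fun setT g -> (forall z, 0 <= g z)%E ->
  (forall z, square (0, 0) a z -> (g z <= c%:E)%E) ->
  (forall z, ~ square (0, 0) a z -> (g z <= 0)%E) ->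
  (\int[mu2]_z g z <= (c * (4 * a ^+ 2))%:E)%E.
Proof.
move=> a0 c0 mg g0 gi go; have mS := @measurable_square R (0, 0) a.
apply: (@le_trans _ _ (\int[mu2]_z (c%:E * (\1_(square (0, 0) a) z)%:E))%E); last first.
  rewrite ge0_integralZl//; last by apply/measurable_EFinP; exact: measurable_indic.
  apply: (@le_trans _ _ (c%:E * mu2 (square (0%R, 0%R) a))%E); first by rewrite integral_indic// setIT.
  by rewrite lebesgue2_square.
apply: ge0_le_integral => //.
- by apply: measurable_funeM; apply/measurable_EFinP; exact: measurable_indic.
move=> w _; have [Aw|nAw] := pselect (square (0, 0) a w).
  by rewrite indicE mem_set// mule1; exact: gi.
by rewrite indicE memNset// mule0; exact: go.
Qed.

Variable h : C2 R -> R.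
Hypothesis hg : homogeneous_gauge h.
Let D' := of_reals @^-1` (balanced_domain h) : set (R4 R).

(** The part |z1 / z2| <= M of the chart, written without division; it meets z2 = 0 only at the
    origin. *)
Definition cone (M : R) : set (R4 R) := [set x | sqabs x.1 <= M ^+ 2 * sqabs x.2].

Lemma measurable_cone M : measurable (cone M).
Proof.
pose d (x : R4 R) := M ^+ 2 * sqabs x.2 - sqabs x.1.
have md : measurable_fun setT d.
  apply: measurable_funB; last exact: (measurableT_comp measurable_sqabs measurable_fst).
  by apply: measurable_funM => //; exact: (measurableT_comp measurable_sqabs measurable_snd).
have := md measurableT `[0, +oo[%classic (measurable_itv _); rewrite setTI.
by congr measurable; apply/seteqP; split => x /=; rewrite in_itv/= andbT subr_ge0.
Qed.

Definition weight (m : nat) (x : R4 R) : \bar R := ((1 + (sqabs x.1 + sqabs x.2)) ^+ m)%:E.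

Lemma measurable_weight m : measurable_fun setT (weight m).
Proof.
apply/measurable_EFinP; apply: measurable_funX; apply: measurable_funD => //.
by apply: measurable_funD; [exact: (measurableT_comp measurable_sqabs measurable_fst)|
  exact: (measurableT_comp measurable_sqabs measurable_snd)].
Qed.

Lemma weight_ge0 m x : (0 <= weight m x)%E.
Proof. by rewrite lee_fin exprn_ge0// addr_ge0// addr_ge0 ?sqabs_ge0. Qed.

Definition cone_weight (M : R) (m : nat) : R4 R -> \bar R := weight m \_ (D' `&` cone M).

Lemma measurable_cone_weight M m : measurable_fun setT (cone_weight M m).
Proof.
have mD : measurable (D' `&` cone M).
  by apply: measurableI; [exact: measurable_balanced_domain|exact: measurable_cone].
apply/measurable_restrict => //; rewrite setTI; apply: measurable_funTS; exact: measurable_weight.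
Qed.

Lemma cone_weight_ge0 M m x : (0 <= cone_weight M m x)%E.
Proof. by rewrite /cone_weight patchE; case: ifP => // _; exact: weight_ge0. Qed.

Let chart_weight M m (z w : R2 R) : \bar R := ((sqabs z)%:E * cone_weight M m (mulc2 z w, z))%E.

Let chart_weight_ge0 M m z w : (0 <= chart_weight M m z w)%E.
Proof. by rewrite mule_ge0 ?lee_fin ?sqabs_ge0 ?cone_weight_ge0. Qed.

Let measurable_chart_weight M m : measurable_fun setT (fun x : R4 R => chart_weight M m x.1 x.2).
Proof.
apply: emeasurable_funM.
  by apply/measurable_EFinP; exact: (measurableT_comp measurable_sqabs measurable_fst).
apply: (measurableT_comp (measurable_cone_weight M m)).
by apply: measurable_fun_pair => //; exact: measurable_mulc2.
Qed.

(** For z != 0 this is the change of variables z1 = l z2. At z = 0 the chart degenerates, but there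
    the fibre of the cone is a single point, a square of half side 0, and the left-hand side
    vanishes. *)
Let chart_weight_fiber M m z :
  (\int[mu2]_y cone_weight M m (y, z) <= \int[mu2]_w chart_weight M m z w)%E.
Proof.
have mf : measurable_fun setT (fun y => cone_weight M m (y, z)).
  apply: (measurableT_comp (measurable_cone_weight M m)).
  by apply: measurable_fun_pair => //; exact: measurable_cst.
have [z0|z0] := eqVneq (sqabs z) 0.
  apply: (@le_trans _ _ 0%E); last by apply: integral_ge0 => w _; exact: chart_weight_ge0.
  have := @integral2_le_square (fun y => cone_weight M m (y, z)) 0 1.
  rewrite expr0n/= !mulr0; apply => //.
  - by move=> y; exact: cone_weight_ge0.
  - move=> y /squareP[/=]; rewrite !subr0 !normr_le0 => /eqP y1 /eqP y2.
    rewrite /cone_weight patchE; case: ifP => // _.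
    by rewrite /weight/= z0 /sqabs y1 y2 expr0n/= !addr0 expr1n.
  - move=> y ny; rewrite /cone_weight patchE; case: ifPn => //; rewrite inE => -[_].
    rewrite /cone/= z0 mulr0 => y0; exfalso; apply: ny; apply/squareP => /=.
    have y1 := sqr_ge0 y.1; have y2 := sqr_ge0 y.2; rewrite /sqabs in y0.
    have e1 : y.1 ^+ 2 = 0 by apply/eqP; rewrite eq_le y1 andbT; move: y0 y2; lra.
    have e2 : y.2 ^+ 2 = 0 by apply/eqP; rewrite eq_le y2 andbT; move: y0 y1; lra.
    move: e1 e2 => /eqP; rewrite sqrf_eq0 => /eqP -> /eqP; rewrite sqrf_eq0 => /eqP ->.
    by rewrite subrr normr0.
have mfm : measurable_fun setT (fun w => cone_weight M m (mulc2 z w, z)).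
  exact: (measurableT_comp mf (measurable_mulc2 (measurable_cst z) (@measurable_id _ _ _))).
rewrite (ge0_integral_mulc2 z0 mf); last by move=> y; exact: cone_weight_ge0.
rewrite -[X in (X <= _)%E]ge0_integralZl//; first by move=> w _; exact: cone_weight_ge0.
by rewrite lee_fin sqabs_ge0.
Qed.

(** The summand 1 of the weight is absorbed into a multiple of a2 = 1 / h^2, which is possible
    because [h] is bounded on the slice over a bounded set; a pure power of 1 / h remains. *)
Let weight_bound (q a2 H2 M2 : R) m : 0 <= q -> q <= a2 -> 1 <= H2 * a2 -> 0 <= M2 ->
  q * (1 + (M2 * q + q)) ^+ m <= a2 * ((H2 + M2 + 1) * a2) ^+ m.
Proof.
move=> q0 qa Ha M0; have a0 : 0 <= a2 := le_trans q0 qa.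
apply: ler_pM => //; first by rewrite exprn_ge0// addr_ge0// addr_ge0// mulr_ge0.
apply: lerXn2r; rewrite ?nnegrE; [by rewrite addr_ge0// addr_ge0// mulr_ge0|by nra|].
have := ler_wpM2l M0 qa; nra.
Qed.

(** For fixed l the domain is |z2| < a = 1 / h (l, 1). The Jacobian contributes a^2, the weight
    a^(2m) and the area a^2, so the integral over z2 is at most a constant times a^(2m+4): this is
    the exponent in the hypothesis. *)
Lemma cone_weight_integrable (M : R) (m : nat) : 0 < M ->
  integrably_dominated (fun w => expeR ((2 * m + 4)%:R%:E * - log_fun h (of_R2 w, 1%R : R[i]))%E)
    (square (0, 0) M) ->
  (\int[lebesgue4]_x cone_weight M m x < +oo)%E.
Proof.
move=> M0 [phi [mphi phi0 ephi iphi]].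
have [K K0 hK] := gauge_bound hg.
pose H := K * (2 * M + 1).
have H0 : 0 < H by rewrite mulr_gt0// addr_gt0// mulr_gt0.
pose C := 4 * (H ^+ 2 + M ^+ 2 + 1) ^+ m.
have C0 : 0 < C by rewrite mulr_gt0// exprn_gt0// ltr_wpDl// addr_ge0// sqr_ge0.
rewrite -[X in (X < _)%E]/(\int[mu2 \x mu2]_x cone_weight M m x)%E.
rewrite (fubini_tonelli2 _ (measurable_cone_weight M m)); last by move=> x; exact: cone_weight_ge0.
have mc := measurable_chart_weight M m.
have mswap : measurable_fun setT (fun x : R4 R => chart_weight M m x.2 x.1).
  have ms : measurable_fun setT (fun x : R4 R => (x.2, x.1) : R4 R).
    by apply: measurable_fun_pair; [exact: measurable_snd|exact: measurable_fst].
  exact: (measurableT_comp mc ms).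
apply: (@le_lt_trans _ _ (\int[mu2]_z \int[mu2]_w chart_weight M m z w)%E).
  apply: ge0_le_integral => //.
  - by move=> z _; apply: integral_ge0 => y _; exact: cone_weight_ge0.
  - by apply: measurable_fun_fubini_tonelli_G; [exact: measurable_cone_weight|exact: cone_weight_ge0].
  - by apply: (@measurable_fun_fubini_tonelli_F _ _ _ _ _ mu2 (fun x : R4 R => chart_weight M m x.1 x.2)) => //; exact: mc.
  - by move=> z _; exact: chart_weight_fiber.
have -> : (\int[mu2]_z \int[mu2]_w chart_weight M m z w = \int[mu2]_w \int[mu2]_z chart_weight M m z w)%E.
  exact: (fubini_tonelli (fun x : R4 R => chart_weight M m x.1 x.2)).
apply: (@le_lt_trans _ _ (\int[mu2]_w (C%:E * phi w))%E); last first.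
  rewrite ge0_integralZl ?lee_fin ?(ltW C0)//.
  by rewrite lte_mul_pinfty ?lee_fin ?(ltW C0).
apply: ge0_le_integral => //.
- by move=> w _; apply: integral_ge0 => z _; exact: chart_weight_ge0.
- by apply: (@measurable_fun_fubini_tonelli_G _ _ _ _ _ mu2 (fun x : R4 R => chart_weight M m x.1 x.2)) => //; exact: mc.
- exact: measurable_funeM.
move=> w _.
have support z : ~~ (sqabs w <= M ^+ 2) \/ ~~ (Normc.normc (of_R2 z : R[i]) * h (of_R2 w, 1%R : R[i]) < 1) ->
    chart_weight M m z w = 0%E.
  move=> nE; rewrite /chart_weight; have [z0|z0] := eqVneq (sqabs z) 0; first by rewrite z0 mul0e.
  rewrite /cone_weight patchE; case: ifPn => [|_]; last by rewrite mule0.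
  rewrite inE => -[/chart_domainE -/(_ hg) Dz]; rewrite /cone/= mulc2_sqabs mulrC.
  rewrite ler_pM2r ?lt0r ?z0 ?sqabs_ge0// => wM.
  by case: nE => /negP; [rewrite wM|rewrite Dz].
have Cphi : (0 <= C%:E * phi w)%E by rewrite mule_ge0// lee_fin ltW.
have [wM|wM] := boolP (sqabs w <= M ^+ 2); last first.
  rewrite (eq_integral (cst 0%E)) ?integral0//.
  by move=> z _; rewrite support//; left.
have nw : Normc.normc (of_R2 w : R[i]) <= M.
  by rewrite -ler_sqr ?nnegrE ?normc_ge0 ?(ltW M0)// -sqabsE.
have wS : square (0, 0) M w.
  apply/squareP; rewrite /= !subr0; split.
    by apply: le_trans nw; exact: (normc_ge_Re (of_R2 w : R[i])).
  by apply: le_trans nw; exact: (normc_ge_Im (of_R2 w : R[i])).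
have := ephi w wS; set hw := h (of_R2 w, 1%R : R[i]) in support *.
(* Where h (l, 1) = 0 the fibre is unbounded, but the majorant [phi] is then infinite. *)
have [h0|h0] := eqVneq hw 0.
  rewrite log_fun0//.
  have -> : ((2 * m + 4)%:R%:E * - -oo = +oo :> \bar R)%E.
    by rewrite /= gt0_muley// lte_fin ltr0n addn_gt0 orbT.
  rewrite leye_eq => /eqP ->.
  by rewrite gt0_muley ?lte_fin// leey.
have hw0 : 0 < hw by rewrite lt0r h0 gauge_ge0.
rewrite (log_funE hg)// -/hw => hphi.
have hH : hw <= H.
  apply: (le_trans (hK _)).
  rewrite -[leLHS]/(K * (Normc.normc (of_R2 w : R[i]) + Normc.normc (1%:C : R[i]))).
  rewrite normc_realC normr1 ler_pM2l// lerD2r.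
  by apply: (le_trans nw); rewrite ler_peMl ?(ltW M0)// ler1n.
pose a := hw^-1; have a0 : 0 < a by rewrite invr_gt0.
have Ha : 1 <= H ^+ 2 * a ^+ 2.
  by rewrite -exprMn exprn_ege1// /a ler_pdivlMr// mul1r.
apply: (@le_trans _ _ ((a ^+ 2 * ((H ^+ 2 + M ^+ 2 + 1) * a ^+ 2) ^+ m) * (4 * a ^+ 2))%:E).
  have B0 : 0 <= a ^+ 2 * ((H ^+ 2 + M ^+ 2 + 1) * a ^+ 2) ^+ m.
    by rewrite mulr_ge0 ?sqr_ge0// exprn_ge0// mulr_ge0 ?sqr_ge0// addr_ge0// addr_ge0// sqr_ge0.
  have za z : Normc.normc (of_R2 z : R[i]) * hw < 1 -> Normc.normc (of_R2 z : R[i]) < a.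
    by rewrite -ltr_pdivlMr// div1r.
  apply: integral2_le_square => //.
  - exact: ltW.
  - exact: (measurableT_comp mswap (measurable_fun_pair (measurable_cst w) (@measurable_id _ _ _))).
  - move=> z zS; have [zh|zh] := boolP (Normc.normc (of_R2 z : R[i]) * hw < 1); last first.
      by rewrite support ?lee_fin//; right.
    rewrite /chart_weight /cone_weight patchE; case: ifPn => [|_]; last by rewrite mule0 lee_fin.
    rewrite inE => -[_ zE]; rewrite /weight -EFinM lee_fin /=.
    have qa : sqabs z <= a ^+ 2.
      by rewrite sqabsE ler_sqr ?nnegrE ?normc_ge0 ?(ltW a0)// ltW// za.
    apply: le_trans (weight_bound m (sqabs_ge0 z) qa Ha (sqr_ge0 M)).
    rewrite ler_wpM2l ?sqabs_ge0// lerXn2r ?nnegrE//.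
    + by rewrite addr_ge0// addr_ge0 ?sqabs_ge0.
    + by rewrite addr_ge0// addr_ge0 ?sqabs_ge0// mulr_ge0 ?sqr_ge0 ?sqabs_ge0.
    + by rewrite lerD2l lerD2r.
  - move=> z zS; rewrite support//; right; apply/negP => /za za'; apply: zS.
    apply/squareP; rewrite /= !subr0; split; apply: ltW; apply: le_lt_trans za'.
      exact: (normc_ge_Re (of_R2 z : R[i])).
    exact: (normc_ge_Im (of_R2 z : R[i])).
apply: (@le_trans _ _ (C%:E * (expR ((2 * m + 4)%:R * - ln hw))%:E)%E); last first.
  by rewrite lee_wpmul2l ?lee_fin ?(ltW C0).
rewrite -EFinM lee_fin mulrC expRM_natl -lnV ?posrE// lnK ?posrE// -/a exprD exprM /C exprMn.
have -> : a ^+ 4 = a ^+ 2 * a ^+ 2 by rewrite -exprD.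
by rewrite le_eqVlt; apply/orP; left; apply/eqP; move: ((a ^+ 2) ^+ m) => X; ring.
Qed.

End convergence.

Section square_integrability.
Context {R : realType}.
Variable h : C2 R -> R.
Hypothesis hg : homogeneous_gauge h.

(** The cones |z1| <= |z2| / s and |z2| <= s |z1| cover C^2; the second one is the first kind of
    cone for the exchanged gauge. *)
Lemma poly_fun_L2h (s : R) (m : nat) P (C : R) : 0 < s -> 0 <= C ->
  (forall z : C2 R, Normc.normc (poly_fun P z) ^+ 2 <= C * (1 + sqnorm z) ^+ m) ->
  (\int[lebesgue4]_x cone_weight h s^-1 m x < +oo)%E ->
  (\int[lebesgue4]_x cone_weight (swap_gauge h) s m x < +oo)%E ->
  L2h (balanced_domain h) (poly_fun P).
Proof.
move=> s0 C0 PC I1 I2; split; first by move=> z _; exact: poly_fun_differentiable.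
have [mRe mIm] := measurable_poly_fun P.
split; [exact: measurable_funTS|exact: measurable_funTS|].
have mD := measurable_balanced_domain hg.
have hgs := swap_gauge_homogeneous hg.
pose w1 x := cone_weight h s^-1 m x.
pose w2 (x : R4 R) := cone_weight (swap_gauge h) s m (x.2, x.1).
have mw1 : measurable_fun setT w1 by exact: measurable_cone_weight.
have mw2 : measurable_fun setT w2.
  have ms : measurable_fun setT (fun x : R4 R => (x.2, x.1) : R4 R).
    by apply: measurable_fun_pair; [exact: measurable_snd|exact: measurable_fst].
  exact: (measurableT_comp (measurable_cone_weight hgs s m) ms).
have w10 x : (0 <= w1 x)%E by exact: cone_weight_ge0.
have w20 x : (0 <= w2 x)%E by exact: cone_weight_ge0.
rewrite integral_mkcond.
apply: (@le_lt_trans _ _ (\int[lebesgue4]_x (C%:E * (w1 x + w2 x)))%E); last first.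
  rewrite ge0_integralZl ?lee_fin//; last 2 first.
  - exact: emeasurable_funD.
  - by move=> x _; rewrite adde_ge0.
  apply: lte_mul_pinfty; rewrite ?lee_fin//.
  rewrite ge0_integralD// lte_add_pinfty//.
  by rewrite (lebesgue4_swap (measurable_cone_weight hgs s m))// => x; exact: cone_weight_ge0.
apply: ge0_le_integral => //.
- by move=> x _; rewrite patchE; case: ifP => // _; rewrite lee_fin sqr_ge0.
- apply/measurable_restrict => //; rewrite setTI; apply: measurable_funTS; apply/measurable_EFinP.
  exact: measurable_sqr_poly_fun.
- by apply: measurable_funeM; exact: emeasurable_funD.
move=> x _; rewrite patchE; case: ifPn => [|_]; last by rewrite mule_ge0 ?lee_fin// adde_ge0.
rewrite inE => Dx.
have PE : (((Normc.normc (poly_fun P (of_reals x))) ^+ 2)%:E <= C%:E * weight m x)%E.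
  rewrite /weight -EFinM lee_fin; apply: (le_trans (PC _)).
  by rewrite /sqnorm !sqabsE.
apply: (le_trans PE); rewrite lee_wpmul2l ?lee_fin//.
have [c1|c1] := boolP (sqabs x.1 <= s^-1 ^+ 2 * sqabs x.2).
  by rewrite /w1 /cone_weight patchE mem_set// leeDl.
have c2 : sqabs x.2 <= s ^+ 2 * sqabs x.1.
  move: c1; rewrite -ltNge exprVn mulrC ltr_pdivrMr ?exprn_gt0// mulrC => c1; exact: ltW.
rewrite /w2 /cone_weight patchE mem_set//.
by rewrite /weight/= [(sqabs x.2 + _)%R]addrC leeDr.
Qed.

End square_integrability.

(** * The two implications *)

Section polynomials_in_L2h.
Context {R : realType}.
Variable h : C2 R -> R.
Hypotheses (hg : homogeneous_gauge h) (hp : pseudoconvex_gauge h)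
  (h_neq0 : exists z, h z != 0).

Let of_R2K (z : R[i]) : of_R2 (complex.Re z, complex.Im z) = z.
Proof. by case: z. Qed.

(** The order of the choices matters: integrability near l = oo fixes s, and compactness then treats
    the square of half side 1 / s in the other chart. *)
Lemma L2h_polynomials : (forall v : C2 R, v != 0 -> lelong_proj (log_fun h) v = 0%E) ->
  forall P : {poly {poly R[i]}}, L2h (balanced_domain h) (poly_fun P).
Proof.
move=> lel0 P; have [C [m [C0 PC]]] := poly_fun_growth P.
have hgs := swap_gauge_homogeneous hg; have hps := swap_gauge_pseudoconvex hp.
have hs0 := swap_gauge_neq0 h_neq0.
have c0 : 0 < (2 * m + 4)%:R :> R by rewrite ltr0n addn_gt0 orbT.
have [s s0 dom2] : exists2 s : R, 0 < s & integrably_dominated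
    (fun z => expeR ((2 * m + 4)%:R%:E * - log_fun (swap_gauge h) (of_R2 z, 1%R : R[i]))%E) (square (0, 0) s).
  apply: slice_lelong0 => //.
  have v0 : ((1, 0) : C2 R) != 0 by rewrite xpair_eqE oner_eq0.
  by have := lel0 _ v0; rewrite /lelong_proj/= eqxx.
have dom1 : integrably_dominated
    (fun z => expeR ((2 * m + 4)%:R%:E * - log_fun h (of_R2 z, 1%R : R[i]))%E) (square (0, 0) s^-1).
  apply: integrably_dominated_square => x _; apply: slice_lelong0 => //.
  have v0 : ((of_R2 x, 1) : C2 R) != 0 by rewrite xpair_eqE oner_eq0 andbF.
  by have := lel0 _ v0; rewrite /lelong_proj/= oner_eq0.
apply: (poly_fun_L2h hg s0 C0 PC); apply: cone_weight_integrable => //.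
by rewrite invr_gt0.
Qed.

Lemma monomial_not_integrable (v : C2 R) : v.2 != 0 ->
  lelong (fun l : C1 R => log_fun h (l, v.2)) v.1 != 0%E ->
  exists b : nat, ~ (\int[lebesgue4]_(x in of_reals @^-1` balanced_domain h) ((sqabs x.2) ^+ b)%:E < +oo)%E.
Proof.
move=> v2 lel.
have [kappa [C [r0 [k0 C0 r00 hk]]]] := slice_pole hg hp h_neq0 v2 lel.
apply: (@pole_not_integrable _ h hg (complex.Re (v.1 / v.2), complex.Im (v.1 / v.2)) kappa C r0) => // l.
by rewrite of_R2K; exact: hk.
Qed.

End polynomials_in_L2h.

(** A nonzero Lelong number excludes a power of one coordinate: of z2, the polynomial ['X^b], when
    v.2 != 0, and otherwise of z1, the constant polynomial over ['X^b], after an exchange of the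
    coordinates. *)
Lemma L2h_polynomials_lelong {R : realType} (h : C2 R -> R) :
  homogeneous_gauge h -> pseudoconvex_gauge h -> (exists z, h z != 0) ->
  (forall P : {poly {poly R[i]}}, L2h (balanced_domain h) (poly_fun P)) ->
  forall v : C2 R, v != 0 -> lelong_proj (log_fun h) v = 0%E.
Proof.
move=> hg hp h_neq0 L2P v v0; apply/eqP; apply: contrapT => /negP.
have normX (z : R2 R) b : (Normc.normc ((of_R2 z : R[i]) ^+ b)) ^+ 2 = (sqabs z) ^+ b.
  rewrite sqabsE; elim: b => [|b IH]; first by rewrite !expr0 (normc_realC 1) normr1 expr1n.
  by rewrite !(exprS _ b) Normc.normcM exprMn IH.
rewrite /lelong_proj; case: ifPn => [v2|/negPn/eqP v2] lel.
  have [b] := monomial_not_integrable hg hp h_neq0 v2 lel; apply.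
  have [_ [_ _]] := L2P 'X^b; congr (_ < _)%E; apply: eq_integral => x _.
  by rewrite /poly_fun hornerXn -polyC_exp hornerC -normX.
have hgs := swap_gauge_homogeneous hg; have hps := swap_gauge_pseudoconvex hp.
have hs0 := swap_gauge_neq0 h_neq0.
have v1 : (v.2, v.1).2 != 0.
  by apply: contra v0 => /eqP /= v1; rewrite (surjective_pairing v) v1 v2.
have [b] := @monomial_not_integrable _ _ hgs hps hs0 (v.2, v.1) v1 lel; apply.
have [_ [_ _]] := L2P ('X^b)%:P; congr (_ < _)%E.
have mD := measurable_balanced_domain hg; have mDs := measurable_balanced_domain hgs.
rewrite [LHS]integral_mkcond [RHS]integral_mkcond; set F := _ \_ _.
have mF : measurable_fun setT F.
  apply/measurable_restrict => //; rewrite setTI; apply: measurable_funTS; apply/measurable_EFinP.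
  exact: measurable_sqr_poly_fun.
have F0 x : (0 <= F x)%E by rewrite /F patchE; case: ifP => // _; rewrite lee_fin sqr_ge0.
rewrite -[LHS](lebesgue4_swap mF F0); apply: eq_integral => x _; rewrite /F !patchE.
have -> : ((x.2, x.1) \in of_reals @^-1` balanced_domain h) = (x \in of_reals @^-1` balanced_domain (swap_gauge h)).
  by apply/idP/idP; rewrite !inE.
by case: ifP => // _; rewrite /poly_fun hornerC hornerXn -normX.
Qed.

Theorem corollary15 (R : realType) (h : C2 R -> R)
    (h_gauge : homogeneous_gauge h)
    (h_psc : pseudoconvex_gauge h)
    (h_neq0 : exists z, h z != 0) :
  (forall P : {poly {poly R[i]}}, L2h (balanced_domain h) (poly_fun P)) <->
  (forall v : C2 R, v != 0 -> lelong_proj (log_fun h) v = 0%E).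
Proof.
split; first exact: L2h_polynomials_lelong.
exact: L2h_polynomials.
Qed.
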